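(* Let $d_0 \geq 2$ and let $\mathcal{T}_{[d_0]}$ be the rooted tree in which every vertex has exactly $d_0-1$ offspring (so every non-root vertex has $d_0$ neighbours). If $d_0 \geq 1287$ then $\big[ d_0^{-1} + 3 d_0^{-2}, \infty\big) \subseteq \mathscr{T}^{\mathcal{T}_{[d_0]}}$. Moreover, for any $\epsilon > 0$ there exists $d_0' \in \mathbb{N}$ such that if $d_0 \geq d_0'$ then $\big[ d_0^{-1} + (\tfrac{13}{6} + \epsilon) d_0^{-2}, \infty\big) \subseteq \mathscr{T}^{\mathcal{T}_{[d_0]}}$.
   Context: For a graph $G$, $\mathscr{T}^G$ denotes the set of $T>0$ such that the random stirring model on $G$ with parameter $T$ has infinite cycles (cycles with infinitely many elements) almost surely. The random stirring model with parameter $T$ is the random permutation $\sigma_T$ of $V(G)$, where $(\sigma_t)_{t\ge0}$ starts at the identity and, independently for each edge $e$, the transposition of the endpoints of $e$ is composed at each point of a rate-one Poisson process on $[0,\infty)$. *)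

(* Defs.v *)
From HB Require Import structures.
From mathcomp Require Import all_boot all_order all_algebra.
From mathcomp Require Import all_classical all_reals all_analysis.
Set Implicit Arguments. Unset Strict Implicit. Unset Printing Implicit Defensive.
Import Order.TTheory GRing.Theory Num.Theory.
Local Open Scope classical_set_scope.
Local Open Scope ring_scope.

(* The rooted tree T_[d0]: every vertex has exactly d0-1 offspring.         *)
(* A vertex is a finite word over the alphabet 'I_(d0-1); the root is [::]  *)
(* and the children of v are the words i :: v.                             *)
Definition tvert (d0 : nat) : Type := seq 'I_(d0.-1).

Definition tadj (d0 : nat) (u v : tvert d0) : bool :=
  ((v != [::]) && (behead v == u)) || ((u != [::]) && (behead u == v)).

(* Edges are indexed by their child endpoint (a non-empty word):           *)
(* the edge indexed by w (w != [::]) joins w and its parent  behead w.      *)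
Definition tedge_of (d0 : nat) (u v : tvert d0) : tvert d0 :=
  if (size u < size v)%N then v else u.

Definition tincident (d0 : nat) (v w : tvert d0) : bool :=
  (w != [::]) && ((w == v) || (behead w == v)).

Section Stirring.
Context {R : realType} (d0 : nat) {dO : measure_display} {Omega : measurableType dO}.

(* N e w t : number of rings of the clock of edge e in [0, t] (outcome w). *)
Definition rings_at (N : tvert d0 -> Omega -> R -> nat) (e : tvert d0)
    (om : Omega) (t : R) : Prop :=
  0 < t /\ forall s, 0 <= s -> s < t -> (N e om s < N e om t)%N.

Definition poisson_clocks (P : probability Omega R)
    (N : tvert d0 -> Omega -> R -> nat) : Prop :=
  (forall e om, N e om 0 = 0%N) /\
  (forall e om s t, 0 <= s -> s <= t -> (N e om s <= N e om t)%N) /\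
  (forall e om t, 0 <= t -> exists2 delta : R, 0 < delta &
       forall s, t <= s -> s < t + delta -> N e om s = N e om t) /\
  (forall e t, measurable_fun setT (fun om => (N e om t)%:R : R)) /\
  (* finite-dimensional distributions: increments over disjoint intervals *)
  (* (across all edges) are independent and Poisson(length) distributed.  *)
  (forall (s : seq (tvert d0 * R * R * nat)),
     (forall k, (k < size s)%N ->
        let: (e, a, b, _) := nth ([::], 0, 0, 0%N) s k in
        e != [::] /\ 0 <= a /\ a < b) ->
     (forall k l, (k < size s)%N -> (l < size s)%N -> k <> l ->
        let: (e1, a1, b1, _) := nth ([::], 0, 0, 0%N) s k in
        let: (e2, a2, b2, _) := nth ([::], 0, 0, 0%N) s l in
        e1 = e2 -> b1 <= a2 \/ b2 <= a1) ->
     P [set om | forall k, (k < size s)%N ->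
        let: (e, a, b, n) := nth ([::], 0, 0, 0%N) s k in
        (N e om b - N e om a)%N = n]
     = (\prod_(q <- s) (poisson_pmf (q.1.2 - q.1.1.2) q.2)%:E)%E).

(* stir_rel N om T x y : following the stirring dynamics up to time T, the  *)
(* element starting at vertex x is at vertex y at time T, i.e. there are    *)
(* successive jumps x = v_0 -> v_1 -> ... -> v_k = y at times               *)
(* 0 < t_1 < ... < t_k <= T, the jump at t_i across the ring of the edge    *)
(* {v_(i-1), v_i}, with no ring of an edge incident to v_(i-1) strictly     *)
(* between t_(i-1) and t_i, and no ring incident to y in (t_k, T].          *)
Definition stir_rel (N : tvert d0 -> Omega -> R -> nat) (om : Omega) (T : R)
    (x y : tvert d0) : Prop :=
  exists (vs : seq (tvert d0)) (ts : seq R),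
    size vs = size ts /\
    last x vs = y /\
    (forall i, (i < size ts)%N -> nth 0 (0 :: ts) i < nth 0 (0 :: ts) i.+1) /\
    last 0 ts <= T /\
    (forall i, (i < size vs)%N ->
       let u := nth x (x :: vs) i in
       let v := nth x (x :: vs) i.+1 in
       let a := nth 0 (0 :: ts) i in
       let b := nth 0 (0 :: ts) i.+1 in
       tadj u v /\ rings_at N (tedge_of u v) om b /\
       forall w, tincident u w ->
         forall s, a < s -> s < b -> N w om s = N w om a) /\
    (forall w, tincident y w -> N w om T = N w om (last 0 ts)).

Definition stirring_infinite_cycle (N : tvert d0 -> Omega -> R -> nat)
    (om : Omega) (T : R) : Prop :=
  exists sigma : tvert d0 -> tvert d0,
    bijective sigma /\
    (forall x y, stir_rel N om T x y <-> sigma x = y) /\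
    exists x, ~ finite_set
      [set y | exists n : nat, iter n sigma x = y \/ iter n sigma y = x].

End Stirring.

Definition in_scrT {R : realType} (d0 : nat) (T : R) : Prop :=
  0 < T /\
  forall (dO : measure_display) (Omega : measurableType dO)
         (P : probability Omega R) (N : tvert d0 -> Omega -> R -> nat),
    poisson_clocks P N ->
    {ae P, forall om, stirring_infinite_cycle N om T}.

(* Main.v *)
From HB Require Import structures.
From mathcomp Require Import all_boot all_order all_algebra.
From mathcomp Require Import boolp reals.
From mathcomp.analysis Require Import sequences exp.
From mathcomp Require Import lra zify ring.
Set Implicit Arguments. Unset Strict Implicit. Unset Printing Implicit Defensive.
Import Order.TTheory GRing.Theory Num.Theory.
Local Open Scope ring_scope.

(** The walk of a particle is followed along the poles [{v} x [0, T)] of the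
    tree, a bar joining two poles wherever an edge rings; an orbit of the
    permutation is finite iff the walk closes up.  Time is cut into [M] cells and
    the tree at level [n], so that the bars become finitely many independent
    bits, and a lower bound for the probability that the walk reaches level [n],
    uniform in [n] and in large [M], is wanted.  Write [d] for the number of
    offspring.

    If [d T <= 20], a child joined to its parent by a single bar is certainly
    visited by a closed walk unless the bars of a sibling straddle that bar.  The
    resulting branching process has mean at least
    [d T (1 - T) (1 - d T^2 / 6)] up to [O(1 / M)], and this exceeds [1].

    If [d T >= 20], let [rho] bound the probability that the walk leaves a
    subtree it has just entered, in the presence of independent bars on the edge
    above.  The first bar met almost always leads to some child [w]; if the walk
    comes back from [w] (probability at most [rho]), then following the walk
    that only [w] would generate one almost always meets a bar to a second,
    untouched child, from which the walk comes back with probability at most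
    [rho] again.  The inequality [rho' <= small + rho (small + rho)] keeps [rho]
    below [1 / 5] for all [n].

    Since the subtrees of distinct vertices of a level are independent, one of
    them almost surely carries an infinite cycle.  The permutation itself is well
    defined because the expected number of chains of [k] successive rings issued
    from a vertex is at most [((d + 1) T)^k / k!]. *)

(** * The walk on a finite tree with discrete time *)

(** Each pole is a circle, since iterating the permutation replays the same rings. For cycles, one
    implication between the two walks is enough: on an outcome whose relevant rings fall into
    distinct cells, a closed walk forces the discrete one to come back. The discrete model may
    therefore count a blocked cell, or reaching level [n], as survival; collisions are paid for
    separately, by a mesh that gets finer with [n]. The event of having no infinite cycle is only
    ever covered by measurable events.

    The straddling argument is sharp near [d T = 1], but its factor [1 - d T^2 / 6] vanishes for [T]
    of order [d^(-1/2)], whence a second regime. In it, [T^2 / 6] is the mean of the straddling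
    bound [u (T - u)] over a uniform time [u] in [[0, T]]. With [x = d T] close to [1] and [d]
    large, the mean number of offspring exceeds one when [d (x - 1) > 1 + 1 / 6]. For
    [T = 1 / d0 + c / d0^2] the left-hand side is about [c - 1], so [c = 13 / 6] is the limit of the
    method. *)

Section Pole.
Variables (M : nat) (I : finType).
Implicit Types (B : pred 'I_M) (bars : I -> pred 'I_M).
Implicit Types (E : I -> 'I_M -> 'I_M -> Prop).

(* [pole B bars E i b]: the walk that is at the root at the beginning of cell [i]
   meets the bars [B] of the parent edge for the first time in cell [b], where
   [E w i' j] says that it returns from its excursion into child [w], begun in
   cell [i'], through cell [j].  A cell with bars to several children blocks the
   walk. *)
Inductive pole B bars E : 'I_M -> 'I_M -> Prop :=
| pole_exit i : B i -> pole B bars E i i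
| pole_skip i b : ~~ B i -> (forall j, ~~ bars j i) ->
    pole B bars E (ordS i) b -> pole B bars E i b
| pole_child i w j b : ~~ B i -> bars w i ->
    (forall w', w' != w -> ~~ bars w' i) -> E w (ordS i) j ->
    pole B bars E (ordS j) b -> pole B bars E i b.

Lemma pole_bar B bars E i b : pole B bars E i b -> B b.
Proof. by elim. Qed.

(** The walk stops at the first bar of the parent edge, so extra bars there only stop it earlier.
    This monotonicity is what later allows bars to be removed when conditioning. *)
Lemma pole_mono B B' bars E i b : {subset B <= B'} ->
  pole B bars E i b -> exists b', pole B' bars E i b'.
Proof.
move=> sBB'; elim=> {i b} [i Bi|i b _ nb _ [b' IH]|i w j b _ wi nw Ew _ [b' IH]].
- by exists i; apply: pole_exit; apply: sBB'.
- case: (boolP (B' i)) => B'i; first by exists i; apply: pole_exit.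
  by exists b'; apply: pole_skip.
- case: (boolP (B' i)) => B'i; first by exists i; apply: pole_exit.
  by exists b'; apply: (pole_child (w := w) (j := j)).
Qed.

Lemma eq_pole B B' bars bars' E E' i b : B =1 B' -> (forall j, bars j =1 bars' j) ->
  (forall j k l, E j k l -> E' j k l) -> pole B bars E i b -> pole B' bars' E' i b.
Proof.
move=> eB eb eE; elim=> {i b} [i Bi|i b nB nb _ IH|i w j b nB wi nw Ew _ IH].
- by apply: pole_exit; rewrite -eB.
- by apply: pole_skip => //; [rewrite -eB|move=> j; rewrite -eb].
- apply: (pole_child (w := w) (j := j)) => //; rewrite -?eB -?eb //.
    by move=> w' /nw; rewrite -eb.
  exact: eE.
Qed.

Lemma pole_fun B bars E i b b' :
  (forall w i j j', E w i j -> E w i j' -> j = j') ->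
  pole B bars E i b -> pole B bars E i b' -> b = b'.
Proof.
move=> Ef P; elim: P b' => {i b} [i Bi|i b nB nb _ IH|i w j b nB wi nw Ew _ IH] b' P.
- by case: P Bi => // [k c /negbTE-> //|k w j c /negbTE-> //].
- case: P nB nb IH => [k ->//|k c _ _ P _ _ IH|k w j c _ wk _ _ _ _ /(_ w)].
    exact: IH.
  by rewrite wk.
- case: P nB wi nw Ew IH => [k ->//|k c _ /(_ w) /negbTE-> //|].
  move=> k w' j' c _ w'k nw' Ew' P _ wk nw Ew IH.
  have ew : w' = w by apply/eqP/negPn/negP => /nw; rewrite w'k.
  by rewrite ew in Ew'; apply: IH; rewrite (Ef _ _ _ _ Ew Ew').
Qed.

Lemma pole_first B bars E r b : pole B bars E r b -> exists t,
  (forall s, (s < t)%N -> ~~ B (iter s (@ordS _) r) /\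
     forall j, ~~ bars j (iter s (@ordS _) r)) /\
  (B (iter t (@ordS _) r) \/ exists w, [/\ ~~ B (iter t (@ordS _) r),
     bars w (iter t (@ordS _) r),
     forall w', w' != w -> ~~ bars w' (iter t (@ordS _) r) &
     exists j, E w (ordS (iter t (@ordS _) r)) j]).
Proof.
elim=> {r b} [i Bi|i b nB nb _ [t [H1 H2]]|i w j b nB wi nw Ew _ _].
- by exists 0%N; split=> //; left.
- exists t.+1; rewrite iterSr; split=> // -[|s] //.
  by rewrite ltnS iterSr; apply: H1.
- by exists 0%N; split=> //; right; exists w; split=> //; exists j.
Qed.

(* One step of the walk on the pole of the root when [w] is the only child. *)
Definition only_step bars E (w : I) (r : 'I_M) : option 'I_M :=
  if bars w r then
    if pselect (exists j, E w (ordS r) j) is left ex then Some (ordS (projT1 (cid ex)))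
    else None
  else Some (ordS r).

Definition only_walk bars E w r t := iter t (obind (only_step bars E w)) (Some r).

Lemma only_walkD bars E w r s t : only_walk bars E w r (t + s) =
  iter t (obind (only_step bars E w)) (only_walk bars E w r s).
Proof. by rewrite /only_walk iterD. Qed.

Lemma only_walk_None bars E w r s t : (s <= t)%N ->
  only_walk bars E w r s = None -> only_walk bars E w r t = None.
Proof.
move=> st; rewrite -(subnK st) only_walkD => ->; by elim: (t - s)%N => //= k ->.
Qed.

(** Until it meets the parent edge or a second child, the walk coincides with the one generated by
    [w] alone. Once the edge and subtree of [w] are fixed, the cells visited are deterministic, and
    the other edges are independent of them. *)
Lemma pole_only B bars E w r b :
  (forall w i j j', E w i j -> E w i j' -> j = j') ->
  pole B bars E r b -> exists t a,
  [/\ only_walk bars E w r t = Some a,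
   forall s c, (s < t)%N -> only_walk bars E w r s = Some c ->
     ~~ B c /\ forall j, j != w -> ~~ bars j c &
   B a \/ exists w2, [/\ w2 != w, bars w2 a & exists j, E w2 (ordS a) j]].
Proof.
move=> Ef; elim=> {r b} [i Bi|i b nB nb _ [t [a [H1 H2 H3]]]|
  i w1 j b nB wi nw Ew _ [t [a [H1 H2 H3]]]].
- by exists 0%N, i; split=> //; left.
- have st : only_step bars E w i = Some (ordS i) by rewrite /only_step (negbTE (nb w)).
  have wS u : only_walk bars E w i u.+1 = only_walk bars E w (ordS i) u.
    by rewrite /only_walk iterSr /= st.
  exists t.+1, a; split=> //; first by rewrite wS.
  case=> [|s] c; first by move=> _ [<-]; split.
  by rewrite ltnS wS; apply: H2.
- case: (eqVneq w1 w) => [e|ne]; last first.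
    exists 0%N, i; split=> //; right; exists w1; split=> //; by exists j.
  move: wi nw Ew; rewrite e => {w1 e} wi nw Ew.
  have st : only_step bars E w i = Some (ordS j).
    rewrite /only_step wi; case: pselect => [ex|[]]; last by exists j.
    by case: cid => j' Ew' /=; rewrite (Ef _ _ _ _ Ew Ew').
  have wS u : only_walk bars E w i u.+1 = only_walk bars E w (ordS j) u.
    by rewrite /only_walk iterSr /= st.
  exists t.+1, a; split=> //; first by rewrite wS.
  case=> [|s] c; first by move=> _ [<-]; split.
  by rewrite ltnS wS; apply: H2.
Qed.

End Pole.

(** * Excursions into trees of finite depth *)

Section Conf.
Variables (M d : nat).

Definition bits : finType := {ffun 'I_M -> bool}.

Fixpoint conf n : finType :=
  if n is n'.+1 then {ffun 'I_d -> (bits * conf n')%type} else unit.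

(* Reaching level [n] counts as not coming back: [ex] is empty for [n = 0]. *)
Fixpoint ex n : conf n -> pred 'I_M -> 'I_M -> 'I_M -> Prop :=
  match n with
  | 0 => fun _ _ _ _ => False
  | n'.+1 => fun (c : conf n'.+1) B =>
      pole B (fun j => (c j).1) (fun j => ex (c j).2 (c j).1)
  end.

Lemma ex_bar n (c : conf n) B i b : ex c B i b -> B b.
Proof. by case: n c => // n c; apply: pole_bar. Qed.

Lemma ex_fun n (c : conf n) B i b b' : ex c B i b -> ex c B i b' -> b = b'.
Proof.
elim: n c B i b b' => // n IH c B i b b'; apply: pole_fun => w k j j'; exact: IH.
Qed.

Lemma ex_mono n (c : conf n) (B B' : pred 'I_M) i b : {subset B <= B'} ->
  ex c B i b -> exists b', ex c B' i b'.
Proof. by case: n c => // n c; apply: pole_mono. Qed.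

(* The walk that enters the root through a bar of the parent edge in cell
   [i0] leaves it again; [B] lists the other bars of the parent edge. *)
Definition exits n (c : conf n) (B : bits) (i0 : 'I_M) : bool :=
  `[< exists b, ex c [pred i | B i || (i == i0)] (ordS i0) b >].

Definition nobits : bits := [ffun=> false].

Lemma exits_mono n (c : conf n) (B B' : bits) i0 :
  (forall i, i != i0 -> B i -> B' i) -> exits c B i0 -> exits c B' i0.
Proof.
move=> sB /asboolP [b E]; apply/asboolP; apply: ex_mono E => i; rewrite !inE.
by case: eqVneq => [->|ni]; rewrite ?orbT ?orbF // => /sB ->.
Qed.

Lemma exits_ex n (c : conf n) (B : bits) i0 b : B i0 -> ex c B (ordS i0) b -> exits c B i0.
Proof.
move=> Bi E; apply/asboolP; apply: ex_mono E => i; rewrite !inE /in_mem /= => ->.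
by [].
Qed.

End Conf.

(** * Finite probability *)

Section Expectation.
Variable R : realFieldType.

Definition isdist (X : finType) (u : X -> R) :=
  (forall x, 0 <= u x) /\ \sum_x u x = 1.

Definition Ex (X : finType) (u : X -> R) (f : X -> R) : R := \sum_x u x * f x.

Definition Pr (X : finType) (u : X -> R) (A : pred X) : R := Ex u (fun x => (A x)%:R).

Definition pairw (X Y : finType) (u : X -> R) (v : Y -> R) : (X * Y)%type -> R :=
  fun z => u z.1 * v z.2.

Definition prodw (I X : finType) (u : X -> R) : {ffun I -> X} -> R :=
  fun f => \prod_i u (f i).

Section Basic.
Variables (X : finType) (u : X -> R).

Lemma eq_Ex f g : f =1 g -> Ex u f = Ex u g.
Proof. by move=> fg; apply: eq_bigr => x _; rewrite fg. Qed.

Lemma eq_Pr (A B : pred X) : A =1 B -> Pr u A = Pr u B.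
Proof. by move=> AB; apply: eq_Ex => x; rewrite AB. Qed.

Lemma ExZ c f : Ex u (fun x => c * f x) = c * Ex u f.
Proof. by rewrite /Ex mulr_sumr; apply: eq_bigr => x _; rewrite mulrCA. Qed.

Lemma ExZr c f : Ex u (fun x => f x * c) = Ex u f * c.
Proof. by rewrite /Ex mulr_suml; apply: eq_bigr => x _; rewrite mulrA. Qed.

Lemma ExD f g : Ex u (fun x => f x + g x) = Ex u f + Ex u g.
Proof. by rewrite /Ex -big_split; apply: eq_bigr => x _; rewrite mulrDr. Qed.

Lemma ExB f g : Ex u (fun x => f x - g x) = Ex u f - Ex u g.
Proof. by rewrite /Ex -sumrB; apply: eq_bigr => x _; rewrite mulrBr. Qed.

Lemma Ex_sum (J : Type) (r : seq J) (P : pred J) F :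
  Ex u (fun x => \sum_(j <- r | P j) F j x) = \sum_(j <- r | P j) Ex u (F j).
Proof.
rewrite /Ex exchange_big; apply: eq_bigr => x _; by rewrite mulr_sumr.
Qed.

Hypothesis hu : isdist u.

Lemma Ex_cst c : Ex u (fun=> c) = c.
Proof. by rewrite /Ex -mulr_suml hu.2 mul1r. Qed.

Lemma le_Ex f g : (forall x, f x <= g x) -> Ex u f <= Ex u g.
Proof. by move=> fg; apply: ler_sum => x _; apply: ler_wpM2l => //; apply: hu.1. Qed.

Lemma Ex_ge0 f : (forall x, 0 <= f x) -> 0 <= Ex u f.
Proof. by move=> f0; apply: sumr_ge0 => x _; apply: mulr_ge0 => //; apply: hu.1. Qed.

Lemma Pr_ge0 (A : pred X) : 0 <= Pr u A.
Proof. by apply: Ex_ge0 => x; apply: ler0n. Qed.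

Lemma le_Pr (A B : pred X) : (forall x, A x -> B x) -> Pr u A <= Pr u B.
Proof. by move=> AB; apply: le_Ex => x; rewrite ler_nat; case: (A x) (AB x) => // ->. Qed.

Lemma Pr_le1 (A : pred X) : Pr u A <= 1.
Proof.
by rewrite -[leRHS](Ex_cst 1); apply: le_Ex => x; rewrite -[1]/(1%:R) ler_nat leq_b1.
Qed.

Lemma PrC (A : pred X) : Pr u (predC A) = 1 - Pr u A.
Proof.
rewrite -[X in X - _](Ex_cst 1) -ExB; apply: eq_Ex => x /=.
by case: (A x); rewrite ?subrr ?subr0.
Qed.

Lemma Pr_union (J : eqType) (r : seq J) (A : pred X) (Q : J -> pred X) :
  (forall x, A x -> exists2 j, j \in r & Q j x) -> Pr u A <= \sum_(j <- r) Pr u (Q j).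
Proof.
move=> AQ; rewrite -Ex_sum; apply: le_Ex => x.
case: (boolP (A x)) => [/AQ [j jr Qj]|_]; last by apply: sumr_ge0 => j _; apply: ler0n.
rewrite (big_rem j) //= Qj lerDl; by apply: sumr_ge0 => i _; apply: ler0n.
Qed.

Lemma Pr_orb (A B C : pred X) :
  (forall x, A x -> B x || C x) -> Pr u A <= Pr u B + Pr u C.
Proof.
move=> H; rewrite -ExD; apply: le_Ex => x; rewrite -natrD ler_nat.
by case: (A x) (H x) => // /(_ isT); case: (B x) => //= ->.
Qed.

Lemma Pr_fiber (Y : finType) (h : X -> Y) (A : pred X) :
  Pr u A = \sum_y Pr u (fun x => (h x == y) && A x).
Proof.
rewrite -Ex_sum; apply: eq_Ex => x.
rewrite (bigD1 (h x)) //= eqxx big1 ?addr0 // => y; by rewrite eq_sym => /negbTE->.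
Qed.

End Basic.

Lemma Ex_pair (X Y : finType) (u : X -> R) (v : Y -> R) f :
  Ex (pairw u v) f = Ex u (fun x => Ex v (fun y => f (x, y))).
Proof.
rewrite /Ex /pairw (eq_bigr (fun x => \sum_y u x * v y * f (x, y))).
  by rewrite pair_bigA; apply: eq_bigr => -[].
by move=> x _; rewrite mulr_sumr; apply: eq_bigr => y _; rewrite mulrA.
Qed.

Lemma isdist_pair (X Y : finType) (u : X -> R) (v : Y -> R) :
  isdist u -> isdist v -> isdist (pairw u v).
Proof.
move=> hu hv; split=> [z|]; first by apply: mulr_ge0; [apply: hu.1|apply: hv.1].
have : Ex (pairw u v) (fun=> 1) = 1.
  by rewrite Ex_pair; under eq_Ex do rewrite Ex_cst //; rewrite Ex_cst.
by move=> <-; apply: eq_bigr => x _; rewrite mulr1.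
Qed.

Lemma Ex_prod (I X : finType) (u : X -> R) (f : I -> X -> R) :
  Ex (prodw u) (fun x : {ffun I -> X} => \prod_i f i (x i)) = \prod_i Ex u (f i).
Proof.
rewrite [RHS]bigA_distr_bigA; apply: eq_bigr => x _; by rewrite -big_split.
Qed.

Lemma isdist_prod (I X : finType) (u : X -> R) : isdist u -> isdist (@prodw I X u).
Proof.
move=> hu; split=> [x|]; first by apply: prodr_ge0 => i _; apply: hu.1.
have := Ex_prod u (fun (i : I) (x : X) => 1).
rewrite [X in _ = X]big1 => [<-|i _]; last exact: Ex_cst.
by apply: eq_bigr => x _; rewrite big1 // mulr1.
Qed.

Lemma Pr_prod (I X : finType) (u : X -> R) (f : I -> pred X) :
  Pr (prodw u) (fun x : {ffun I -> X} => [forall i, f i (x i)]) = \prod_i Pr u (f i).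
Proof.
rewrite -Ex_prod; apply: eq_Ex => x.
case: (boolP [forall i, f i (x i)]) => [/forallP H|/forallPn [i /negbTE H]].
  by rewrite big1 // => i _; rewrite H.
by rewrite (bigD1 i) //= H mul0r.
Qed.

Lemma Pr_pair_prod (Y I X : finType) (v : Y -> R) (u : X -> R) (g : pred Y) (f : I -> pred X) :
  Pr (pairw v (prodw u)) (fun z : Y * {ffun I -> X} => g z.1 && [forall i, f i (z.2 i)])
  = Pr v g * \prod_i Pr u (f i).
Proof.
rewrite /Pr Ex_pair -Pr_prod -ExZr; apply: eq_Ex => y /=.
by rewrite -ExZ; apply: eq_Ex => x /=; case: (g y); rewrite ?mul1r ?mul0r.
Qed.

(** * Independent bits and monotone conditioning *)

Section Bits.
Variables (M : nat) (p : R).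
Hypothesis p01 : 0 <= p <= 1.

Definition bw (b : bool) : R := if b then p else 1 - p.

Definition bitsw : bits M -> R := prodw bw.

Lemma isdist_bw : isdist bw.
Proof.
case/andP: p01 => p0 p1; split; first by case=> //=; rewrite subr_ge0.
by rewrite big_bool /bw /= addrC subrK.
Qed.

Lemma isdist_bits : isdist bitsw.
Proof. exact/isdist_prod/isdist_bw. Qed.

Definition upd (b : bits M) (k : 'I_M) (v : bool) : bits M :=
  [ffun i => if i == k then v else b i].

Lemma upd_same b k : upd b k (b k) = b.
Proof. by apply/ffunP => i; rewrite ffunE; case: eqP => [->|]. Qed.

Lemma bitsw_upd b k v : bitsw (upd b k v) = bw v * \prod_(i | i != k) bw (b i).
Proof.
rewrite /bitsw /prodw (bigD1 k) //= ffunE eqxx; congr (_ * _).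
by apply: eq_bigr => i /negbTE ik; rewrite ffunE ik.
Qed.

Lemma updK b k v : (upd b k v) k = v.
Proof. by rewrite ffunE eqxx. Qed.

Lemma updN b k v i : i != k -> (upd b k v) i = b i.
Proof. by rewrite ffunE => /negbTE->. Qed.

Lemma upd_upd b k v v' : upd (upd b k v) k v' = upd b k v'.
Proof. by apply/ffunP => i; rewrite !ffunE; case: eqP. Qed.

(** Bit [k] is independent of the rest, so prescribing its value amounts to overwriting it in
    [h]. *)
Lemma Ex_bit k v (h : bits M -> R) :
  Ex bitsw (fun b : bits M => (b k == v)%:R * h b) = bw v * Ex bitsw (fun b : bits M => h (upd b k v)).
Proof.
pose W (b : bits M) := \prod_(i | i != k) bw (b i).
have -> : Ex bitsw (fun b : bits M => (b k == v)%:R * h b) =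
    \sum_(b : bits M | b k == v) bw v * (W b * h b).
  rewrite /Ex [RHS]big_mkcond; apply: eq_bigr => b _; case: eqP => [e|_]; last first.
    by rewrite mul0r mulr0.
  by rewrite mul1r -{1}(upd_same b k) bitsw_upd e mulrA.
rewrite -mulr_sumr /Ex; congr (_ * _).
(* Each fibre of [upd _ k v] consists of two bit vectors, of total weight [W b]. *)
rewrite [RHS](partition_big (fun b : bits M => upd b k v) (fun b : bits M => b k == v)) /=; last first.
  by move=> b _; rewrite updK.
apply: eq_bigr => b /eqP bk.
rewrite (eq_bigr (fun b' => bitsw b' * h b)) => [|b' /eqP -> //].
rewrite -mulr_suml; congr (_ * _).
rewrite (reindex_onto (fun v' => upd b k v') (fun b' : bits M => b' k)) /=.
  rewrite (eq_bigl predT) => [|v']; last first.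
    by rewrite upd_upd updK -bk upd_same !eqxx.
  rewrite big_bool /= !bitsw_upd -mulrDl /bw /W addrC subrK mul1r //.
by move=> b' /eqP <-; rewrite upd_upd upd_same.
Qed.

Lemma Pr_bit k v : Pr bitsw (fun b : bits M => b k == v) = bw v.
Proof.
have := Ex_bit k v (fun=> 1); rewrite Ex_cst ?mulr1; last exact: isdist_bits.
by move=> <-; apply: eq_Ex => b; rewrite mulr1.
Qed.

Lemma Ex_bit_le k v (h : bits M -> R) : (forall b, h (upd b k v) <= h b) ->
  Ex bitsw (fun b : bits M => (b k == v)%:R * h b) <= bw v * Ex bitsw h.
Proof.
move=> hle; rewrite Ex_bit; apply: ler_wpM2l; first exact: (isdist_bw).1.
exact: (le_Ex isdist_bits).
Qed.

Lemma bw_ge0 v : 0 <= bw v. Proof. exact: isdist_bw.1. Qed.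

Definition none (l : seq 'I_M) (b : bits M) := all (fun i => ~~ b i) l.

Lemma none_upd l b k v : k \notin l -> none l (upd b k v) = none l b.
Proof.
move=> kl; apply: eq_in_all => i il; rewrite updN //.
by apply: contraNneq kl => <-.
Qed.

(** An elementary correlation inequality: clearing a bit of [l] does not raise [h], so the absence
    of these bits is negatively correlated with [h]. *)
Lemma Ex_none_le l (h : bits M -> R) : uniq l ->
  (forall k b, k \in l -> h (upd b k false) <= h b) ->
  Ex bitsw (fun b : bits M => (none l b)%:R * h b) <= (1 - p) ^+ size l * Ex bitsw h.
Proof.
elim: l h => [|k l IH] h /=; first by rewrite expr0 mul1r; under eq_Ex do rewrite mul1r.
case/andP=> kl ul hle.
have -> : Ex bitsw (fun b : bits M => (none (k :: l) b)%:R * h b) =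
   Ex bitsw (fun b : bits M => (b k == false)%:R * ((none l b)%:R * h b)).
  apply: eq_Ex => b; rewrite /= eqbF_neg mulrA -natrM mulnb //.
apply: le_trans (Ex_bit_le _) _.
  move=> b; rewrite none_upd //; apply: ler_wpM2l => //.
  by apply: hle; rewrite mem_head.
rewrite exprS -mulrA; apply: ler_wpM2l; first exact: bw_ge0.
by apply: IH => // i b il; apply: hle; rewrite in_cons il orbT.
Qed.

Lemma Pr_none l : uniq l -> Pr bitsw (none l) = (1 - p) ^+ size l.
Proof.
elim: l => [|k l IH] /=; first by rewrite expr0 /Pr Ex_cst //; apply: isdist_bits.
case/andP=> kl ul; rewrite exprS -(IH ul).
have -> : Pr bitsw (none (k :: l)) = Ex bitsw (fun b : bits M => (b k == false)%:R * (none l b)%:R).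
  by apply: eq_Ex => b; rewrite /= eqbF_neg -natrM mulnb.
rewrite Ex_bit; congr (_ * _); apply: eq_Ex => b; by rewrite none_upd.
Qed.

Lemma Ex_first_le l c (h : bits M -> R) : uniq (c :: l) ->
  (forall k b, k \in l -> h (upd b k false) <= h b) ->
  (forall b, h (upd b c true) <= h b) ->
  Ex bitsw (fun b : bits M => (none l b && b c)%:R * h b) <= (1 - p) ^+ size l * p * Ex bitsw h.
Proof.
case/andP=> cl ul h1 h2.
have -> : Ex bitsw (fun b : bits M => (none l b && b c)%:R * h b) =
   Ex bitsw (fun b : bits M => (b c == true)%:R * ((none l b)%:R * h b)).
  by apply: eq_Ex => b; rewrite eqb_id andbC mulrA -natrM mulnb.
apply: le_trans (Ex_bit_le _) _.
  by move=> b; rewrite none_upd //; apply: ler_wpM2l.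
rewrite [_ * p]mulrC -mulrA; apply: ler_wpM2l; first exact: bw_ge0 true.
exact: Ex_none_le.
Qed.

Lemma Pr_first l c : uniq (c :: l) ->
  Pr bitsw (fun b : bits M => none l b && b c) <= (1 - p) ^+ size l * p.
Proof.
move=> ul; have := Ex_first_le (h := fun=> 1) ul.
rewrite Ex_cst ?mulr1; last exact: isdist_bits.
move=> /(_ (fun _ _ _ => lexx _) (fun _ => lexx _)); apply: le_trans.
by apply: (le_Ex isdist_bits) => b; rewrite mulr1.
Qed.

Variable d : nat.

Fixpoint wt n : conf M d n -> R :=
  match n with
  | 0 => fun=> 1
  | n'.+1 => prodw (pairw bitsw (@wt n'))
  end.

Lemma isdist_wt n : isdist (@wt n).
Proof.
elim: n => [|n IH]; first by split=> // ; rewrite (big_pred1 tt) => // -[].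
exact/isdist_prod/isdist_pair/IH/isdist_bits.
Qed.

Definition xw n := pairw bitsw (@wt n).

Lemma isdist_xw n : isdist (@xw n).
Proof. exact: isdist_pair isdist_bits (isdist_wt n). Qed.

Lemma Pr_xw_fst n (A : pred (bits M)) : Pr (@xw n) (fun x => A x.1) = Pr bitsw A.
Proof.
rewrite /Pr Ex_pair; apply: eq_Ex => b /=; rewrite Ex_cst //; exact: isdist_wt.
Qed.

(* Conditioning on where the bars of the edge to a child are first met can only
   help the walk to survive: bars are removed, except the one it enters through. *)
Lemma Pr_first_exits n l c rho : uniq (c :: l) ->
  Pr (@xw n) (fun x => exits x.2 x.1 c) <= rho ->
  Pr (@xw n) (fun x => [&& none l x.1, x.1 c & exits x.2 x.1 c])
    <= (1 - p) ^+ size l * p * rho.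
Proof.
move=> ul hr.
have /Ex_first_le -/(_ (fun b : bits M => Ex (@wt n) (fun y => (exits y b c)%:R))) H := ul.
apply: le_trans (le_trans (H _ _) _).
- rewrite /Pr Ex_pair; apply: (le_Ex isdist_bits) => b /=; rewrite -ExZ.
  apply: (le_Ex (isdist_wt n)) => y /=; by rewrite -natrM mulnb andbA.
- move=> k b kl; apply: (le_Ex (isdist_wt n)) => y; rewrite ler_nat.
  case e : (exits _ _ _) => //; rewrite lt0b; apply: exits_mono e => i ic.
  by rewrite ffunE; case: eqP.
- move=> b; apply: (le_Ex (isdist_wt n)) => y; rewrite ler_nat.
  case e : (exits _ _ _) => //; rewrite lt0b; apply: exits_mono e => i ic.
  by rewrite ffunE (negbTE ic).
- apply: ler_wpM2l; last by move: hr; rewrite /Pr Ex_pair.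
  apply: mulr_ge0; last exact: bw_ge0 true.
  by apply: exprn_ge0; exact: bw_ge0 false.
Qed.

End Bits.
End Expectation.

(** * The regime of large [T] *)

Section Cells.
Variable M : nat.

Lemma val_iter_ordS s (i : 'I_M) : val (iter s (@ordS M) i) = ((i + s) %% M)%N.
Proof.
elim: s => [|s IH]; first by rewrite addn0 modn_small.
by rewrite iterS [LHS]/= [nat_of_ord _]IH -[X in (X %% M)%N = _]addn1 modnDml addn1 addnS.
Qed.

Lemma iter_ordS_inj (i : 'I_M) s t : (s < M)%N -> (t < M)%N ->
  iter s (@ordS M) i = iter t (@ordS M) i -> s = t.
Proof.
move=> sM tM /(congr1 val); rewrite !val_iter_ordS => /eqP.
by rewrite eqn_modDl !modn_small // => /eqP.
Qed.

Lemma iter_ordS_last (i : 'I_M) : iter M.-1 (@ordS M) (ordS i) = i.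
Proof.
rewrite -iterSr prednK; last by apply: leq_ltn_trans (ltn_ord i).
by apply: val_inj; rewrite val_iter_ordS modnDr modn_small.
Qed.

Definition seg (r : 'I_M) k := [seq iter s (@ordS M) r | s <- iota 0 k].

Lemma size_seg r k : size (seg r k) = k.
Proof. by rewrite size_map size_iota. Qed.

Lemma uniq_seg r k : (k <= M)%N -> uniq (seg r k).
Proof.
move=> kM; rewrite map_inj_in_uniq ?iota_uniq // => s t.
rewrite !mem_iota => /andP[_ sk] /andP[_ tk]; apply: iter_ordS_inj; lia.
Qed.

Lemma uniq_segS r k : (k < M)%N -> uniq (iter k (@ordS M) r :: seg r k).
Proof.
move=> kM; rewrite /= uniq_seg ?(ltnW kM) // andbT; apply/negP => /mapP [s].
rewrite mem_iota add0n => /andP[_ sk] /iter_ordS_inj; lia.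
Qed.

Definition lastc (i0 : 'I_M) L := [seq iter s.+1 (@ord_pred M) i0 | s <- iota 0 L].

Lemma size_lastc i0 L : size (lastc i0 L) = L.
Proof. by rewrite size_map size_iota. Qed.

Lemma iter_ord_predK s (i : 'I_M) : iter s (@ordS M) (iter s (@ord_pred M) i) = i.
Proof.
elim: s => // s IH; rewrite iterSr iterS ord_predK IH //.
Qed.

Lemma seg_lastc i0 k L : (k < M.-1)%N ->
  iter k (@ordS M) (ordS i0) \in lastc i0 L -> (M.-1 <= k + L)%N.
Proof.
move=> kM /mapP [s]; rewrite mem_iota add0n => /andP[_ sL] e.
rewrite leqNgt; apply/negP => lt.
have := congr1 (iter s.+1 (@ordS M)) e; rewrite iter_ord_predK -iterD => e'.
have := iter_ordS_inj (i := ordS i0) (s := s.+1 + k) (t := M.-1).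
rewrite e' iter_ordS_last => /(_ _ _ erefl); lia.
Qed.

End Cells.

Section WalkUniq.
Variables (M : nat) (f : 'I_M -> option 'I_M) (r : 'I_M).
Let wk s := iter s (obind f) (Some r).

(* A deterministic walk that repeats a cell never meets a new one. *)
Lemma walk_uniq (hit : pred 'I_M) t a : wk t = Some a -> hit a ->
  (forall s c, (s < t)%N -> wk s = Some c -> ~~ hit c) ->
  forall s s', (s < s')%N -> (s' <= t)%N -> wk s != wk s'.
Proof.
move=> wt ha nh s s' ss' s't; apply/negP => /eqP e.
have /nh : (t - s' + s < t)%N by lia.
move=> /(_ a); rewrite ha => H; suff /H : wk (t - s' + s) = Some a by [].
by rewrite /wk iterD -/(wk s) e -iterD subnK.
Qed.

End WalkUniq.

Section High.
Variables (M d n : nat).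
Notation X := (bits M * conf M d n)%type.
Implicit Types (y : X) (x : conf M d n.+1) (B : bits M).
Variable (i0 : 'I_M).
Let r := ordS i0.

(* The walk on the pole of the root generated by a single child, whose edge and
   subtree are [y]: [wk y s] is the [s]-th cell, if the walk gets there. *)
Definition wstep (y : X) : 'I_M -> option 'I_M :=
  only_step (fun _ : unit => y.1 : pred _) (fun=> ex y.2 y.1) tt.

Definition wk (y : X) s : option 'I_M := iter s (obind (wstep y)) (Some r).
Definition wc (y : X) s : 'I_M := odflt r (wk y s).
Definition wl (y : X) t := [seq wc y s | s <- iota 0 t].

Lemma size_wl y t : size (wl y t) = t.
Proof. by rewrite size_map size_iota. Qed.

Lemma wk_seg y k : none (seg r k) y.1 -> wk y k = Some (iter k (@ordS M) r).
Proof.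
elim: k => // k IH; rewrite /none /seg -addn1 iotaD map_cat all_cat => /andP[H].
rewrite /= andbT add0n => H2; rewrite addn1 /wk [LHS]iterS -/(wk y k) IH //=.
by rewrite /wstep /only_step (negbTE H2).
Qed.

(** Read backwards from [i0]: a return from the child lands just after one of its bars, so a cell
    whose predecessor has no bar can only be reached from that predecessor. *)
Lemma wk_complete y t L : wk y t = Some i0 -> none (lastc i0 L) y.1 ->
  forall s, (s <= L)%N -> (s <= t)%N -> wk y (t - s) = Some (iter s (@ord_pred M) i0).
Proof.
move=> wt nL; elim=> [|s IH] sL st; first by rewrite subn0.
have /IH : (s <= L)%N by lia.
move=> /(_ (ltnW st)).
have -> : (t - s = (t - s.+1).+1)%N by lia.
rewrite {1}/wk iterS -/(wk _ _); case: (wk y _) => //= c.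
have nb : ~~ y.1 (iter s.+1 (@ord_pred M) i0).
  by apply: (allP nL); apply/mapP; exists s => //; rewrite mem_iota.
rewrite /wstep /only_step; case: ifP => [yc|_].
  case: pselect => // ex [e]; case: cid e => j /= /ex_bar yj e.
  have : j = iter s.+1 (@ord_pred M) i0 by rewrite iterS -e ordSK.
  by move=> ej; move: nb; rewrite -ej yj.
by case=> e; rewrite -e ordSK.
Qed.

(** The part, concerning the data of [w] alone, of the event that child [w] is met first, in cell
    [k], and left again. *)
Definition phi y k := [&& none (seg r k) y.1, y.1 (iter k (@ordS M) r) &
  exits y.2 y.1 (iter k (@ordS M) r)].

(* In turn: the parent edge is met first; no child is met; child [w] is met first,
   in cell [k], and the walk returns from it.  In the last case, either [w] has a
   bar among the last [L] cells, or the other edges have no bar along the first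
   [k + L + 1] cells visited by the walk generated by [w], or one of them is met
   there after [t] cells. *)
Lemma exits_cases x B L : exits x B i0 ->
  [\/ exists2 k, (k < M.-1)%N & [/\ none (seg r k) B, B (iter k (@ordS M) r) &
        forall j, none (seg r k) (x j).1],
      forall j, none (seg r M.-1) (x j).1 |
      exists w k, [/\ (k < M.-1)%N, phi (x w) k &
       [\/ [/\ ~~ none (lastc i0 L) (x w).1, none (seg r k) B &
              forall j, j != w -> none (seg r k) (x j).1],
           [/\ uniq (wl (x w) (k + L).+1), none (wl (x w) (k + L).+1) B &
              forall j, j != w -> none (wl (x w) (k + L).+1) (x j).1] |
           exists t, [/\ (k < t < M)%N, uniq (wl (x w) t.+1),
              none (wl (x w) t) B, forall j, j != w -> none (wl (x w) t) (x j).1 &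
              B (wc (x w) t) \/ exists2 w2, w2 != w & (x w2).1 (wc (x w) t) &&
                exits (x w2).2 (x w2).1 (wc (x w) t)]]]].
Proof.
move=> /asboolP [b P]; have [t [H1 H2]] := pole_first P.
(* The entrance cell [i0] lies [M.-1] steps ahead of [r] and counts as a bar, so the first bar
   cannot come later. *)
have tM : (t <= M.-1)%N.
  rewrite leqNgt; apply/negP => /H1 [].
  by rewrite iter_ordS_last /= eqxx orbT.
have nB k : (k <= t)%N -> none (seg r k) B.
  move=> kt; apply/allP => c0 /mapP[s]; rewrite mem_iota add0n => /andP[_ sk] ->.
  have /H1 [] : (s < t)%N by lia.
  by rewrite inE negb_or => /andP[].
have nx k j : (k <= t)%N -> none (seg r k) (x j).1.
  move=> kt; apply/allP => c0 /mapP[s]; rewrite mem_iota add0n => /andP[_ sk] ->.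
  have /H1 [] : (s < t)%N by lia.
  by move=> _ /(_ j).
case: (eqVneq t M.-1) => [et|nt]; first by constructor 2 => j; apply: nx; rewrite et.
have {}tM : (t < M.-1)%N by rewrite ltn_neqAle nt.
have ti0 : (iter t (@ordS M) r == i0) = false.
  apply/negbTE/eqP => e; have := iter_ordS_inj (i := r) (s := t) (t := M.-1).
  rewrite e iter_ordS_last => /(_ _ _ erefl); lia.
case: H2 => [|[w [nBt wt nw [j Ej]]]].
  rewrite inE ti0 orbF => Bt; constructor 1; exists t => //; split=> // [|j].
    exact: nB.
  exact: nx.
constructor 3; exists w, t.
have ph : phi (x w) t.
  rewrite /phi nx // wt; apply/and3P; split=> //.
  exact: exits_ex wt Ej.
split=> //.
have Ef : forall (w : 'I_d) i j j', ex (x w).2 (x w).1 i j -> ex (x w).2 (x w).1 i j' -> j = j'.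
  by move=> ? ? ? ?; apply: ex_fun.
have [t2 [a [Q1 Q2 Q3]]] := pole_only w Ef P.
have wE s : only_walk (fun j => (x j).1 : pred _) (fun j => ex (x j).2 (x j).1) w r s = wk (x w) s by [].
rewrite wE in Q1.
have {}Q2 s c : (s < t2)%N -> wk (x w) s = Some c ->
    [/\ ~~ B c, c != i0 & forall j, j != w -> ~~ (x j).1 c].
  move=> st; rewrite -wE => /(Q2 _ _ st) []; rewrite inE negb_or => /andP[-> ->]; by split.
have wks s : (s <= t)%N -> wk (x w) s = Some (iter s (@ordS M) r).
  by move=> st; apply: wk_seg; apply: nx.
(* The first [t] cells are empty and cell [t] has a bar to [w] only, so neither stopping condition
   of the walk generated by [w] holds there. *)
have tt2 : (t < t2)%N.
  rewrite ltnNge; apply/negP => t2t; move: Q1; rewrite wks // => -[ea].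
  move: t2t; rewrite leq_eqVlt => /orP [/eqP e|/H1 [n1 n2]]; last first.
    case: Q3 => [|[w2 [_ w2a _]]]; first by rewrite -ea (negbTE n1).
    by move: (n2 w2); rewrite ea w2a.
  case: Q3 => [|[w2 [w2w w2a _]]]; first by rewrite -ea e (negbTE nBt).
  by move: (nw _ w2w); rewrite -e ea w2a.
pose hit c := [|| B c, c == i0 | [exists j, (j != w) && (x j).1 c]].
have wkS s : (s <= t2)%N -> exists c, wk (x w) s = Some c.
  move=> st; case e : (wk _ _) => [c|]; first by exists c.
  by move: Q1; rewrite -wE; rewrite -wE in e; rewrite (only_walk_None st e).
have neq s s' : (s < s')%N -> (s' <= t2)%N -> wk (x w) s != wk (x w) s'.
  apply: (walk_uniq (hit := hit) Q1).
    rewrite /hit; case: Q3 => [/=/orP[->//|->]|[w2 [w2w w2a _]]]; first by rewrite orbT.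
    by apply/or3P; constructor 3; apply/existsP; exists w2; rewrite w2w.
  move=> {}s c st /(Q2 _ _ st) [nBc nc nj]; rewrite /hit (negbTE nBc) (negbTE nc) /=.
  apply/existsPn => j'; apply/negP => /andP[/nj]; by move/negbTE->.
have uw s : (s <= t2.+1)%N -> uniq (wl (x w) s).
  move=> st; rewrite map_inj_in_uniq ?iota_uniq // => s1 s2.
  rewrite !mem_iota !add0n => /andP[_ s1s] /andP[_ s2s]; rewrite /wc => e.
  have [c1 e1] : exists c, wk (x w) s1 = Some c by apply: wkS; lia.
  have [c2 e2] : exists c, wk (x w) s2 = Some c by apply: wkS; lia.
  move: e; rewrite e1 e2 /= => e.
  case: (ltngtP s1 s2) => // lt.
    have := @neq s1 s2 lt; rewrite e1 e2 e eqxx => H; suff : false by []; apply: H; lia.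
  have := @neq s2 s1 lt; rewrite e1 e2 e eqxx => H; suff : false by []; apply: H; lia.
have nwl s : (s <= t2)%N -> none (wl (x w) s) B /\ forall j, j != w -> none (wl (x w) s) (x j).1.
  move=> st; split=> [|j' j'w]; apply/allP => c0 /mapP[s1]; rewrite mem_iota add0n;
    move=> /andP[_ s1s] ->; rewrite /wc.
    have [c e1] : exists c, wk (x w) s1 = Some c by apply: wkS; lia.
    by rewrite e1 /=; have [|] := Q2 s1 c _ e1; first by lia.
  have [c e1] : exists c, wk (x w) s1 = Some c by apply: wkS; lia.
  rewrite e1 /=; have [|_ _] := Q2 s1 c _ e1; first by lia.
  exact.
(* Pigeonhole: the [t2.+1] cells visited are distinct. *)
have t2M : (t2 < M)%N.
  have := uw _ (leqnn _) => /card_uniqP; rewrite size_wl => <-.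
  by apply: leq_trans (max_card _) _; rewrite card_ord.
have wct2 : wc (x w) t2 = a by rewrite /wc Q1.
case: Q3 => [|[w2 [w2w w2a [j' Ej']]]]; last first.
  constructor 3; exists t2; have [? ?] := nwl _ (leqnn t2); split=> //; first by rewrite tt2.
    exact: uw.
  right; exists w2 => //; rewrite wct2 w2a /=; exact: exits_ex w2a Ej'.
case: (eqVneq a i0) => [ea _|na]; last first.
  rewrite inE (negbTE na) orbF => Ba.
  constructor 3; exists t2; have [? ?] := nwl _ (leqnn t2); split=> //; first by rewrite tt2.
    exact: uw.
  by left; rewrite wct2.
(* Here the walk closes up at the entrance bar. If [w] has no bar in the last [L] cells, the final
   [L] steps are forced through them; cell [t] has a bar of [w], so it comes earlier. *)
case: (boolP (none (lastc i0 L) (x w).1)) => nL; last first.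
  constructor 1; split=> // [|j'' _]; first exact: nB.
  exact: nx.
constructor 2; rewrite ea in Q1.
have lt2 : ((t + L).+1 <= t2)%N.
  rewrite ltnNge; apply/negP => le.
  have [e] : Some (iter t (@ordS M) r) = Some (iter (t2 - t) (@ord_pred M) i0).
    rewrite -wks // -(wk_complete Q1 nL); [congr wk; lia|lia|lia].
  have nb : ~~ (x w).1 (iter (t2 - t) (@ord_pred M) i0).
    apply: (allP nL); apply/mapP; exists (t2 - t).-1; first by rewrite mem_iota; lia.
    by congr (iter _ _ _); lia.
  by move: nb; rewrite -e wt.
have [? ?] := nwl _ lt2; split=> //; exact/uw/leqW.
Qed.

End High.

(** * The recursive inequality for the probability of coming back *)

Section HighProb.
Variables (R : realFieldType) (M d n : nat) (p : R).
Hypothesis p01 : 0 <= p <= 1.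
Let q := 1 - p.
Notation X := (bits M * conf M d n)%type.
Notation u := (@xw R M p d n).
Notation V := (pairw (@bitsw R M p) (@prodw R ('I_d : finType) (X : finType) u)).
Notation Z := (bits M * {ffun 'I_d -> X})%type.

Let p0 : 0 <= p. Proof. by case/andP: p01. Qed.
Let q0 : 0 <= q. Proof. by case/andP: p01 => _; rewrite subr_ge0. Qed.
Let q1 : q <= 1. Proof. by rewrite /q lerBlDr lerDl. Qed.
Let qX k : 0 <= q ^+ k. Proof. exact: exprn_ge0. Qed.

Let hu : isdist u. Proof. exact: isdist_xw. Qed.
Let hV : isdist V. Proof. exact/isdist_pair/isdist_prod/hu/isdist_bits. Qed.

(** With the data of [w] frozen at [y], the cells visited by its walk are known, and the conditions
    on the other edges factor. *)
Lemma Pr_at w (y : X) (g : pred (bits M)) (f : 'I_d -> pred X) :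
  Pr V (fun z : Z => [&& z.2 w == y, g z.1 & [forall j, (j != w) ==> f j (z.2 j)]])
  = u y * (Pr (@bitsw R M p) g * \prod_(j | j != w) Pr u (f j)).
Proof.
transitivity (Pr V (fun z : Z => g z.1 && [forall j, if j == w then z.2 j == y else f j (z.2 j)])).
  apply: eq_Pr => z /=; rewrite andbCA; congr (_ && _).
  apply/andP/forallP => [[/eqP zw /forallP H] j|H].
    by case: eqVneq => [->|jw] /=; [rewrite zw|move: (H j); rewrite jw].
  split; first by have := H w; rewrite eqxx.
  by apply/forallP => j; apply/implyP => /negbTE jw; have := H j; rewrite jw.
rewrite (Pr_pair_prod _ _ g (fun j (v : X) => if j == w then v == y else f j v)) (bigD1 w) //= eqxx mulrCA; congr (_ * (_ * _)).
  rewrite /Pr /Ex (bigD1 y) //= eqxx mulr1 big1 ?addr0 // => i /negbTE->; by rewrite mulr0.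
by apply: eq_bigr => j /negbTE->.
Qed.

Lemma prod_others (w : 'I_d) (c : R) : \prod_(j | j != w) c = c ^+ d.-1.
Proof. by rewrite prodr_const cardC1 card_ord. Qed.

(** The exponent counts [d] silent edges: the parent edge and the [d.-1] other children. *)
Lemma Pr_at_none w (y : X) l : uniq l ->
  Pr V (fun z : Z => [&& z.2 w == y, none l z.1 & [forall j, (j != w) ==> none l (z.2 j).1]])
  = u y * q ^+ (d * size l).
Proof.
move=> ul; rewrite (Pr_at w y (none l) (fun j (v : X) => none l v.1)) (Pr_none p01) // (eq_bigr (fun=> q ^+ size l)) => [|j _].
  rewrite prod_others -exprM -exprD; congr (_ * _ ^+ _).
  by rewrite mulnC -mulSn prednK //; apply: leq_ltn_trans (ltn_ord w).
by rewrite (Pr_xw_fst p01 d n (none l)) (Pr_none p01).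
Qed.

Lemma Pr_at_parent w (y : X) l c : uniq (c :: l) ->
  Pr V (fun z : Z => [&& z.2 w == y, none l z.1 && z.1 c &
     [forall j, (j != w) ==> none l (z.2 j).1]])
  <= u y * (q ^+ (d * size l) * p).
Proof.
move=> ul; have /= /andP [_ ul'] := ul.
rewrite (Pr_at w y (fun b : bits M => none l b && b c) (fun j (v : X) => none l v.1)); apply: ler_wpM2l; first exact: hu.1.
rewrite (eq_bigr (fun=> q ^+ size l)) => [|j _]; last first.
  by rewrite (Pr_xw_fst p01 d n (none l)) (Pr_none p01).
rewrite prod_others -exprM.
have -> : q ^+ (d * size l) * p = (q ^+ size l * p) * q ^+ (size l * d.-1).
  rewrite mulrAC -exprD; congr (_ ^+ _ * _).
  by rewrite -mulnS mulnC prednK //; apply: leq_ltn_trans (ltn_ord w).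
by apply: ler_wpM2r => //; apply: Pr_first.
Qed.

Variable rho : R.
Hypothesis hrho : forall c, Pr u (fun x => exits x.2 x.1 c) <= rho.

Lemma Pr_at_child w w2 (y : X) l c : w2 != w -> uniq (c :: l) ->
  Pr V (fun z : Z => [&& z.2 w == y, none l z.1 &
     [forall j, (j != w) ==> (if j == w2 then
        [&& none l (z.2 j).1, (z.2 j).1 c & exits (z.2 j).2 (z.2 j).1 c]
        else none l (z.2 j).1)]])
  <= u y * (q ^+ (d * size l) * (p * rho)).
Proof.
move=> w2w ul; have /= /andP [_ ul'] := ul.
rewrite (Pr_at w y (none l) (fun j (v : X) => if j == w2 then
        [&& none l v.1, v.1 c & exits v.2 v.1 c] else none l v.1)).
apply: ler_wpM2l; first exact: hu.1.
rewrite (Pr_none p01) // (bigD1 w2) //= eqxx.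
rewrite (eq_bigr (fun=> q ^+ size l)) => [|j /andP[_ /negbTE->]]; last first.
  by rewrite (Pr_xw_fst p01 d n (none l)) (Pr_none p01).
set PP := \prod_(_ | _) _.
have HPP : q ^+ size l * PP = q ^+ size l ^+ d.-1.
  by rewrite /PP -(prod_others w) [RHS](bigD1 w2).
have -> : q ^+ (d * size l) * (p * rho) =
   q ^+ size l * (q ^+ size l * p * rho * PP).
  transitivity (q ^+ size l * (q ^+ size l * PP) * (p * rho)); last by ring.
  rewrite HPP -exprM -exprD; congr (_ ^+ _ * _).
  by rewrite -mulnS mulnC prednK //; apply: leq_ltn_trans (ltn_ord w).
apply: ler_wpM2l => //; apply: ler_wpM2r; first by apply: prodr_ge0.
exact: Pr_first_exits.
Qed.

Variables (i0 : 'I_M) (L : nat).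
Let r := ordS i0.

(** Bounds the probability that, among [m] edges watched from cell to cell, a prescribed one has a
    bar in the first cell with any; of order [1 / m]. *)
Let geo m N := \sum_(t < N) q ^+ (m * t) * p.

Lemma Pr_phi k : (k < M)%N -> Pr u (fun y => phi i0 y k) <= q ^+ k * p * rho.
Proof.
move=> kM; have := Pr_first_exits p01 (uniq_segS r kM) (hrho _).
by rewrite size_seg.
Qed.

Lemma Pr_first2 l c c' : uniq (c :: l) -> c' \notin l -> c' != c ->
  Pr (@bitsw R M p) (fun b : bits M => [&& none l b, b c & b c']) <= q ^+ size l * p * p.
Proof.
move=> ul c'l c'c.
have := Ex_first_le p01 (h := fun b : bits M => (b c')%:R) ul.
have -> : Ex (@bitsw R M p) (fun b : bits M => (b c')%:R) = p.
  rewrite -[RHS](@Pr_bit R M p p01 c' true); apply: eq_Ex => b; by rewrite eqb_id.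
move=> H; apply: le_trans (H _ _).
- by apply: (le_Ex (@isdist_bits R M p p01)) => b; rewrite -natrM mulnb andbA.
- by move=> k b kl; rewrite ler_nat updN //; apply: contraNneq c'l => ->.
- by move=> b; rewrite updN.
Qed.

Lemma Pr_phi_last k : (k < M.-1)%N ->
  Pr u (fun y => phi i0 y k && ~~ none (lastc i0 L) y.1)
  <= q ^+ k * p * ((M.-1 <= k + L)%N%:R + L%:R * p).
Proof.
move=> kM; have kM' : (k < M)%N by lia.
set c := iter k (@ordS M) r.
(* When cell [k] is this late, its own bar may lie among the last [L] cells, and the extra condition
   is dropped. *)
case: (boolP (M.-1 <= k + L)%N) => kL.
  apply: (@le_trans _ _ (q ^+ k * p)).
    have := Pr_first p01 (uniq_segS r kM'); rewrite size_seg; apply: le_trans.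
    rewrite -(Pr_xw_fst p01 d n (fun b : bits M => none (seg r k) b && b c)).
    by apply: (le_Pr hu) => y /andP[/and3P[-> -> _] _].
  rewrite ler_peMr //; first by apply: mulr_ge0.
  by rewrite -[leLHS]addr0 lerD2l; apply: mulr_ge0.
rewrite add0r.
pose Q c' (b : bits M) := [&& none (seg r k) b, b c & b c'].
apply: le_trans (@Pr_union _ _ _ hu _ (lastc i0 L) _ (fun c' (y : X) => Q c' y.1) _) _.
  move=> y /andP[/and3P[n1 n2 _] /allPn [c' c'l]]; rewrite negbK => yc'.
  by exists c' => //; rewrite /Q n1 n2.
apply: (@le_trans _ _ (\sum_(c' <- lastc i0 L) q ^+ k * p * p)); last first.
  rewrite big_const_seq count_predT size_lastc iter_addr_0 -mulr_natl.
  by rewrite le_eqVlt; apply/orP; left; apply/eqP; ring.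
rewrite big_seq [leRHS]big_seq; apply: ler_sum => c' c'l; rewrite (Pr_xw_fst p01 d n (Q c')).
have c'c : c' != c.
  apply: contraNneq kL => e; apply: (seg_lastc kM (i0 := i0)); by rewrite -/r -/c -e.
case: (boolP (c' \in seg r k)) => c's; last first.
  by have := Pr_first2 (uniq_segS r kM') c's c'c; rewrite size_seg.
rewrite /Pr /Ex big1 ?mulr_ge0 // => b _.
case: (boolP (Q c' b)) => [/and3P [/allP /(_ _ c's) /negbTE -> //]|_]; by rewrite mulr0.
Qed.

(** The cost of the second stage: [L] more cells without a bar of the [d] other edges, or the parent
    edge comes first, or another child comes first and is left again. *)
Let C := q ^+ (d * L) + geo d M * (1 + d.-1%:R * rho).

Hypothesis rho0 : 0 <= rho.

Lemma Pr_stage2 w k : (k < M.-1)%N ->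
  Pr V (fun z : Z => phi i0 (z.2 w) k && `[<
   [\/ [/\ ~~ none (lastc i0 L) (z.2 w).1, none (seg r k) z.1 &
              forall j, j != w -> none (seg r k) (z.2 j).1],
           [/\ uniq (wl i0 (z.2 w) (k + L).+1), none (wl i0 (z.2 w) (k + L).+1) z.1 &
              forall j, j != w -> none (wl i0 (z.2 w) (k + L).+1) (z.2 j).1] |
           exists t, [/\ (k < t < M)%N, uniq (wl i0 (z.2 w) t.+1),
              none (wl i0 (z.2 w) t) z.1, forall j, j != w -> none (wl i0 (z.2 w) t) (z.2 j).1 &
              z.1 (wc i0 (z.2 w) t) \/ exists2 w2, w2 != w & (z.2 w2).1 (wc i0 (z.2 w) t) &&
                exits (z.2 w2).2 (z.2 w2).1 (wc i0 (z.2 w) t)]] >])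
  <= q ^+ (d.+1 * k) * p * ((M.-1 <= k + L)%N%:R + L%:R * p + rho * C).
Proof.
move=> kM; have kM' : (k < M)%N by lia.
(* Condition on the data [y] of [w]: the visited cells [wl i0 y] become a fixed list. *)
rewrite (Pr_fiber _ (fun z : Z => z.2 w)).
have geo0 m N : 0 <= geo m N by apply: sumr_ge0 => t _; apply: mulr_ge0.
have C0 : 0 <= C.
  by apply: addr_ge0 => //; apply: mulr_ge0 => //; apply: addr_ge0 => //; apply: mulr_ge0.
apply: (@le_trans _ _ (\sum_y u y * ((phi i0 y k)%:R *
    (q ^+ (d * k) * ((~~ none (lastc i0 L) y.1)%:R + C))))); last first.
  have -> : \sum_y u y * ((phi i0 y k)%:R *
    (q ^+ (d * k) * ((~~ none (lastc i0 L) y.1)%:R + C))) =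
    q ^+ (d * k) * (Pr u (fun y => phi i0 y k && ~~ none (lastc i0 L) y.1)
     + Pr u (fun y => phi i0 y k) * C).
    rewrite /Pr -ExZr -ExD -ExZ; apply: eq_bigr => y _; congr (_ * _).
    by rewrite -mulnb natrM; ring.
  have -> : q ^+ (d.+1 * k) * p * ((M.-1 <= k + L)%N%:R + L%:R * p + rho * C) =
     q ^+ (d * k) * (q ^+ k * p * ((M.-1 <= k + L)%N%:R + L%:R * p) + q ^+ k * p * rho * C).
    by rewrite mulSn exprD; ring.
  apply: ler_wpM2l => //; apply: lerD; first exact: Pr_phi_last.
  by apply: ler_wpM2r => //; apply: Pr_phi.
apply: ler_sum => y _.
case: (boolP (phi i0 y k)) => ph; last first.
  rewrite mul0r mulr0 /Pr /Ex big1 // => z _.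
  by case: eqP => [->|_]; rewrite ?(negbTE ph) mulr0.
rewrite mul1r.
pose E1 (z : Z) := [&& ~~ none (lastc i0 L) y.1, z.2 w == y, none (seg r k) z.1 &
    [forall j, (j != w) ==> none (seg r k) (z.2 j).1]].
pose l2 := wl i0 y (k + L).+1.
pose E2 (z : Z) := [&& uniq l2, z.2 w == y, none l2 z.1 &
    [forall j, (j != w) ==> none l2 (z.2 j).1]].
pose E3 (t : nat) (z : Z) := let l := wl i0 y t in
  [&& (k < t)%N && uniq (wl i0 y t.+1), z.2 w == y, none l z.1 && z.1 (wc i0 y t) &
    [forall j, (j != w) ==> none l (z.2 j).1]].
pose E4 (t : nat) (w2 : 'I_d) (z : Z) := let l := wl i0 y t in
  [&& (k < t)%N && uniq (wl i0 y t.+1) && (w2 != w), z.2 w == y, none l z.1 &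
    [forall j, (j != w) ==> (if j == w2 then
        [&& none l (z.2 j).1, (z.2 j).1 (wc i0 y t) & exits (z.2 j).2 (z.2 j).1 (wc i0 y t)]
        else none l (z.2 j).1)]].
have Pr0 (b : bool) (F : pred Z) (c : R) : (b -> Pr V F <= c) -> 0 <= c ->
    Pr V (fun z => b && F z) <= b%:R * c.
  case: b => [/(_ isT) H _|_ _]; first by rewrite mul1r.
  by rewrite mul0r /Pr /Ex big1 // => z _; rewrite mulr0.
have uy : 0 <= u y by apply: hu.1.
have B1 : Pr V E1 <= (~~ none (lastc i0 L) y.1)%:R * (u y * q ^+ (d * k)).
  apply: Pr0; last by apply: mulr_ge0.
  by move=> _; rewrite Pr_at_none ?size_seg // uniq_seg // ltnW.
have B2 : Pr V E2 <= u y * (q ^+ (d * k) * q ^+ (d * L)).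
  apply: le_trans (Pr0 _ _ (u y * q ^+ (d * (k + L).+1)) _ _) _.
  - by move=> ul; rewrite Pr_at_none // size_wl.
  - by apply: mulr_ge0.
  apply: (@le_trans _ _ (u y * q ^+ (d * (k + L).+1))).
    by apply: ler_piMl; [apply: mulr_ge0|rewrite -[1]/(1%:R) ler_nat leq_b1].
  apply: ler_wpM2l => //; rewrite -exprD -mulnDr; apply: ler_wiXn2l => //.
  by rewrite leq_mul2l leqnSn orbT.
have segS t : uniq (wl i0 y t.+1) -> uniq (wc i0 y t :: wl i0 y t).
  by rewrite /wl -addn1 iotaD map_cat cats1 /= add0n rcons_uniq.
have B3 t : Pr V (E3 t) <= u y * ((k < t)%N%:R * q ^+ (d * t) * p).
  apply: le_trans (Pr0 _ _ (u y * (q ^+ (d * t) * p)) _ _) _.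
  - by move=> /andP[_ /segS ul]; rewrite -[X in (d * X)%N](size_wl i0 y t) Pr_at_parent.
  - by apply: mulr_ge0 => //; apply: mulr_ge0.
  rewrite mulrCA; apply: ler_wpM2l => //; rewrite mulrA; apply: ler_wpM2r => //.
  by apply: ler_wpM2r => //; rewrite ler_nat; case: (k < t)%N => //; rewrite leq_b1.
have B4 t w2 : Pr V (E4 t w2) <= u y * ((w2 != w)%:R * ((k < t)%N%:R * q ^+ (d * t) * (p * rho))).
  have prho : 0 <= p * rho by apply: mulr_ge0.
  apply: le_trans (Pr0 _ _ (u y * (q ^+ (d * t) * (p * rho))) _ _) _.
  - move=> /andP[/andP[_ /segS ul] w2w].
    by rewrite -[X in (d * X)%N](size_wl i0 y t) Pr_at_child.
  - by apply: mulr_ge0 => //; apply: mulr_ge0.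
  rewrite mulrCA; apply: ler_wpM2l => //; rewrite !mulrA.
  do 3 apply: ler_wpM2r => //.
  rewrite -natrM mulnb ler_nat; case: (k < t)%N; last by rewrite andbF.
  by case: (w2 != w); rewrite ?andbF ?leq_b1.
(* Only [t > k] contributes, and shifting by [k.+1] takes out [q ^+ (d * k)]. *)
have sumq : \sum_(t < M) (k < t)%N%:R * q ^+ (d * t) * p <= q ^+ (d * k) * geo d M.
  rewrite -(big_mkord xpredT (fun t => (k < t)%N%:R * q ^+ (d * t) * p)).
  rewrite (big_cat_nat (n := k.+1)) //= big_nat_cond big1 ?add0r; last first.
    by move=> t /andP[/andP[_ tk] _]; rewrite ltnNge -ltnS tk !mul0r.
  rewrite -{1}[k.+1]add0n big_addn big_mkord /geo mulr_sumr.
  apply: (@le_trans _ _ (\sum_(i < M - k.+1) q ^+ (d * k) * (q ^+ (d * i) * p))).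
    apply: ler_sum => t _; rewrite mulrA -exprD; apply: ler_wpM2r => //.
    rewrite (_ : (k < t + k.+1)%N); last by rewrite leq_addl.
    rewrite mul1r; apply: ler_wiXn2l => //; rewrite -mulnDr leq_mul2l.
    by rewrite addnS addnC leqnSn orbT.
  rewrite -(big_mkord xpredT (fun t => q ^+ (d * k) * (q ^+ (d * t) * p))).
  rewrite -[leRHS](big_mkord xpredT (fun t => q ^+ (d * k) * (q ^+ (d * t) * p))).
  rewrite [leRHS](big_cat_nat (n := M - k.+1)) //= ?leq_subr // lerDl.
  by apply: sumr_ge0 => t _; rewrite !mulr_ge0.
apply: (@le_trans _ _ (Pr V E1 + (Pr V E2 + (\sum_(t < M) Pr V (E3 t)
    + \sum_(tw : 'I_M * 'I_d) Pr V (E4 tw.1 tw.2))))).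
  pose F3 (z : Z) := [exists t : 'I_M, E3 t z].
  pose F4 (z : Z) := [exists tw : 'I_M * 'I_d, E4 tw.1 tw.2 z].
  apply: (@le_trans _ _ (Pr V E1 + (Pr V E2 + (Pr V F3 + Pr V F4)))); last first.
    do 2 apply: lerD => //; apply: lerD; apply: (Pr_union hV) => z /existsP [t H].
      by exists t => //; rewrite mem_index_enum.
    by exists t => //; rewrite mem_index_enum.
  apply: le_trans (Pr_orb (B := E1) (C := fun z => E2 z || (F3 z || F4 z)) hV _) _.
    move=> z /andP[/eqP e /andP[_ /asboolP]]; rewrite e.
    case=> [[a1 a2 a3]|[a1 a2 a3]|[t [/andP[kt tM] a1 a2 a3 a4]]].
    - apply/orP; left; apply/and4P; split=> //; first exact/eqP.
      by apply/forallP => j; apply/implyP => /a3.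
    - apply/orP; right; apply/orP; left; apply/and4P; split=> //; first exact/eqP.
      by apply/forallP => j; apply/implyP => /a3.
    - apply/orP; right; apply/orP; right; apply/orP; case: a4 => [a4|[w2 w2w /andP[a4 a5]]].
        left; apply/existsP; exists (Ordinal tM); apply/and4P; split.
        + by rewrite /= kt.
        + exact/eqP.
        + by rewrite a2.
        + by apply/forallP => j; apply/implyP => /a3.
      right; apply/existsP; exists (Ordinal tM, w2); apply/and4P; split.
      + by rewrite /= kt; apply/andP.
      + exact/eqP.
      + exact: a2.
      + apply/forallP => j; apply/implyP => jw; case: eqP => [->|_]; last exact: a3.
        by rewrite a3 //= a4.
  apply: lerD => //; apply: le_trans (Pr_orb (B := E2) (C := fun z => F3 z || F4 z) hV _) _ => //.
  apply: lerD => //; exact: (Pr_orb hV).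
have B34 : \sum_(t < M) Pr V (E3 t) + \sum_(tw : 'I_M * 'I_d) Pr V (E4 tw.1 tw.2)
   <= u y * (q ^+ (d * k) * (geo d M * (1 + d.-1%:R * rho))).
  apply: (@le_trans _ _ (u y * ((\sum_(t < M) (k < t)%N%:R * q ^+ (d * t) * p) *
     (1 + d.-1%:R * rho)))); last first.
    apply: ler_wpM2l => //; rewrite mulrA; apply: ler_wpM2r => //.
    by apply: addr_ge0 => //; apply: mulr_ge0.
  rewrite mulrDr mulr1 mulrDr; apply: lerD.
    by rewrite mulr_sumr; apply: ler_sum.
  rewrite -(pair_bigA _ (fun (t : 'I_M) w2 => Pr V (E4 t w2))) /= mulr_suml mulr_sumr.
  apply: ler_sum => t _; apply: (@le_trans _ _ (\sum_w2 u y * ((w2 != w)%:R * ((k < t)%N%:R * q ^+ (d * t) * (p * rho))))).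
    by apply: ler_sum.
  rewrite -mulr_sumr -mulr_suml; apply: ler_wpM2l => //.
  have -> : \sum_(w2 : 'I_d) (w2 != w)%:R = d.-1%:R :> R.
    rewrite (bigD1 w) //= eqxx add0r (eq_bigr (fun=> 1)) => [|j -> //].
    by rewrite sumr_const cardC1 card_ord.
  by rewrite le_eqVlt; apply/orP; left; apply/eqP; ring.
have -> : u y * (q ^+ (d * k) * ((~~ none (lastc i0 L) y.1)%:R + C)) =
  (~~ none (lastc i0 L) y.1)%:R * (u y * q ^+ (d * k)) + (u y * (q ^+ (d * k) * q ^+ (d * L))
   + u y * (q ^+ (d * k) * (geo d M * (1 + d.-1%:R * rho)))).
  by rewrite /C; ring.
by do 2 apply: lerD => //.
Qed.

(** The summands follow the cases of [exits_cases]. Since [d * geo d.+1 M.-1] is about [1] and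
    [d * geo d M] too, the last one is roughly [rho * (small + rho)] plus a small error: the
    recursion is quadratic in [rho]. *)
Lemma exits_rec :
  Pr (@xw R M p d n.+1) (fun z => exits z.2 z.1 i0) <=
  geo d.+1 M.-1 + q ^+ (d * M.-1) +
  d%:R * \sum_(k < M.-1) q ^+ (d.+1 * k) * p *
     ((M.-1 <= k + L)%N%:R + L%:R * p + rho * C).
Proof.
pose E1 k (z : Z) := (none (seg r k) z.1 && z.1 (iter k (@ordS M) r)) &&
  [forall j, none (seg r k) (z.2 j).1].
pose E2 (z : Z) := predT z.1 && [forall j, none (seg r M.-1) (z.2 j).1].
pose E3 w k (z : Z) :=  phi i0 (z.2 w) k && `[<
   [\/ [/\ ~~ none (lastc i0 L) (z.2 w).1, none (seg r k) z.1 &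
              forall j, j != w -> none (seg r k) (z.2 j).1],
           [/\ uniq (wl i0 (z.2 w) (k + L).+1), none (wl i0 (z.2 w) (k + L).+1) z.1 &
              forall j, j != w -> none (wl i0 (z.2 w) (k + L).+1) (z.2 j).1] |
           exists t, [/\ (k < t < M)%N, uniq (wl i0 (z.2 w) t.+1),
              none (wl i0 (z.2 w) t) z.1, forall j, j != w -> none (wl i0 (z.2 w) t) (z.2 j).1 &
              z.1 (wc i0 (z.2 w) t) \/ exists2 w2, w2 != w & (z.2 w2).1 (wc i0 (z.2 w) t) &&
                exits (z.2 w2).2 (z.2 w2).1 (wc i0 (z.2 w) t)]] >].
pose F1 (z : Z) := [exists k : 'I_M.-1, E1 k z].
pose F3 (z : Z) := [exists wk : 'I_d * 'I_M.-1, E3 wk.1 wk.2 z].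
have H1 (z : Z) : exits (z.2 : conf M d n.+1) z.1 i0 -> F1 z || (E2 z || F3 z).
  move=> /(exits_cases L) [[k kM [a1 a2 a3]]|a1|[w [k [kM a1 a2]]]].
  - apply/orP; left; apply/existsP; exists (Ordinal kM).
    by rewrite /E1 a1 a2; apply/forallP.
  - by apply/orP; right; apply/orP; left; apply/forallP.
  - do 2 (apply/orP; right); apply/existsP; exists (w, Ordinal kM).
    by apply/andP; split=> //; apply/asboolP.
have eV : Pr (@xw R M p d n.+1) (fun z => exits z.2 z.1 i0) =
   Pr V (fun z => exits (z.2 : conf M d n.+1) z.1 i0) by [].
rewrite eV; apply: le_trans (Pr_orb hV H1) _; rewrite -addrA; apply: lerD.
  apply: le_trans (Pr_union (r := index_enum _) (Q := fun (k : 'I_M.-1) => E1 k) hV _) _.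
    by move=> z /existsP [k H]; exists k => //; rewrite mem_index_enum.
  apply: ler_sum => k _; have kM : (k < M)%N by have := ltn_ord k; lia.
  rewrite (Pr_pair_prod (@bitsw R M p) u (fun b : bits M => none (seg r k) b && b (iter k (@ordS M) r))
    (fun j (v : X) => none (seg r k) v.1)).
  rewrite (eq_bigr (fun=> q ^+ k)) => [|j _]; last first.
    by rewrite (Pr_xw_fst p01 d n (none _)) (Pr_none p01) ?size_seg // uniq_seg // ltnW.
  rewrite prodr_const card_ord mulSn exprD mulrAC [(d * k)%N]mulnC -exprM.
  apply: ler_wpM2r => //.
  by have := Pr_first p01 (uniq_segS r kM); rewrite size_seg.
apply: le_trans (Pr_orb (B := E2) (C := F3) hV _) _ => //; apply: lerD.
  rewrite (Pr_pair_prod (@bitsw R M p) u predT (fun j (v : X) => none (seg r M.-1) v.1)).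
  rewrite (eq_bigr (fun=> q ^+ M.-1)) => [|j _]; last first.
    by rewrite (Pr_xw_fst p01 d n (none _)) (Pr_none p01) ?size_seg // uniq_seg // leq_pred.
  rewrite prodr_const card_ord [(d * _)%N]mulnC -exprM ler_piMl //.
  exact: (Pr_le1 (@isdist_bits R M p p01)).
apply: le_trans (Pr_union (r := index_enum _) (Q := fun (wk : 'I_d * 'I_M.-1) => E3 wk.1 wk.2) hV _) _.
  by move=> z /existsP [k H]; exists k => //; rewrite mem_index_enum.
rewrite -(pair_bigA _ (fun (w : 'I_d) (k : 'I_M.-1) => Pr V (E3 w k))) /=.
rewrite mulr_natl -[X in _ *+ X](card_ord d) -sumr_const.
apply: ler_sum => w _; apply: ler_sum => k _; exact: Pr_stage2.
Qed.

End HighProb.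

(** * The regime of small [T] *)

Section LowDet.
Variables (M d n : nat) (i0 : 'I_M).
Let r := ordS i0.
Notation cell k := (iter k (@ordS M) r).

Lemma cell_exists (j : 'I_M) : exists2 s, (s < M)%N & j = cell s.
Proof.
have M0 : (0 < M)%N by apply: leq_ltn_trans (ltn_ord j).
exists ((j + (M - r)) %% M)%N; first by rewrite ltn_mod.
apply: val_inj; rewrite val_iter_ordS modnDmr addnCA subnKC; last exact: ltnW.
by rewrite modnDr modn_small.
Qed.

Definition aft k := [seq cell s | s <- iota k (M - k)].

(** Both ranges contain cell [k], so a bar in that cell is excluded too. *)
Definition oneside k (b : bits M) := none (seg r k.+1) b || none (aft k) b.

Definition onebar k : bits M := [ffun i => i == cell k].

(* A walk on the pole of the root that has to get past a cell not straddled by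
   the bars of any other child must go through that cell. *)
Lemma exits_through (x : conf M d n.+1) w k : (k < M.-1)%N ->
  exits x (nobits M) i0 -> (x w).1 = onebar k ->
  (forall j, j != w -> oneside k (x j).1) -> exits (x w).2 (nobits M) (cell k).
Proof.
move=> kM /asboolP [b P] xw ns.
suff : exits (x w).2 (x w).1 (cell k).
  apply: exits_mono => i /negbTE ik; by rewrite xw ffunE ik.
have xwE i : (x w).1 i = (i == cell k) by rewrite xw ffunE.
have [s sk er] : exists2 s, (s <= k)%N & ordS i0 = cell s by exists 0%N.
(* Invariant: the current cell has offset [s <= k] until cell [k] is left through [w]. *)
elim: P s sk er => {b} [c Bc|c b nB nb _ IH|c w1 j b nB w1c nw E _ IH] s sk ec.
- have : c = i0 by move: Bc; rewrite inE ffunE => /eqP.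
  rewrite ec -[RHS](iter_ordS_last i0) => /iter_ordS_inj; lia.
- have sk' : s != k.
    by apply: contraNneq (nb w) => e; rewrite xwE ec e.
  by apply: (IH s.+1); [lia|rewrite ec].
- case: (eqVneq s k) => [e|nsk].
    have e1 : w1 = w.
      by apply/eqP; rewrite eq_sym; apply/negPn/negP => /nw; rewrite xwE ec e eqxx.
    subst s; rewrite -ec; move: w1c E; rewrite e1; exact: exits_ex.
  have w1w : w1 != w.
    apply: contraNneq nsk => e; move: w1c; rewrite e xwE ec => /eqP /iter_ordS_inj ->//; lia.
  have [s' s'M ej] := cell_exists j.
  have w1j : (x w1).1 j by apply: ex_bar E.
  apply: (IH s'.+1); last by rewrite ej.
  (* A jump past cell [k] would use two bars of the sibling [w1], in cells of offset [s <= k] and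
     [s' >= k]. *)
  rewrite ltnNge; apply/negP => ks'.
  case/orP: (ns _ w1w) => /allP /= H.
    have /H : c \in seg r k.+1.
      by apply/mapP; exists s => //; rewrite mem_iota; lia.
    by rewrite w1c.
  have /H : j \in aft k by apply/mapP; exists s' => //; rewrite mem_iota; lia.
  by rewrite w1j.
Qed.

End LowDet.

Lemma bernoulli_le (R : realFieldType) (x : R) m : 0 <= x <= 1 -> 1 - m%:R * (1 - x) <= x ^+ m.
Proof.
case/andP=> x0 x1; elim: m => [|m IH]; first by rewrite mul0r subr0 expr0.
rewrite exprS -natr1; have h : x * (1 - m%:R * (1 - x)) <= x * x ^+ m by apply: ler_wpM2l.
apply: le_trans h; have m0 : 0 <= m%:R :> R by [].
have : 0 <= m%:R * ((1 - x) * (1 - x)) by rewrite mulr_ge0 // mulr_ge0 // subr_ge0.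
by nra.
Qed.

(** * First and second moments of the useful children *)

Section LowProb.
Variables (R : realFieldType) (M d n : nat) (p : R) (i0 : 'I_M).
Hypothesis p01 : 0 <= p <= 1.
Let q := 1 - p.
Let r := ordS i0.
Notation cell k := (iter k (@ordS M) r).
Notation X := (bits M * conf M d n)%type.
Notation u := (@xw R M p d n).
Notation bW := (@bitsw R M p).

Let p0 : 0 <= p. Proof. by case/andP: p01. Qed.
Let q0 : 0 <= q. Proof. by case/andP: p01 => _; rewrite subr_ge0. Qed.
Let q1 : q <= 1. Proof. by rewrite /q lerBlDr lerDl. Qed.
Let hu : isdist u. Proof. exact: isdist_xw. Qed.
Let hb : isdist bW. Proof. exact: isdist_bits. Qed.

Lemma Pr_onebar k : Pr bW (fun b => b == onebar i0 k) = q ^+ M.-1 * p.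
Proof.
rewrite /Pr /Ex (bigD1 (onebar i0 k)) //= eqxx mulr1 big1 ?addr0; last first.
  by move=> b /negbTE->; rewrite mulr0.
rewrite /bitsw /prodw (bigD1 (cell k)) //= ffunE eqxx mulrC; congr (_ * _).
rewrite (eq_bigr (fun=> q)) => [|i /negbTE ik]; last by rewrite ffunE ik.
by rewrite prodr_const cardC1 card_ord.
Qed.

(** Failure requires a bar in cell [k], or one of [k * (M.-1 - k)] pairs of bars around it, each of
    probability [p * p]. *)
Lemma Pr_oneside k : (k < M)%N ->
  1 - (p + k%:R * (M.-1 - k)%:R * (p * p)) <= Pr bW (oneside i0 k).
Proof.
move=> kM; rewrite lerBlDr -lerBlDl -(PrC hb).
pose l2 := seg r k; pose l3 := [seq cell s | s <- iota k.+1 (M.-1 - k)].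
pose E1 (b : bits M) := b (cell k) == true.
pose E2 (cc : 'I_M * 'I_M) (b : bits M) := b cc.1 && b cc.2.
pose F2 (b : bits M) := [exists cc : 'I_M * 'I_M, [&& cc.1 \in l2, cc.2 \in l3 & E2 cc b]].
have H b : predC (oneside i0 k) b -> E1 b || F2 b.
  rewrite /= negb_or => /andP[/allPn [c cs bc] /allPn [c' c's bc']]; rewrite /E1.
  case: (boolP (b (cell k))) => //= nb; rewrite !negbK in bc bc'.
  apply/existsP; exists (c, c'); rewrite /E2 /= bc bc' !andbT; apply/andP; split.
    case/mapP: cs => s; rewrite mem_iota add0n => /andP[_ sk] ec.
    apply/mapP; exists s => //; rewrite mem_iota add0n /=.
    rewrite ltn_neqAle -ltnS sk andbT; apply: contraNneq nb => <-; by rewrite -ec.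
  case/mapP: c's => s; rewrite mem_iota => /andP[ks sM] ec.
  apply/mapP; exists s => //; rewrite mem_iota.
  have : k != s by apply: contraNneq nb => ->; rewrite -ec.
  lia.
apply: le_trans (Pr_orb hb H) _; apply: lerD; first by rewrite (Pr_bit p01).
apply: le_trans (Pr_union (r := [seq (c, c') | c <- l2, c' <- l3]) (Q := E2) hb _) _.
  move=> b /existsP [[c c'] /and3P [c2 c3 E]]; exists (c, c') => //.
  by apply/allpairsP; exists (c, c').
rewrite (_ : k%:R * _ * _ = \sum_(j <- [seq (c, c') | c <- l2, c' <- l3]) (p * p)); last first.
  rewrite big_const_seq count_predT size_allpairs size_seg size_map size_iota iter_addr_0.
  by rewrite -[RHS]mulr_natl natrM.
rewrite big_seq [leRHS]big_seq; apply: ler_sum => -[c c'] /allpairsP [[a a'] /= [ha ha' [-> ->]]].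
have aa' : a' != a.
  case/mapP: ha => s; case/mapP: ha' => s'; rewrite !mem_iota => h -> h' ->.
  apply/eqP => /iter_ordS_inj; lia.
have := @Pr_first2 R M p p01 [::] a a' isT isT aa'; rewrite expr0 mul1r; apply: le_trans.
by apply: (le_Pr hb).
Qed.

Variable s0 : R.
Hypothesis s00 : 0 < s0.
Hypothesis hs0 : forall c, s0 <= Pr (@wt R M p d n) (fun y => ~~ exits y (nobits M) c).

(* Thinning brings the mean down to exactly [s0], so that the second moment term
   of the inclusion-exclusion bound is quadratic in [s0]. *)
Definition thin c (y : conf M d n) : R :=
  s0 / Pr (@wt R M p d n) (fun y => ~~ exits y (nobits M) c) * (~~ exits y (nobits M) c)%:R.

Lemma thin_ge0 c y : 0 <= thin c y.
Proof.
apply: mulr_ge0 => //; apply: divr_ge0; first exact: ltW.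
exact: le_trans (ltW s00) (hs0 c).
Qed.

Lemma thin_le1 c y : thin c y <= 1.
Proof.
rewrite /thin; case: (exits _ _ _); rewrite ?mulr0 // mulr1 ler_pdivrMr ?mul1r //.
exact: lt_le_trans s00 (hs0 c).
Qed.

Lemma Ex_thin c : Ex (@wt R M p d n) (thin c) = s0.
Proof.
rewrite /thin ExZ -/(Pr _ _) divfK // gt_eqF //; exact: lt_le_trans s00 (hs0 c).
Qed.

Definition single k (v : X) : R := (v.1 == onebar i0 k)%:R * thin (cell k) v.2.

Lemma single_ge0 k v : 0 <= single k v.
Proof. by apply: mulr_ge0 => //; apply: thin_ge0. Qed.

Lemma Ex_single k : Ex u (single k) = q ^+ M.-1 * p * s0.
Proof.
rewrite Ex_pair -(Pr_onebar k) /Pr -ExZr; apply: eq_Ex => b /=.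
by rewrite /single /= ExZ Ex_thin.
Qed.

Lemma sum_single_le1 v : \sum_(k < M.-1) single k v <= 1.
Proof.
case: (boolP [exists k : 'I_M.-1, v.1 == onebar i0 k]) => [/existsP [k /eqP e]|/existsPn H].
  rewrite (bigD1 k) //= big1 ?addr0.
    by rewrite /single e eqxx mul1r thin_le1.
  move=> k' k'k; rewrite /single e; case: eqP => [/ffunP /(_ (cell k))|_]; last by rewrite mul0r.
  rewrite !ffunE eqxx => /esym/eqP /iter_ordS_inj H.
  case/eqP: k'k; apply: val_inj; rewrite /= H //; have := ltn_ord k; have := ltn_ord k'; lia.
by rewrite big1 // => k _; rewrite /single (negbTE (H k)) mul0r.
Qed.

(** For each [k] a product over the children, so that its expectation factors; [thin] is the only
    source of fractional values. *)
Definition cand w (x : {ffun 'I_d -> X}) : R := \sum_(k < M.-1)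
  \prod_j (if j == w then single k (x j) else (oneside i0 k (x j).1)%:R).

Lemma cand_ge0 w x : 0 <= cand w x.
Proof.
by apply: sumr_ge0 => k _; apply: prodr_ge0 => j _; case: ifP => // _; apply: single_ge0.
Qed.

Lemma cand_le w x : cand w x <= \sum_(k < M.-1) single k (x w).
Proof.
apply: ler_sum => k _; rewrite (bigD1 w) //= eqxx ler_piMr ?single_ge0 //.
apply: prodr_ile1 => j /negbTE ->; by rewrite ler0n -[1]/(1%:R) ler_nat leq_b1.
Qed.

Lemma cand_survive w (x : conf M d n.+1) : cand w x != 0 -> ~~ exits x (nobits M) i0.
Proof.
apply: contraNN => ex; rewrite /cand big1 // => k _.
case: (boolP ((x w).1 == onebar i0 k)) => [/eqP e|/negbTE ne]; last first.
  by rewrite (bigD1 w) //= eqxx /single ne !mul0r.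
case: (boolP [forall j, (j != w) ==> oneside i0 k (x j).1]) => [/forallP H|].
  rewrite (bigD1 w) //= eqxx /single /thin (exits_through (w := w) (ltn_ord k) ex e).
    by rewrite mulr0 mulr0 mul0r.
  by move=> j jw; have := H j; rewrite jw.
case/forallPn => j; rewrite negb_imply => /andP[jw nj].
by rewrite (bigD1 j) //= (negbTE jw) (negbTE nj) mul0r.
Qed.

(** A Bonferroni inequality for weights in [[0, 1]], each of which is nonzero only if the walk
    survives. *)
Lemma survive_ge (x : conf M d n.+1) :
  \sum_w cand w x - \sum_w \sum_(w' | w' != w) cand w x * cand w' x
  <= (~~ exits x (nobits M) i0)%:R.
Proof.
set S := \sum_w cand w x; pose Q := \sum_w cand w x * cand w x.
have -> : \sum_w \sum_(w' | w' != w) cand w x * cand w' x = S * S - Q.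
  rewrite /Q /S mulr_suml -sumrB; apply: eq_bigr => w _.
  by rewrite mulr_sumr [in RHS](bigD1 w) //= addrAC subrr add0r.
have S0 : 0 <= S by apply: sumr_ge0 => w _; apply: cand_ge0.
case: (boolP (exits x _ _)) => /= [ex|_].
  have z w : cand w x = 0 by apply/eqP; apply: contraTT ex => /cand_survive.
  by rewrite /S /Q !big1 ?mulr0 ?subrr // => w _; rewrite z ?mulr0.
have Q1 : Q <= S.
  apply: ler_sum => w _; rewrite ler_piMl ?cand_ge0 //.
  exact: le_trans (cand_le _ _) (sum_single_le1 _).
have Q2 : Q <= S * S.
  rewrite /S mulr_suml; apply: ler_sum => w _; apply: ler_wpM2l; first exact: cand_ge0.
  by rewrite (bigD1 w) //= lerDl; apply: sumr_ge0 => j _; apply: cand_ge0.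
(* For [S <= 1] the bound [Q <= S * S] suffices; for [S >= 1], [Q <= S] leaves [2 S - S^2 <= 1]. *)
nra.
Qed.

Lemma Ex_cand w : q ^+ M.-1 * p * s0 * (M.-1%:R * (1 - d%:R * p)
    - d%:R * p * p * \sum_(k < M.-1) k%:R * (M.-1 - k)%:R)
  <= Ex (prodw u) (cand w).
Proof.
rewrite /cand Ex_sum.
have -> : M.-1%:R * (1 - d%:R * p) - d%:R * p * p * \sum_(k < M.-1) k%:R * (M.-1 - k)%:R
   = \sum_(k < M.-1) (1 - d%:R * (p + k%:R * (M.-1 - k)%:R * (p * p))).
  rewrite mulr_natl -[in X in _ *+ X](card_ord M.-1) -sumr_const mulr_sumr -sumrB.
  by apply: eq_bigr => k _; ring.
rewrite mulr_sumr; apply: ler_sum => k _.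
rewrite (Ex_prod u (fun j (v : X) => if j == w then single k v else (oneside i0 k v.1)%:R)).
rewrite (bigD1 w) //= eqxx (@eq_Ex _ _ _ _ (single k)) // Ex_single.
apply: ler_wpM2l; first by rewrite mulr_ge0 ?mulr_ge0 ?exprn_ge0 // ltW.
rewrite (eq_bigr (fun=> Pr bW (oneside i0 k))) => [|j /negbTE jw]; last first.
  by rewrite -(Pr_xw_fst p01 d n (oneside i0 k)); apply: eq_Ex => v; rewrite jw.
rewrite prod_others; have kM : (k < M)%N by have := ltn_ord k; lia.
have N0 := Pr_ge0 hb (oneside i0 k); have N1 := Pr_le1 hb (oneside i0 k).
apply: le_trans (bernoulli_le _ _); last by rewrite N0.
have := Pr_oneside kM; set N := Pr _ _ in N0 N1 *; set e := p + _ => hN.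
have dd : d.-1%:R <= d%:R :> R by rewrite ler_nat leq_pred.
rewrite lerD2l lerN2; apply: ler_pM => //; first by rewrite subr_ge0.
by rewrite lerBlDr -lerBlDl.
Qed.

(** Forgetting the siblings leaves two factors that depend on different children, hence are
    independent. *)
Lemma Ex_cand2 w w' : w' != w ->
  Ex (prodw u) (fun x => cand w x * cand w' x) <= (M%:R * p * s0) ^+ 2.
Proof.
move=> ww'; pose S v := \sum_(k < M.-1) single k v.
have S0 v : 0 <= S v by apply: sumr_ge0 => k _; apply: single_ge0.
apply: (@le_trans _ _ (Ex (prodw u) (fun x : {ffun 'I_d -> X} => \prod_j
   (if (j == w) || (j == w') then S (x j) else 1)))).
  apply: (le_Ex (isdist_prod _ hu)) => x.
  rewrite (bigD1 w) //= eqxx (bigD1 w') //= eqxx orbT big1 ?mulr1.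
    by apply: ler_pM; rewrite ?cand_ge0 ?cand_le.
  by move=> j /andP[/negbTE-> /negbTE->].
rewrite (Ex_prod u (fun j v => if (j == w) || (j == w') then S v else 1)).
have ES : Ex u S <= M%:R * p * s0.
  rewrite /S Ex_sum (eq_bigr (fun=> q ^+ M.-1 * p * s0)) => [|k _]; last exact: Ex_single.
  rewrite sumr_const card_ord -[leLHS]mulr_natl.
  have -> : M%:R * p * s0 = M%:R * (1 * p * s0) by ring.
  apply: ler_pM => //; first by rewrite mulr_ge0 ?mulr_ge0 ?exprn_ge0 // ltW.
    by rewrite ler_nat leq_pred.
  apply: ler_wpM2r; first exact: ltW.
  by apply: ler_wpM2r => //; apply: exprn_ile1.
have ES0 : 0 <= Ex u S by apply: (Ex_ge0 hu).
rewrite (bigD1 w) //= (bigD1 w') //= big1 ?mulr1.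
  rewrite !eqxx orbT /= -/(Ex u S) expr2; apply: ler_pM => //.
move=> j /andP[/negbTE jw /negbTE jw']; rewrite jw jw' /=; exact: (Ex_cst hu).
Qed.

(** One generation: a term linear in [s0], whose slope is the mean of the branching process, minus a
    square. A small [s0] is thus reproduced once the slope exceeds one. *)
Lemma survive_rec :
  d%:R * (q ^+ M.-1 * p * s0 * (M.-1%:R * (1 - d%:R * p)
    - d%:R * p * p * \sum_(k < M.-1) k%:R * (M.-1 - k)%:R)) - (d%:R * (M%:R * p * s0)) ^+ 2
  <= Pr (@wt R M p d n.+1) (fun x => ~~ exits x (nobits M) i0).
Proof.
have hw : isdist (@wt R M p d n.+1) by apply: isdist_wt.
apply: le_trans (le_Ex hw survive_ge).
have -> : Ex (@wt R M p d n.+1) (fun x : conf M d n.+1 => \sum_w cand w x -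
     \sum_w \sum_(w' | w' != w) cand w x * cand w' x)
  = \sum_w (Ex (prodw u) (cand w)) -
    \sum_w \sum_(w' | w' != w) Ex (prodw u) (fun x => cand w x * cand w' x).
  rewrite ExB !Ex_sum; congr (_ - _); apply: eq_bigr => w _; by rewrite Ex_sum.
apply: lerB.
  rewrite mulr_natl -[in X in _ *+ X](card_ord d) -sumr_const.
  by apply: ler_sum => w _; apply: Ex_cand.
apply: (@le_trans _ _ (\sum_(w : 'I_d) \sum_(w' : 'I_d) (M%:R * p * s0) ^+ 2)).
  apply: ler_sum => w _; rewrite [leRHS](bigID (fun w' => w' != w)) /= -[leLHS]addr0.
  apply: lerD; first by apply: ler_sum => w' ww'; apply: Ex_cand2.
  by apply: sumr_ge0 => w' _; apply: sqr_ge0.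
rewrite !sumr_const !card_ord -mulrnA -[leLHS]mulr_natl natrM.
by rewrite le_eqVlt; apply/orP; left; apply/eqP; ring.
Qed.

End LowProb.

(** * Uniform survival *)

Section Numeric.
Variable R : realType.

Lemma expRN_le (x : R) m : m%:R <= x -> expR (- x) <= 2^-1 ^+ m.
Proof.
move=> mx; apply: (@le_trans _ _ (expR (- m%:R))); first by rewrite ler_expR lerN2.
rewrite -[m%:R]mulr1 -mulrN expRM_natl; apply: lerXn2r; rewrite ?nnegrE ?expR_ge0 ?invr_ge0 //.
rewrite expRN lef_pV2 ?posrE ?expR_gt0 //.
by have := expR_ge1Dx (1 : R); lra.
Qed.

(** The probability that a rate-one Poisson clock rings in a cell of length [h]. *)
Definition pbar (h : R) := 1 - expR (- h).

Lemma pbar01 h : 0 <= h -> 0 <= pbar h <= 1.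
Proof.
move=> h0; rewrite /pbar subr_ge0 lerBlDr lerDl expR_ge0 andbT.
by rewrite -expR0 ler_expR oppr_le0.
Qed.

Lemma pbar_le h : pbar h <= h.
Proof. by have := expR_ge1Dx (- h); rewrite /pbar; lra. Qed.

Lemma pbar_ge h : 0 <= h -> h * (1 - h) <= pbar h.
Proof.
move=> h0; have e1 := expR_ge1Dx h; have e2 := expRxMexpNx_1 h; rewrite /pbar.
have e3 := expR_ge0 (- h).
have h4 : (1 + h) * expR (- h) <= 1 by rewrite -[leRHS]e2; apply: ler_wpM2r.
have h5 : 0 <= h * h by apply: mulr_ge0.
have h6 : 0 <= h * h * (1 + h - 1) by apply: mulr_ge0 => //; lra.
suff : (1 + h) * (h * (1 - h)) <= (1 + h) * (1 - expR (- h)) by rewrite ler_pM2l; [|lra].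
nra.
Qed.

Lemma qX h k : (1 - pbar h) ^+ k = expR (- (k%:R * h)).
Proof. by rewrite /pbar opprB addrC subrK -mulrN expRM_natl. Qed.

Lemma count_tail N L : (\sum_(k < N) (N <= k + L)%N = minn N L)%N.
Proof.
elim: N => [|N IH]; first by rewrite big_ord0 min0n.
rewrite big_ord_recl /= add0n (eq_bigr (fun k : 'I_N => (N <= k + L)%N : nat)).
  by rewrite IH; case: leqP; lia.
by move=> k _; rewrite /bump /= add1n addSn ltnS.
Qed.

(** The geometric sum is at most [p / (1 - q ^+ m)], and [1 - q ^+ m >= 9 / 10 * (m * p)] because
    [q ^+ m >= 9 / 10] on so fine a mesh. *)
Lemma geo_le h m N : 0 <= h -> m%:R * h <= 10^-1 ->
  m%:R * \sum_(t < N) (1 - pbar h) ^+ (m * t) * pbar h <= 10 / 9.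
Proof.
move=> h0 mh; set q := 1 - pbar h; set p := pbar h.
have /andP[p0 p1] := pbar01 h0; rewrite -/p in p0 p1.
have q0 : 0 <= q by rewrite subr_ge0.
have q1 : q <= 1 by rewrite lerBlDr lerDl.
rewrite -mulr_suml; under eq_bigr do rewrite exprM; set S := \sum_(_ < _) _.
have S0 : 0 <= S by apply: sumr_ge0 => t _; rewrite !exprn_ge0.
have e1 : (1 - q ^+ m) * S <= 1.
  have -> : (1 - q ^+ m) * S = 1 - (q ^+ m) ^+ N.
    by rewrite -[1 - _ ^+ N]opprB subrX1 -/S -mulNr opprB.
  by rewrite lerBlDr lerDl !exprn_ge0.
have e2 : 9 / 10 * (m%:R * p) <= 1 - q ^+ m.
  have -> : 1 - q ^+ m = p * \sum_(i < m) q ^+ i.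
    by rewrite -[1 - _ ^+ m]opprB subrX1 -mulNr opprB ; congr (_ * _); rewrite /q /p; ring.
  have -> : 9 / 10 * (m%:R * p) = p * (9 / 10 *+ m) by rewrite -[_ *+ m]mulr_natr; ring.
  apply: ler_wpM2l => //; rewrite -[X in _ *+ X](card_ord m) -sumr_const; apply: ler_sum => i _.
  apply: (@le_trans _ _ (q ^+ m)); last by apply: ler_wiXn2l => //; apply: ltnW.
  by rewrite qX; have := expR_ge1Dx (- (m%:R * h)); lra.
have m0 : 0 <= m%:R * p :> R by apply: mulr_ge0.
have : 9 / 10 * (m%:R * p) * S <= 1 by apply: le_trans e1; apply: ler_wpM2r.
have -> : m%:R * (S * p) = m%:R * p * S by ring.
lra.
Qed.

Lemma exits0 M d p c : Pr (@xw R M p d 0) (fun x => exits x.2 x.1 c) = 0.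
Proof.
rewrite /Pr /Ex big1 // => x _.
by rewrite (_ : exits _ _ _ = false) ?mulr0 //; apply/asboolP => -[b []].
Qed.

Lemma rho_bound (d M : nat) (T : R) : (100 <= d)%N -> 20 <= d%:R * T ->
  10 * (d.+1%:R * T) <= M%:R -> forall n (c : 'I_M),
  Pr (@xw R M (pbar (T / M%:R)) d n) (fun x => exits x.2 x.1 c) <= 5^-1.
Proof.
move=> d100 dT MM; elim=> [|n IH] i0; first by rewrite exits0; lra.
have dR : 100 <= d%:R :> R by rewrite (ler_nat _ 100).
have T0 : 0 < T by rewrite -(pmulr_rgt0 T (_ : 0 < d%:R)); lra.
have M0 : 0 < M%:R :> R.
  apply: lt_le_trans MM; apply: mulr_gt0 => //; apply: mulr_gt0 => //; by rewrite ltr0n.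
set h := T / M%:R.
have h0 : 0 < h by apply: divr_gt0.
have Th : T = M%:R * h by rewrite mulrC divfK // gt_eqF.
have d1h : d.+1%:R * h <= 10^-1.
  rewrite /h mulrA ler_pdivrMr //; lra.
have d1R : d.+1%:R = d%:R + 1 :> R by rewrite -natr1.
have dh : d%:R * h <= 10^-1 by move: d1h; rewrite d1R mulrDl mul1r; lra.
have dh0 : 0 < d%:R * h by apply: mulr_gt0 => //; lra.
(* The window of [L] cells lasts between [5 / d] and [6 / d]: [d] edges stay silent in it with
   probability at most [2^-5], while a time above [13 / d] remains outside it. *)
pose L := (Num.truncn (5 / (d%:R * h))).+1.
have [L1 L2] : 5 <= d%:R * h * L%:R /\ d%:R * h * L%:R <= 6.
  have /andP[t1 t2] := truncn_itv (divr_ge0 (ler0n R 5) (ltW dh0)).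
  move: t1 t2; rewrite ler_pdivlMr // ltr_pdivrMr // -/L => t1 t2; split.
    by rewrite mulrC ltW.
  rewrite /L -natr1 mulrDr mulr1 mulrC; lra.
set p := pbar h; have p01 : 0 <= p <= 1 by apply: pbar01; apply: ltW.
have /andP[p0 p1] := p01; have ph : p <= h by apply: pbar_le.
have r0 : 0 <= 5^-1 :> R by rewrite invr_ge0.
apply: le_trans (exits_rec p01 IH i0 L r0) _.
have g1 := geo_le M.-1 (ltW h0) d1h; have g2 := geo_le M (ltW h0) dh.
rewrite -/p in g1 g2.
set G1 := \sum_(t < M.-1) (1 - p) ^+ (d.+1 * t) * p in g1 *.
set G2 := \sum_(t < M) (1 - p) ^+ (d * t) * p in g2 *.
have q0 k : 0 <= (1 - p) ^+ k by apply: exprn_ge0; rewrite subr_ge0.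
have G10 : 0 <= G1 by apply: sumr_ge0 => t _; apply: mulr_ge0.
have G20 : 0 <= G2 by apply: sumr_ge0 => t _; apply: mulr_ge0.
set C := (1 - p) ^+ (d * L) + _.
have M1 : M.-1%:R = M%:R - 1 :> R.
  by rewrite -subn1 natrB // -(ltr0n R).
have hC : C <= 2^-1 ^+ 5 + (10 / 9) * 100^-1 + (10 / 9) * 5^-1.
  rewrite /C -addrA; apply: lerD.
    by rewrite qX; apply: expRN_le; rewrite natrM; lra.
  have dd : d.-1%:R <= d%:R :> R by rewrite ler_nat leq_pred.
  have h1 : G2 * (d.-1%:R * 5^-1) <= G2 * (d%:R * 5^-1).
    by apply: ler_wpM2l => //; apply: ler_wpM2r.
  have h2 : 100 * G2 <= d%:R * G2 by apply: ler_wpM2r.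
  have h3 : G2 * (d%:R * 5^-1) = d%:R * G2 * 5^-1 by ring.
  rewrite mulrDr mulr1; lra.
have C0 : 0 <= C by apply: addr_ge0 => //; apply: mulr_ge0 => //; apply: addr_ge0 => //; apply: mulr_ge0.
have a1 : G1 <= 50^-1.
  have : 101 * G1 <= d.+1%:R * G1 by apply: ler_wpM2r => //; rewrite d1R; lra.
  lra.
have a2 : (1 - p) ^+ (d * M.-1) <= 2^-1 ^+ 13.
  rewrite qX; apply: expRN_le; rewrite natrM M1.
  have -> : d%:R * (M%:R - 1) * h = d%:R * (M%:R * h) - d%:R * h by ring.
  rewrite -Th; lra.
(* The indicator selects at most [L] cells, all so late that silence of [d.+1] edges up to them has
   probability at most [2^-13]; the other terms form a geometric series. *)
have a3 : \sum_(k < M.-1) (1 - p) ^+ (d.+1 * k) * p *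
   ((M.-1 <= k + L)%N%:R + L%:R * p + 5^-1 * C) <=
   L%:R * h * 2^-1 ^+ 13 + G1 * (L%:R * p + 5^-1 * C).
  rewrite /G1 mulr_suml.
  apply: (@le_trans _ _ (\sum_(k < M.-1) ((M.-1 <= k + L)%N%:R * (h * 2^-1 ^+ 13) +
     (1 - p) ^+ (d.+1 * k) * p * (L%:R * p + 5^-1 * C)))).
    apply: ler_sum => k _; rewrite -addrA mulrDr lerD2r.
    case: (leqP M.-1 (k + L)) => kL; last by rewrite mulr0 mul0r.
    rewrite mulr1 mul1r mulrC; apply: ler_pM => //.
    rewrite qX; apply: expRN_le; rewrite natrM.
    have kL' : M%:R - 1 - L%:R <= k%:R :> R.
      by rewrite -M1 lerBlDr -natrD ler_nat.
    have k0 : 0 <= k%:R :> R by [].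
    have : d%:R * h * (M%:R - 1 - L%:R) <= d%:R * h * k%:R by apply: ler_wpM2l => //; apply: ltW.
    have : 0 <= h * k%:R by apply: mulr_ge0 => //; apply: ltW.
    have : d%:R * h * (M%:R - 1 - L%:R) = d%:R * (M%:R * h) - d%:R * h - d%:R * h * L%:R by ring.
    rewrite -Th d1R; have -> : (d%:R + 1) * k%:R * h = d%:R * h * k%:R + h * k%:R by ring.
    lra.
  rewrite big_split /= lerD2r -mulr_suml -natr_sum count_tail -mulrA.
  apply: ler_wpM2r; first by apply: mulr_ge0; [apply: ltW|apply: exprn_ge0; rewrite invr_ge0].
  by rewrite ler_nat geq_minr.
have Lp : d%:R * (L%:R * p) <= 6.
  apply: le_trans L2; have -> : d%:R * h * L%:R = d%:R * (L%:R * h) by ring.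
  by do 2 apply: ler_wpM2l => //.
have Lp0 : 0 <= L%:R * p by apply: mulr_ge0.
have a4 : L%:R * p <= 6 / 100.
  have : 100 * (L%:R * p) <= d%:R * (L%:R * p) by apply: ler_wpM2r.
  lra.
have dG : d%:R * G1 <= 10 / 9.
  apply: le_trans g1; apply: ler_wpM2r => //; rewrite d1R; lra.
have a5 : d%:R * (L%:R * h * 2^-1 ^+ 13 + G1 * (L%:R * p + 5^-1 * C)) <=
    6 * 2^-1 ^+ 13 + 10 / 9 * (L%:R * p + 5^-1 * C).
  rewrite mulrDr; apply: lerD.
    have -> : d%:R * (L%:R * h * 2^-1 ^+ 13) = d%:R * h * L%:R * 2^-1 ^+ 13 by ring.
    by apply: ler_wpM2r => //; apply: exprn_ge0; rewrite invr_ge0.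
  by rewrite mulrA; apply: ler_wpM2r => //; apply: addr_ge0 => //; apply: mulr_ge0.
have a6 : d%:R * (\sum_(k < M.-1) (1 - p) ^+ (d.+1 * k) * p *
   ((M.-1 <= k + L)%N%:R + L%:R * p + 5^-1 * C)) <=
   6 * 2^-1 ^+ 13 + 10 / 9 * (L%:R * p + 5^-1 * C).
  by apply: le_trans a5; apply: ler_wpM2l.
move: a6 hC a2; have -> : 2^-1 ^+ 13 = 8192^-1 :> R by rewrite exprVn -natrX.
have -> : 2^-1 ^+ 5 = 32^-1 :> R by rewrite exprVn -natrX.
lra.
Qed.

(** The discrete form of the integral of [u (T - u)] over [[0, T]], and the origin of the factor
    [1 / 6]. *)
Lemma sum_parab N : \sum_(k < N) k%:R * (N - k)%:R = (N%:R ^+ 3 - N%:R) / 6 :> R.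
Proof.
(* Decoupling the constant in the summand from the upper limit makes induction possible. *)
have gen (c : R) m : \sum_(k < m) k%:R * (c - k%:R) =
    c * (m%:R * (m%:R - 1) / 2) - m%:R * (m%:R - 1) * (2 * m%:R - 1) / 6.
  elim: m => [|m IH]; first by rewrite big_ord0; field.
  by rewrite big_ord_recr /= IH -natr1; field.
rewrite (eq_bigr (fun k : 'I_N => k%:R * (N%:R - k%:R))) => [|k _].
  by rewrite gen; field.
by rewrite natrB // ltnW.
Qed.

Lemma Pr_survive_low (d : nat) (T : R) : 0 < T -> d%:R * T <= 20 -> T <= 1 ->
  1 < d%:R * T * (1 - T) * (1 - d%:R * T ^+ 2 / 6) ->
  exists2 s0, 0 < s0 & exists M0, forall M, (M0 <= M)%N -> forall n (c : 'I_M),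
  s0 <= Pr (@wt R M (pbar (T / M%:R)) d n) (fun y => ~~ exits y (nobits M) c).
Proof.
move=> T0 dT T1; set m0 := (X in 1 < X) => m01.
have dT0 : 0 <= d%:R * T by apply: mulr_ge0 => //; apply: ltW.
set e := d%:R * T ^+ 2 / 6 in m0 m01 *.
have e0 : 0 <= e by rewrite divr_ge0 // mulr_ge0 // exprn_ge0 // ltW.
set K := d%:R * T * (1 - T) in m0 m01 *.
have K0 : 0 <= K by apply: mulr_ge0 => //; rewrite subr_ge0.
have K20 : K <= 20.
  by rewrite -[leRHS]mulr1; apply: ler_pM => //; lra.
(* Half of the excess [m0 - 1] absorbs the mesh error, at most [20 * dl]; the other half absorbs the
   square, at most [(20 * s0) ^+ 2] since [d T <= 20]. *)
exists ((m0 - 1) / 800); first by apply: divr_gt0 => //; lra.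
have m020 : m0 <= 20 by apply: le_trans K20; rewrite /m0 ler_piMr // lerBlDr lerDl.
set s0 := (m0 - 1) / 800; have s00 : 0 < s0 by apply: divr_gt0 => //; lra.
pose M0 := (Num.truncn (40 * (1 + d%:R * T + T) / (m0 - 1))).+2.
exists M0 => M M0M.
have MR : 40 * (1 + d%:R * T + T) / (m0 - 1) < M%:R.
  have := truncnS_gt (40 * (1 + d%:R * T + T) / (m0 - 1)); move/lt_le_trans; apply.
  by rewrite ler_nat; apply: leq_trans M0M; rewrite /M0.
have M1 : (0 < M)%N by apply: leq_trans M0M.
have MR0 : 0 < M%:R :> R by rewrite ltr0n.
set h := T / M%:R; have h0 : 0 < h by apply: divr_gt0.
have Th : T = M%:R * h by rewrite mulrC divfK // gt_eqF.
set dl := (1 + d%:R * T + T) / M%:R.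
have dlE : dl = M%:R^-1 + d%:R * h + h by rewrite /dl /h; field; rewrite gt_eqF.
have hdl : 40 * dl <= m0 - 1.
  rewrite /dl mulrA ler_pdivrMr //; move: MR; rewrite ltr_pdivrMr; [lra|lra].
have dl0 : 0 <= dl by rewrite divr_ge0 //; lra.
elim=> [|n IH] c.
  rewrite (_ : Pr _ _ = 1); first by rewrite /s0; lra.
  rewrite /Pr (@eq_Ex _ _ _ _ (fun=> 1)) => [|y].
    by apply: Ex_cst; apply: isdist_wt; apply: pbar01; apply: ltW.
  by rewrite (_ : exits _ _ _ = false) //; apply/asboolP => -[b []].
have p01 := pbar01 (ltW h0); rewrite -/h in IH *; set p := pbar h in p01 IH *.
have /andP[p0 p1] := p01; have ph : p <= h by apply: pbar_le.
have pg : h * (1 - h) <= p by apply: pbar_ge; apply: ltW.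
apply: le_trans (survive_rec c p01 s00 IH).
have M1R : M.-1%:R = M%:R - 1 :> R by rewrite -subn1 natrB.
have qM : 1 - T <= (1 - p) ^+ M.-1.
  apply: (@le_trans _ _ ((1 - p) ^+ M)).
    rewrite qX -Th; exact: expR_ge1Dx.
  by apply: ler_wiXn2l; rewrite ?leq_pred // ?subr_ge0 // lerBlDr lerDl.
rewrite sum_parab M1R.
set br := (M%:R - 1) * (1 - d%:R * p) - _.
have hM : h * M%:R = T by rewrite mulrC.
have brlow : M%:R * (1 - e - M%:R^-1 - d%:R * h) <= br.
  have b1 : (M%:R - 1) * (1 - d%:R * h) <= (M%:R - 1) * (1 - d%:R * p).
    apply: ler_wpM2l; first by rewrite subr_ge0 ler1n.
    by rewrite lerD2l lerN2; apply: ler_wpM2l.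
  have b2 : d%:R * p * p * (((M%:R - 1) ^+ 3 - (M%:R - 1)) / 6) <= M%:R * e.
    have -> : M%:R * e = d%:R * h * h * (M%:R ^+ 3 / 6) by rewrite /e Th; ring.
    have Mge : 1 <= M%:R :> R by rewrite ler1n.
    apply: ler_pM.
    - by rewrite !mulr_ge0.
    - rewrite divr_ge0 // subr_ge0.
      case: (M) M1 => // -[|M'] _; first by rewrite subrr expr0n.
      have -> : M'.+2%:R - 1 = M'.+1%:R :> R by rewrite -natr1 addrK.
      by rewrite -natrX ler_nat; apply: (@leq_pexp2l M'.+1 1 3).
    - by apply: ler_pM; rewrite ?mulr_ge0 //; apply: ler_wpM2l.
    - apply: ler_wpM2r; first by rewrite invr_ge0.
      rewrite lerBlDr.
      have : (M%:R - 1) ^+ 3 <= M%:R ^+ 3 :> R.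
        by apply: lerXn2r; rewrite ?nnegrE ?subr_ge0 ?ler0n //; lra.
      have : 0 <= M%:R - 1 :> R by lra.
      lra.
  have b3 : M%:R * (1 - e - M%:R^-1 - d%:R * h) = M%:R - M%:R * e - 1 - M%:R * (d%:R * h).
    by field; rewrite gt_eqF.
  have b4 : 0 <= d%:R * h by apply: mulr_ge0 => //; apply: ltW.
  rewrite /br b3; lra.
have tpos : 0 < 1 - e - dl.
  have h1 : 0 < K * (1 - e - dl).
    have -> : K * (1 - e - dl) = m0 - K * dl by rewrite /m0; ring.
    have : K * dl <= 20 * dl by apply: ler_wpM2r.
    lra.
  by move: h1; rewrite pmulr_rgt0 // lt_neqAle K0 andbT eq_sym; apply: contraTneq m01 => k0; rewrite /m0 k0 mul0r ltr10.
have A1 : T * (1 - T) * (1 - e - dl) <= (1 - p) ^+ M.-1 * p * br.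
  apply: (@le_trans _ _ ((1 - T) * (h * (1 - h)) * (M%:R * (1 - e - M%:R^-1 - d%:R * h)))).
    set a := 1 - e - M%:R^-1 - d%:R * h.
    have -> : (1 - T) * (h * (1 - h)) * (M%:R * a) = T * (1 - T) * ((1 - h) * a).
      by rewrite -{2}hM; ring.
    apply: ler_wpM2l; first by apply: mulr_ge0; lra.
    have -> : 1 - e - dl = a - h by rewrite dlE /a; ring.
    have : 0 <= M%:R^-1 :> R by rewrite invr_ge0.
    have : 0 <= d%:R * h by apply: mulr_ge0 => //; apply: ltW.
    move=> x1 x2; have : h * a <= h * 1 by apply: ler_wpM2l; [apply: ltW|rewrite /a; lra].
    lra.
  have h1 : h <= 1 by rewrite /h ler_pdivrMr // mul1r; apply: le_trans T1 _; rewrite ler1n.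
  have a0 : 0 <= 1 - e - M%:R^-1 - d%:R * h by move: tpos; rewrite dlE; lra.
  apply: ler_pM => //.
  - by apply: mulr_ge0; [lra|apply: mulr_ge0; lra].
  - by apply: mulr_ge0 => //; apply: ltW.
  - by apply: ler_pM => //; [lra|apply: mulr_ge0; lra].
have A2 : (d%:R * (M%:R * p * s0)) ^+ 2 <= 400 * s0 * s0.
  have x0 : 0 <= d%:R * (M%:R * p * s0).
    by apply: mulr_ge0 => //; apply: mulr_ge0; [apply: mulr_ge0|apply: ltW].
  have x1 : d%:R * (M%:R * p * s0) <= 20 * s0.
    rewrite mulrA; apply: ler_wpM2r; first exact: ltW.
    apply: le_trans dT; apply: ler_wpM2l => //; rewrite Th; exact: ler_wpM2l.
  have -> : 400 * s0 * s0 = (20 * s0) ^+ 2 by ring.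
  by apply: lerXn2r => //; rewrite nnegrE // mulr_ge0 // ltW.
have A3 : (m0 - (m0 - 1) / 2) * s0 <= d%:R * ((1 - p) ^+ M.-1 * p * s0 * br).
  have -> : d%:R * ((1 - p) ^+ M.-1 * p * s0 * br) = d%:R * ((1 - p) ^+ M.-1 * p * br) * s0 by ring.
  apply: ler_wpM2r; first exact: ltW.
  apply: (@le_trans _ _ (d%:R * (T * (1 - T) * (1 - e - dl)))); last exact: ler_wpM2l.
  have -> : d%:R * (T * (1 - T) * (1 - e - dl)) = m0 - K * dl by rewrite /m0 /K; ring.
  have : K * dl <= 20 * dl by apply: ler_wpM2r.
  lra.
apply: le_trans (lerB A3 A2).
have : 400 * s0 = (m0 - 1) / 2 by rewrite /s0; field.
by move=> e4; rewrite e4 -mulrBl; apply: ler_peMl; [apply: ltW|lra].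
Qed.

Lemma discrete_survival (d : nat) (T : R) : 0 < T ->
  ((100 <= d)%N /\ 20 <= d%:R * T) \/ [/\ d%:R * T <= 20, T <= 1 &
  1 < d%:R * T * (1 - T) * (1 - d%:R * T ^+ 2 / 6)] ->
  exists2 s0, 0 < s0 & exists M0, forall M, (M0 <= M)%N -> forall n (c : 'I_M),
  s0 <= Pr (@wt R M (pbar (T / M%:R)) d n) (fun y => ~~ exits y (nobits M) c).
Proof.
move=> T0 [[d100 dT]|[dT T1 m1]]; last exact: Pr_survive_low.
exists (4 / 5); first by apply: divr_gt0.
exists (Num.truncn (10 * (d.+1%:R * T))).+1 => M MM n c.
have MR : 10 * (d.+1%:R * T) <= M%:R.
  apply: ltW; have := truncnS_gt (10 * (d.+1%:R * T)); move/lt_le_trans; apply.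
  by rewrite ler_nat.
have h0 : 0 <= T / M%:R by rewrite divr_ge0 // ltW.
have p01 := pbar01 h0; set p := pbar _ in p01 *.
have hw : isdist (@wt R M p d n) by apply: isdist_wt.
rewrite (PrC hw); have := rho_bound d100 dT MR n c; rewrite -/p.
(* Averaging over the bars of the parent edge only makes coming back easier than having none. *)
suff : Pr (@wt R M p d n) (fun y => exits y (nobits M) c) <=
   Pr (@xw R M p d n) (fun x => exits x.2 x.1 c) by lra.
have hb : isdist (@bitsw R M p) by apply: isdist_bits.
rewrite -[leLHS](Ex_cst hb) [leRHS]Ex_pair; apply: (le_Ex hb) => b; apply: (le_Pr hw) => y /=.
by apply: exits_mono => i _; rewrite ffunE.
Qed.

End Numeric.

(** * From the threshold on [T] to one of the two regimes *)

Section Regimes.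
Variable R : realType.

(* [d + 1] is the degree.  With [x = d T], the mean number of useful offspring
   exceeds one as soon as [x^2 + x^3 / 6 < d (x - 1)], and on [1, 20] the
   left-hand side is at most [7 / 6 + 92 (x - 1)]. *)
Lemma regimes (d : nat) (c T : R) : (100 <= d)%N ->
  7 / 6 * (d%:R + 1) ^+ 2 < (d%:R - 92) * ((c - 1) * d%:R - 1) ->
  d.+1%:R^-1 + c * d.+1%:R ^- 2 <= T ->
  0 < T /\ (((100 <= d)%N /\ 20 <= d%:R * T) \/ [/\ d%:R * T <= 20, T <= 1 &
  1 < d%:R * T * (1 - T) * (1 - d%:R * T ^+ 2 / 6)]).
Proof.
move=> d100 hc hT; set D : R := d%:R in hc *.
have D100 : 100 <= D by rewrite /D (ler_nat _ 100).
have d1 : d.+1%:R = D + 1 :> R by rewrite -natr1.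
(* At the smallest admissible [T], [(D * T - 1) * (D + 1) ^+ 2] equals [(c - 1) * D - 1], which
   explains the form of the hypothesis. *)
have u0 : 7 / 6 * (D + 1) ^+ 2 < (D - 92) * (D * T - 1) * (D + 1) ^+ 2.
  apply: lt_le_trans hc _; rewrite -mulrA; apply: ler_wpM2l; first by lra.
  have : D * (d.+1%:R^-1 + c * d.+1%:R ^- 2) <= D * T by apply: ler_wpM2l => //; lra.
  have -> : D * (d.+1%:R^-1 + c * d.+1%:R ^- 2) = (D * (D + 1) + c * D) / (D + 1) ^+ 2.
    by rewrite d1; field; rewrite gt_eqF //; lra.
  rewrite ler_pdivrMr; last by rewrite exprn_gt0 //; lra.
  have := sqr_ge0 (D + 1); rewrite !expr2; lra.
have {}u0 : 7 / 6 < (D - 92) * (D * T - 1).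
  by move: u0; rewrite ltr_pM2r // exprn_gt0 //; lra.
have x1 : 0 < D * T - 1.
  have : 0 < (D - 92) * (D * T - 1) by lra.
  by rewrite pmulr_rgt0 //; lra.
have T0 : 0 < T.
  have : 0 < D * T by lra.
  by rewrite pmulr_rgt0 //; lra.
split=> //; case: (leP 20 (D * T)) => [le|lt]; first by left.
right; have T5 : T <= 5^-1.
  have : 100 * T <= D * T by apply: ler_wpM2r => //; apply: ltW.
  lra.
split; [exact: ltW|by lra|].
set x := D * T in u0 x1 lt *.
(* [x^2 + x^3 / 6 - 7 / 6 = (x - 1) (x^2 + 7 x + 7) / 6], and for [x <= 20] the factor
   [(x^2 + 7 x + 7) / 6] is at most [547 / 6 < 92]. *)
have key : x * x + x * x * x / 6 < D * (x - 1).
  have x10 : 0 <= x - 1 by lra.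
  have x20 : 0 <= 20 - x by lra.
  have a1 : 0 <= (x - 1) * (20 - x) by apply: mulr_ge0.
  have a2 : 0 <= (x - 1) * (20 - x) * x by apply: mulr_ge0 => //; lra.
  lra.
have e1 : D * (x * (1 - T - D * T ^+ 2 / 6)) = D * x - (x * x + x * x * x / 6).
  by rewrite /x; field.
have e2 : 1 < x * (1 - T - D * T ^+ 2 / 6).
  have D0 : 0 < D by lra.
  by rewrite -(ltr_pM2l D0) e1; lra.
apply: (lt_le_trans e2); rewrite -[leRHS]mulrA; apply: ler_wpM2l; first by lra.
have : 0 <= T * (D * T ^+ 2 / 6).
  by rewrite mulr_ge0 ?divr_ge0 ?mulr_ge0 ?exprn_ge0 //; lra.
lra.
Qed.

Lemma regime3 (d0 : nat) (T : R) : (1287 <= d0)%N -> d0%:R^-1 + 3 * d0%:R ^- 2 <= T ->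
  let d := d0.-1 in
  0 < T /\ (((100 <= d)%N /\ 20 <= d%:R * T) \/ [/\ d%:R * T <= 20, T <= 1 &
  1 < d%:R * T * (1 - T) * (1 - d%:R * T ^+ 2 / 6)]).
Proof.
case: d0 => // d hd hT; apply: (regimes (c := 3)) hT; first by lia.
have hD : 1286 <= d%:R :> R by rewrite (ler_nat _ 1286).
rewrite expr2; set D : R := d%:R in hD *.
have : 1286 * D <= D * D by apply: ler_wpM2r => //; lra.
rewrite /=; lra.
Qed.

Lemma regime_eps (eps : R) : 0 < eps -> exists d0' : nat, forall d0 : nat,
  (d0' <= d0)%N -> (100 < d0)%N /\ forall T : R, d0%:R^-1 + (13%:R / 6%:R + eps) * d0%:R ^- 2 <= T ->
  let d := d0.-1 in
  0 < T /\ (((100 <= d)%N /\ 20 <= d%:R * T) \/ [/\ d%:R * T <= 20, T <= 1 &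
  1 < d%:R * T * (1 - T) * (1 - d%:R * T ^+ 2 / 6)]).
Proof.
(* For [c = 13 / 6 + eps] the terms [7 / 6 D^2] cancel, and it suffices that [eps * (D - 92)] exceed
   [332 / 3], rounded up to [111]. *)
move=> e0; exists ((Num.truncn (92 + 111 / eps)).+1 + 102)%N.
case=> [|d hd]; first by rewrite addnS.
split=> [|T hT]; first by lia.
have hD : 92 + 111 / eps < d%:R.
  apply: lt_le_trans (truncnS_gt (92 + 111 / eps)) _; rewrite ler_nat.
  by apply: leq_trans (_ : (_ <= (Num.truncn (92 + 111 / eps)).+1 + 101)%N) _;
    rewrite ?leq_addr // -ltnS -addnS.
have d100 : (100 <= d)%N by lia.
apply: (regimes d100) hT.
have hD' : 111 < (d%:R - 92) * eps by rewrite -ltr_pdivrMr //; lra.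
have D100 : 100 <= d%:R :> R by rewrite (ler_nat _ 100).
set D : R := d%:R in hD' D100 *.
have : D * 111 < D * ((D - 92) * eps) by rewrite ltr_pM2l //; lra.
rewrite expr2; lra.
Qed.

End Regimes.

Require Import Defs.
From mathcomp Require Import all_classical all_reals all_analysis.

(** * From trajectories to discrete paths *)

Section Tree.
Variable d0 : nat.
Implicit Types u v w : tvert d0.

Lemma tadjP u w : tadj u w ->
  (exists j, w = j :: u /\ tedge_of u w = w) \/ (exists j, u = j :: w /\ tedge_of u w = u).
Proof.
rewrite /tadj /tedge_of => /orP [] /andP[].
  by case: w => // j w _ /eqP <-; left; exists j; rewrite /= ltnS leqnn.
case: u => // j u _ /eqP <-; right; exists j; split=> //.
by rewrite /= ltnNge leqnSn.
Qed.

Lemma tadj_child u j : tadj u (j :: u). Proof. by rewrite /tadj /= eqxx. Qed.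

Lemma tadj_sym u w : tadj u w = tadj w u. Proof. by rewrite /tadj orbC. Qed.

Lemma tedge_child u j : tedge_of u (j :: u) = j :: u.
Proof. by rewrite /tedge_of /= ltnS leqnn. Qed.

Lemma tedge_parent u j : tedge_of (j :: u) u = j :: u.
Proof. by rewrite /tedge_of /= ltnNge leqnSn. Qed.

Lemma tedge_sym u w : tadj u w -> tedge_of u w = tedge_of w u.
Proof.
by case/tadjP=> -[j [-> _]]; rewrite tedge_child tedge_parent.
Qed.

Lemma tincident_edge u w : tadj u w -> tincident u (tedge_of u w).
Proof.
by case/tadjP=> -[j [-> _]]; rewrite ?tedge_child ?tedge_parent /tincident /= eqxx ?orbT.
Qed.

Lemma tincident_size u e : tincident u e -> (0 < size e <= (size u).+1)%N.
Proof.
by case: e => // j e /andP[_ /orP[/eqP <-|/eqP <-]] /=; rewrite ?leqnSn ?leqnn.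
Qed.

Lemma tincident_sizeW n u e : (size u < n)%N -> tincident u e -> (0 < size e <= n)%N.
Proof. by move=> un /tincident_size /andP[-> /leq_trans ->]. Qed.

Lemma tincidentP u e : tincident u e -> exists2 w, tadj u w & tedge_of u w = e.
Proof.
case: e => // j e /andP[_ /orP[/eqP <-|/= /eqP ->]].
  by exists e; rewrite ?tedge_parent // tadj_sym tadj_child.
by exists (j :: u); rewrite ?tedge_child // tadj_child.
Qed.

Lemma tadj_size u w : tadj u w -> (size w <= (size u).+1)%N.
Proof. by case/tadjP=> -[j [-> _]] /=; lia. Qed.

Lemma tedge_inj u w w' : tadj u w -> tadj u w' -> tedge_of u w = tedge_of u w' -> w = w'.
Proof.
case/tadjP=> -[j [e ->]]; case/tadjP=> -[j' [e' ->]] //.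
- by move=> ew; move: e; rewrite ew => /(congr1 size) /=; lia.
- by move=> ew; move: e'; rewrite -ew => /(congr1 size) /=; lia.
- by move=> _; move: e'; rewrite e => -[].
Qed.

End Tree.

(** * Continuous trajectories against paths through cells *)

Section Paths.
Context {R : realType} (d0 : nat) {dO : measure_display} {Omega : measurableType dO}.
Variables (N : tvert d0 -> Omega -> R -> nat) (om : Omega) (T : R).
Hypothesis T0 : 0 < T.
Hypothesis Nmono : forall e s t, 0 <= s -> s <= t -> (N e om s <= N e om t)%N.
Hypothesis Nrc : forall e t, 0 <= t -> exists2 delta : R, 0 < delta &
       forall s, t <= s -> s < t + delta -> N e om s = N e om t.
Implicit Types u v w x y e : tvert d0.

(** [stir_rel] in inductive form, confined below level [n] so that finitely many edges matter. *)
Inductive traj (n : nat) : R -> tvert d0 -> tvert d0 -> Prop :=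
| traj_end a u : (size u < n)%N -> a <= T ->
    (forall w, tincident u w -> N w om T = N w om a) -> traj n a u u
| traj_jump a u v b y : (size u < n)%N -> a < b -> b <= T -> tadj u v ->
    rings_at N (tedge_of u v) om b ->
    (forall w, tincident u w -> forall s, a < s -> s < b -> N w om s = N w om a) ->
    traj n b v y -> traj n a u y.

Lemma traj_stir_gen n a x y : 0 <= a -> traj n a x y -> exists (vs : seq (tvert d0)) (ts : seq R),
    size vs = size ts /\
    last x vs = y /\
    (forall i, (i < size ts)%N -> nth 0 (a :: ts) i < nth 0 (a :: ts) i.+1) /\
    last a ts <= T /\
    (forall i, (i < size vs)%N ->
       let u := nth x (x :: vs) i in
       let v := nth x (x :: vs) i.+1 in
       let a := nth 0 (a :: ts) i in
       let b := nth 0 (a :: ts) i.+1 in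
       tadj u v /\ rings_at N (tedge_of u v) om (nth 0 ts i) /\
       forall w, tincident u w ->
         forall s, a < s -> s < nth 0 ts i -> N w om s = N w om a) /\
    (forall w, tincident y w -> N w om T = N w om (last a ts)).
Proof.
move=> a0 H; elim: H a0 => {a x y} [a u _ aT H|a u v b y _ ab bT uv rb nr _ IH] a0.
  by exists [::], [::].
have [|vs [ts [H1 [H2 [H3 [H4 [H5 H6]]]]]]] := IH; first by apply: le_trans a0 (ltW ab).
exists (v :: vs), (b :: ts); split; first by rewrite /= H1.
split=> //; split; first by case=> // i; apply: H3.
split=> //; split=> // -[|i] /=; first by [].
rewrite ltnS => iv; have := H5 i iv.
by rewrite !(set_nth_default u v) //= ltnS ltnW.
Qed.

Lemma traj_stir n x y : traj n 0 x y -> stir_rel N om T x y.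
Proof.
move=> /(traj_stir_gen (lexx _)) [vs [ts [H1 [H2 [H3 [H4 [H5 H6]]]]]]].
by exists vs, ts.
Qed.

Lemma stir_traj_gen n a x y (vs : seq (tvert d0)) (ts : seq R) :
  (forall v, v \in (x :: vs : seq (seq _)) -> (size v < n)%N) ->
  size vs = size ts -> last x vs = y ->
  (forall i, (i < size ts)%N -> nth 0 (a :: ts) i < nth 0 (a :: ts) i.+1) ->
  last a ts <= T ->
  (forall i, (i < size vs)%N ->
     let u := nth x (x :: vs) i in
     let v := nth x (x :: vs) i.+1 in
     let a' := nth 0 (a :: ts) i in
     let b := nth 0 (a :: ts) i.+1 in
     tadj u v /\ rings_at N (tedge_of u v) om b /\
     forall w, tincident u w ->
       forall s, a' < s -> s < b -> N w om s = N w om a') ->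
  (forall w, tincident y w -> N w om T = N w om (last a ts)) -> traj n a x y.
Proof.
elim: vs ts x a => [|v vs IH] [|b ts] x a szx //= H1 H2 H3 H4 H5 H6.
  by rewrite -H2 in H6 *; apply: traj_end => //; apply: szx; rewrite mem_head.
have [h1 [h2 h3]] := H5 0%N isT.
have lastle : forall (c : R) l, (forall i, (i < size l)%N -> nth 0 (c :: l) i < nth 0 (c :: l) i.+1) -> c <= last c l.
  move=> c l; elim: l c => //= c' l IHl c H; apply: (@le_trans _ _ c').
    by apply: ltW; apply: (H 0%N).
  by apply: IHl => i il; apply: (H i.+1).
have H3' : forall i, (i < size ts)%N -> nth 0 (b :: ts) i < nth 0 (b :: ts) i.+1.
  by move=> i il; apply: (H3 i.+1).
apply: (@traj_jump n a x v b y) => //.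
- by apply: szx; rewrite mem_head.
- exact: (H3 0%N).
- exact: le_trans (lastle _ _ H3') H4.
- apply: (IH ts) => //.
  + by move=> v' v'in; apply: szx; rewrite in_cons v'in orbT.
  + by case: H1.
  + move=> i il; have := H5 i.+1 il; rewrite /=.
    rewrite !(set_nth_default v x) //=; last by rewrite ltnS ltnW.
Qed.

Lemma stir_traj x y : stir_rel N om T x y -> exists n0, forall n, (n0 <= n)%N -> traj n 0 x y.
Proof.
case=> vs [ts [H1 [H2 [H3 [H4 [H5 H6]]]]]].
exists (\max_(v <- x :: vs) size v).+1 => n hn; apply: (stir_traj_gen (vs := vs) (ts := ts)) => //.
by move=> v vin; apply: leq_ltn_trans hn; apply: (@leq_bigmax_seq _ _ xpredT size).
Qed.

Variable M : nat.
Hypothesis M0 : (0 < M)%N.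

Definition tm (i : nat) : R := i%:R * (T / M%:R).

Let h0 : 0 < T / M%:R. Proof. by rewrite divr_gt0 // ltr0n. Qed.

Lemma tm_ge0 i : 0 <= tm i. Proof. by rewrite mulr_ge0 // ltW. Qed.

Lemma tm_ltS i : tm i < tm i.+1.
Proof. by rewrite /tm ltr_pM2r // ltr_nat. Qed.

Lemma tm_le i j : (i <= j)%N -> tm i <= tm j.
Proof. by move=> ij; rewrite /tm ler_pM2r // ler_nat. Qed.

Lemma tmM : tm M = T.
Proof. by rewrite /tm mulrC divfK // pnatr_eq0 -lt0n. Qed.

Definition bar e (i : nat) : bool := (N e om (tm i) < N e om (tm i.+1))%N.

Lemma nobarP e i : ~~ bar e i -> N e om (tm i.+1) = N e om (tm i).
Proof.
rewrite -leqNgt => H; apply/eqP; rewrite eqn_leq H Nmono ?tm_ge0 //; exact/ltW/tm_ltS.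
Qed.

(** At most one ring per cell among the edges up to level [n]: no order inside a cell is lost by
    keeping only the bits. *)
Definition sep n := (forall e i, (0 < size e <= n)%N -> (i < M)%N ->
    (N e om (tm i.+1) <= (N e om (tm i)).+1)%N) /\
  (forall e e' i, (0 < size e <= n)%N -> (0 < size e' <= n)%N -> (i < M)%N ->
     bar e i -> bar e' i -> e = e').

Definition dstep (i : nat) u w := (w = u /\ forall e, tincident u e -> ~~ bar e i) \/
  (tadj u w /\ bar (tedge_of u w) i).

Fixpoint lpath (n : nat) (s : seq nat) u y : Prop :=
  if s is i :: s' then exists w, [/\ (size w < n)%N, dstep i u w & lpath n s' w y]
  else u = y.

Lemma sandwich e s t r : 0 <= s -> s <= r -> r <= t -> N e om t = N e om s ->
  N e om r = N e om s.
Proof.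
move=> s0 sr rt e1; apply/eqP; rewrite eqn_leq (Nmono _ s0 sr) andbT -e1.
by apply: Nmono => //; apply: le_trans sr.
Qed.

(** The jump at time [b] has used the only ring of cell [i], so the new vertex hears nothing in the
    rest of the cell. *)
Lemma after_ring n i b u v : sep n -> (i < M)%N -> (size u < n)%N -> (size v < n)%N ->
  tadj u v -> bar (tedge_of u v) i -> tm i <= b -> b <= tm i.+1 ->
  (N (tedge_of u v) om (tm i) < N (tedge_of u v) om b)%N ->
  forall w, tincident v w -> N w om (tm i.+1) = N w om b.
Proof.
move=> [s1 s2] iM un vn uv be ib bi lt w vw.
have wn : (0 < size w <= n)%N by exact: tincident_sizeW vn vw.
have en : (0 < size (tedge_of u v) <= n)%N.
  exact: tincident_sizeW un (tincident_edge uv).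
have b0 : 0 <= b by apply: le_trans (tm_ge0 _) ib.
case: (boolP (bar w i)) => bw.
  rewrite (s2 _ _ _ wn en iM bw be); apply/eqP; rewrite eqn_leq (Nmono _ b0 bi) andbT.
  by apply: leq_trans (s1 _ _ en iM) lt.
rewrite (nobarP bw); apply/esym; apply: sandwich ib bi _; first exact: tm_ge0.
exact: nobarP.
Qed.

(** The last jump time [a] may lie well before [tm i]; the invariant is that the current vertex
    hears nothing in between. *)
Lemma traj_lpath n k i a u y : sep n -> (i + k = M)%N -> traj n a u y -> 0 <= a -> a <= tm i ->
  (forall w, tincident u w -> N w om (tm i) = N w om a) -> lpath n (iota i k) u y.
Proof.
move=> sp; elim: k i a u y => [|k IH] i a u y ik tr a0 ai cond.
  rewrite addn0 in ik; case: tr a0 ai cond => {a u y} // a u v b y _ ab bT uv [_ rb] _ _ a0 ai cond.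
  have := rb a a0 ab; rewrite ltnNge -(cond _ (tincident_edge uv)) ik tmM Nmono //.
  exact: le_trans (ltW ab).
have iM : (i < M)%N by rewrite -ik addnS ltnS leq_addr.
have tiT : tm i.+1 <= T by rewrite -tmM tm_le.
case: tr (tr) a0 ai cond => {a u y} [a u un aT c tr a0 ai cond|
   a u v b y un ab bT uv rg nr tr' tr a0 ai cond].
  have c' w : tincident u w -> N w om (tm i.+1) = N w om a.
    move=> uw; apply: sandwich (c _ uw) => //; exact: le_trans ai (ltW (tm_ltS _)).
  exists u; split=> //; last by apply: (IH i.+1 a) => //; [by rewrite addSnnS|exact: le_trans ai (ltW (tm_ltS _))].
  left; split=> // e ue; by rewrite -leqNgt c' // cond.
have e1 := tincident_edge uv; case: (rg) => b0 rb.
have bi : tm i < b.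
  rewrite ltNge; apply/negP => bi; have := rb a a0 ab.
  by rewrite ltnNge -(cond _ e1) Nmono // ltW.
case: (ltP (tm i.+1) b) => bi1.
  have c' w : tincident u w -> N w om (tm i.+1) = N w om a.
    move=> uw; apply: nr => //; exact: le_lt_trans ai (tm_ltS _).
  exists u; split=> //; last by apply: (IH i.+1 a) => //; [by rewrite addSnnS|exact: le_trans ai (ltW (tm_ltS _))].
  left; split=> // e ue; by rewrite -leqNgt c' // cond.
have lt : (N (tedge_of u v) om (tm i) < N (tedge_of u v) om b)%N by apply: rb => //; apply: tm_ge0.
have be : bar (tedge_of u v) i.
  by apply: leq_trans lt _; apply: Nmono => //; apply: ltW.
have vn : (size v < n)%N by case: tr'.
exists v; split=> //; first by right.
apply: (IH i.+1 b v y _ tr' (ltW b0) bi1); first by rewrite addSnnS.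
by apply: (after_ring sp iM un vn uv) => //; apply: ltW.
Qed.

(** The infimum of the times at which the count exceeds its value at [s]; right continuity shows
    that it belongs to this set. *)
Lemma ring_exists e s t : 0 <= s -> s <= t -> (N e om s < N e om t)%N ->
  exists b, [/\ s < b, b <= t, (N e om s < N e om b)%N & rings_at N e om b].
Proof.
move=> s0 st lt; pose A := [set r | s <= r /\ (N e om s < N e om r)%N]%classic.
have At : A t by [].
have Ai : has_inf A.
  by split; [exists t|exists s => r []].
pose b := inf A.
have sb : s <= b by apply: lb_le_inf; [exists t|move=> r []].
have bt : b <= t by apply: ge_inf => //; exists s => r [].
have b0 : 0 <= b by apply: le_trans sb.
have [dl dl0 H] := Nrc e b0.
have [r [sr lr] rb] := inf_adherent dl0 Ai.
have br : b <= r by apply: ge_inf => //; exists s => r' [].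
have lb : (N e om s < N e om b)%N by rewrite -(H r).
have sb' : s < b.
  by rewrite lt_neqAle sb andbT; apply: contraTneq lb => ->; rewrite ltnn.
exists b; split=> //; split; first exact: le_lt_trans sb'.
move=> r' r'0 r'b; apply: leq_ltn_trans lb; rewrite leqNgt; apply/negP => lr'.
case: (leP s r') => sr'; last first.
  by move: lr'; rewrite ltnNge Nmono // ltW.
suff : b <= r' by rewrite leNgt r'b.
by apply: ge_inf => //; exists s => z [].
Qed.

Lemma lpath_traj n k i a u y : sep n -> (i + k = M)%N -> lpath n (iota i k) u y ->
  (size u < n)%N -> 0 <= a -> a <= tm i ->
  (forall w, tincident u w -> N w om (tm i) = N w om a) -> traj n a u y.
Proof.
move=> sp; elim: k i a u => [|k IH] i a u ik /= P un a0 ai cond.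
  rewrite addn0 in ik; rewrite -P; apply: traj_end => //.
    by rewrite -tmM -ik.
  by move=> w uw; rewrite -cond // ik tmM.
have iM : (i < M)%N by rewrite -ik addnS ltnS leq_addr.
have tiT : tm i.+1 <= T by rewrite -tmM tm_le.
have ai1 := le_trans ai (ltW (tm_ltS i)).
case: P => v [vn [[-> nb]|[uv be]] P].
  apply: (IH i.+1) => //; first by rewrite addSnnS.
  by move=> w uw; rewrite nobarP ?cond // nb.
have [b [ib bi lt rg]] := ring_exists (tm_ge0 i) (ltW (tm_ltS i)) be.
have e1 := tincident_edge uv.
have en : (0 < size (tedge_of u v) <= n)%N by exact: tincident_sizeW un e1.
apply: (@traj_jump n a u v b) => //.
- exact: le_lt_trans ib.
- exact: le_trans bi tiT.
- move=> w uw s as_ sb.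
  have s0 : 0 <= s by apply: le_trans a0 (ltW as_).
  have wn : (0 < size w <= n)%N by exact: tincident_sizeW un uw.
  case: (boolP (bar w i)) => bw; last first.
    apply: (@sandwich w a (tm i.+1)) => //; [exact: ltW|exact: le_trans (ltW sb) bi|].
    by rewrite nobarP ?cond.
  have ew := sp.2 _ _ _ wn en iM bw be; rewrite ew.
  apply/eqP; rewrite eqn_leq (Nmono _ a0 (ltW as_)) andbT -(cond _ e1) -ltnS.
  have h2 : (N (tedge_of u v) om b <= (N (tedge_of u v) om (tm i)).+1)%N.
    by apply: leq_trans (sp.1 _ _ en iM); apply: Nmono => //; apply: le_trans a0 (ltW (lt_trans as_ sb)).
  by apply: leq_trans h2; rewrite -ltnS ltnS; apply: rg.2.
- apply: (IH i.+1) => //; [by rewrite addSnnS|exact: le_trans (tm_ge0 i) (ltW ib)|].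
  by apply: (after_ring sp iM un vn uv) => //; apply: ltW.
Qed.

Lemma dstep_fun n i u w w' : sep n -> (i < M)%N -> (size u < n)%N ->
  dstep i u w -> dstep i u w' -> w = w'.
Proof.
move=> [_ s2] iM un [[-> nb]|[uw b]] [[-> nb']|[uw' b']] //.
- by have := nb _ (tincident_edge uw'); rewrite b'.
- by have := nb' _ (tincident_edge uw); rewrite b.
- apply: (tedge_inj uw uw'); apply: (s2 _ _ i) => //.
    exact: tincident_sizeW un (tincident_edge uw).
  exact: tincident_sizeW un (tincident_edge uw').
Qed.

Lemma dstep_sym i u w : dstep i u w -> dstep i w u.
Proof.
case=> [[-> nb]|[uw b]]; first by left.
by right; rewrite tadj_sym uw -tedge_sym.
Qed.

Lemma lpath_cat n s1 s2 u w y : lpath n s1 u w -> lpath n s2 w y -> lpath n (s1 ++ s2) u y.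
Proof.
elim: s1 u => [|i s1 IH] u /=; first by move=> ->.
by case=> v [vn st P] Q; exists v; split=> //; apply: IH.
Qed.

(** Transpositions are involutions, so the reversed cells lead back; surjectivity and injectivity of
    the permutation come from this. *)
Lemma lpath_rev n s u y : (size u < n)%N -> lpath n s u y -> lpath n (rev s) y u.
Proof.
elim: s u => [|i s IH] u un /=; first by move=> ->.
case=> v [vn st P]; rewrite rev_cons -cats1; apply: lpath_cat (IH _ vn P) _.
by exists u; split=> //; apply: dstep_sym.
Qed.

Lemma lpath_size n s u y : (size u < n)%N -> lpath n s u y -> (size y < n)%N.
Proof. by elim: s u => [|i s IH] u un /= => [<-//|[v [vn _]]]; apply: IH. Qed.

Lemma lpath_fun n s u y y' : sep n -> all (fun i => (i < M)%N) s -> (size u < n)%N ->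
  lpath n s u y -> lpath n s u y' -> y = y'.
Proof.
move=> sp; elim: s u => [|i s IH] u /=; first by move=> _ _ -> ->.
move=> /andP[iM sM] un [v [vn st P]] [v' [vn' st' P']].
by rewrite (dstep_fun sp iM un st st') in vn P *; apply: IH P P'.
Qed.

Fixpoint chain (s : seq nat) (k : nat) u : Prop :=
  match k, s with
  | 0, _ => True
  | _.+1, [::] => False
  | k'.+1, i :: s' => chain s' k u \/
      exists w, [/\ tadj u w, bar (tedge_of u w) i & chain s' k' w]
  end.

Lemma chain0 s u : chain s 0 u. Proof. by case: s. Qed.

(** Without a chain of [k] bars the path makes fewer than [k] jumps, each raising the level by at
    most one. *)
Lemma nochain_lpath n s k u : ~ chain s k u -> (size u + k <= n)%N -> exists y, lpath n s u y.
Proof.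
elim: s k u => [|i s IH] k u nc uk; first by exists u.
case: k nc uk => [[]//|k] nc uk.
have [ex|nex] := pselect (exists2 e, tincident u e & bar e i).
    case: ex => e /tincidentP [w uw <-] be.
    have nc' : ~ chain s k w by move=> c; apply: nc; right; exists w.
    have k0 : (0 < k)%N by case: k nc' {uk nc} => // /(_ (chain0 _ _)).
    have wu := tadj_size uw.
    have wk : (size w + k <= n)%N.
      by rewrite addnS in uk; apply: leq_trans uk; rewrite -addSn leq_add2r.
    have [y P] := IH _ _ nc' wk; exists y, w; split=> //; last by right.
    by apply: leq_trans wk; rewrite -addn1 leq_add2l.
  have [|y P] := IH k.+1 u _ uk; first by move=> c; apply: nc; left.
  exists y, u; split=> //; first by apply: leq_trans uk; rewrite addnS ltnS leq_addr.
  by left; split=> // e ue; apply/negP => be; apply: nex; exists e.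
Qed.

Lemma lpath_stir n x y : sep n -> (size x < n)%N -> lpath n (iota 0 M) x y -> stir_rel N om T x y.
Proof.
move=> sp xn P; apply: (@traj_stir n).
apply: (lpath_traj sp (add0n M) P xn) => // [|w _]; last by rewrite /tm mul0r.
by rewrite /tm mul0r.
Qed.

Lemma traj_lpath0 n x y : sep n -> traj n 0 x y -> lpath n (iota 0 M) x y.
Proof.
move=> sp tr; apply: (traj_lpath sp (add0n M) tr) => // [|w _]; last by rewrite /tm mul0r.
by rewrite /tm mul0r.
Qed.

Definition bitsOf e : bits M := [ffun i : 'I_M => bar e i].

Fixpoint confOf m u : conf M d0.-1 m :=
  match m with
  | 0 => tt
  | m'.+1 => [ffun j => (bitsOf (j :: u), confOf m' (j :: u))]
  end.

(** Time is cyclic here, unlike in [lpath]: each full turn applies the permutation once. *)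
Fixpoint rpath (n L : nat) (i : 'I_M) u z : Prop :=
  if L is L'.+1 then exists w, [/\ (size w < n)%N, dstep i u w & rpath n L' (ordS i) w z]
  else u = z.

Lemma rpath_cat n L1 L2 i u w z : rpath n L1 i u w ->
  rpath n L2 (iter L1 (@ordS M) i) w z -> rpath n (L1 + L2) i u z.
Proof.
elim: L1 i u => [|L1 IH] i u; first by move=> /= ->.
case=> v [vn st P]; rewrite iterSr => Q; exists v; split=> //; exact: IH Q.
Qed.

Lemma rpath_last n L i u z : rpath n L.+1 i u z ->
  exists w, rpath n L i u w /\ dstep (iter L (@ordS M) i) w z.
Proof.
elim: L i u => [|L IH] i u; first by case=> v [_ st /= <-]; exists u.
case=> v [vn st P]; have [w [P' st']] := IH _ _ P.
exists w; split; last by rewrite iterSr.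
by exists v.
Qed.

Lemma lpath_rpath n k (i : 'I_M) u y : (i + k <= M)%N -> lpath n (iota i k) u y -> rpath n k i u y.
Proof.
elim: k i u => [|k IH] i u //= ik [w [wn st P]]; exists w; split=> //.
case: k IH ik P => [|k] IH ik P //; rewrite addnS in ik.
have e : ordS i = i.+1 :> nat by rewrite /= modn_small //; apply: leq_trans ik; rewrite ltnS addnS ltnS leq_addr.
by apply: IH; rewrite e ?addSn.
Qed.

Lemma dstep_children n i u j : sep n -> (size u < n)%N -> tincident u j -> bar j i -> (i < M)%N ->
  forall j', tincident u j' -> j' != j -> ~~ bar j' i.
Proof.
move=> [_ s2] un uj bj iM j' uj' jj'; apply: contra jj' => bj'; apply/eqP.
by apply: (s2 _ _ i) => //; apply: tincident_sizeW un _.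
Qed.

Lemma suffixW (j : 'I_d0.-1) u z : suffix (j :: u) z -> suffix u z.
Proof.
by case/suffixP=> s ->; apply/suffixP; exists (rcons s j); rewrite cat_rcons.
Qed.

(* A path leaving the subtree of [u] does so for the first time through a bar
   of the edge above [u]; this converts a path into the recursion [ex]. *)
Lemma rpath_exit n L m u i z : sep n -> (size u + m)%N = n -> u != [::] -> (size u < n)%N ->
  rpath n L i u z -> ~~ suffix u z ->
  exists b L', [/\ (L' < L)%N, ex (confOf m u) (bitsOf u) i b,
    rpath n L' (ordS b) (behead u) z & iter L' (@ordS M) (ordS b) = iter L (@ordS M) i].
Proof.
move=> sp; elim/ltn_ind: L m u i => -[|L] IH m u i um u0 un P nz.
  by have e : u = z := P; rewrite e suffix_refl in nz.
case: m um => [|m] um; first by rewrite addn0 in um; rewrite um ltnn in un.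
have iM := ltn_ord i.
have uu : tincident u u by rewrite /tincident u0 eqxx.
have uc j : tincident u (j :: u) by rewrite /tincident /= eqxx orbT.
case: P => w [wn st P].
case: st P wn => [[-> nb] P _|[uw be] P wn].
  have [b [L' [LL' E P' it]]] := IH L (ltnSn _) m.+1 u (ordS i) um u0 un P nz.
  exists b, L'; split=> //; [by apply: ltnW| |by rewrite it -iterSr].
  apply: pole_skip => //; first by rewrite ffunE nb.
  by move=> j; rewrite !ffunE /= ?ffunE nb.
have uni := dstep_children sp un (tincident_edge uw) be iM.
case/tadjP: uw => -[j [e ee]]; rewrite ee in be uni; last first.
  exists i, L; rewrite -iterSr; split=> //; first by apply: pole_exit; rewrite ffunE.
  by move: P; rewrite e.
subst w; rewrite /= in wn.
have nz' : ~~ suffix (j :: u) z by apply: contra nz; apply: suffixW.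
have [] := IH L (ltnSn _) m (j :: u) (ordS i) _ _ _ P nz' => //=; first by rewrite addSnnS.
move=> b1 [L1 [LL1 E1 P1 it1]].
have [|b [L' [LL' E P' it]]] := IH L1 _ m.+1 u (ordS b1) um u0 un P1 nz; first exact: ltnW.
exists b, L'; split=> //; [|  |by rewrite it it1 -iterSr].
  by apply: ltn_trans LL' _; apply: ltn_trans LL1 _.
apply: (pole_child (w := j) (j := b1)) => //.
- rewrite ffunE; apply: uni => //; by apply/eqP => /(congr1 size) /n_Sn.
- by rewrite !ffunE /= ?ffunE.
- move=> w' w'j; rewrite !ffunE /= ?ffunE; apply: uni => //.
  by apply: contra w'j => /eqP [->].
- by rewrite !ffunE.
Qed.

Lemma rpath_root n L m x i lst : sep n -> (size x + m)%N = n -> (size x < n)%N ->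
  (forall i : 'I_M, ~~ bar x i) ->
  rpath n L i x x -> iter L (@ordS M) i = lst ->
  exists b, ex (confOf m x) (pred1 lst) i b.
Proof.
move=> sp; elim/ltn_ind: L m i => L IH m i xm xn nbx P it.
case: m xm => [|m] xm; first by rewrite addn0 in xm; rewrite xm ltnn in xn.
case: (eqVneq i lst) => [e|ne]; first by exists i; apply: pole_exit; rewrite /= e.
case: L IH P it => [|L] IH P it; first by move: ne; rewrite -it eqxx.
have xc j : tincident x (j :: x) by rewrite /tincident /= eqxx orbT.
case: P => w [wn st P]; case: st P wn => [[-> nb] P _|[xw be] P wn].
  have [] // := IH L (ltnSn _) m.+1 (ordS i) xm xn nbx P; first by rewrite -iterSr.
  move=> b E; exists b; apply: pole_skip => // j; by rewrite !ffunE /= ?ffunE nb.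
have uni := dstep_children sp xn (tincident_edge xw) be (ltn_ord i).
case/tadjP: xw => -[j [e ee]]; rewrite ee in be uni; last first.
  by move: (nbx i); rewrite be.
subst w; rewrite /= in wn.
have nz' : ~~ suffix (j :: x) x.
  apply/negP => /suffixP [s] /(congr1 size)/eqP; rewrite size_cat /= addnS -addSn.
  by rewrite -{1}[size x]add0n eqn_add2r.
have [] := @rpath_exit n L m (j :: x) (ordS i) x sp _ _ _ P nz' => //=; first by rewrite addSnnS.
move=> b1 [L1 [LL1 E1 P1 it1]].
have [] // := IH L1 _ m.+1 (ordS b1) xm xn nbx P1; [exact: ltnW|by rewrite it1 -iterSr|].
move=> b E; exists b; apply: (pole_child (w := j) (j := b1)) => //.
- by rewrite !ffunE /= ?ffunE.
- move=> w' w'j; rewrite !ffunE /= ?ffunE; apply: uni => //.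
  by apply: contra w'j => /eqP [->].
- by rewrite !ffunE.
Qed.

(** When it fails, [x] is cut off from its parent, and a closed walk through [x] would spend its
    last cell on the pole of [x]. Cell [lst] then serves as entrance, with no other bar above. *)
Definition bad_conf m (lst : 'I_M) (v : bits M * conf M d0.-1 m.+1) : bool :=
  [|| [exists i, v.1 i], [exists j, (v.2 j).1 lst] | exits v.2 (nobits M) lst].

Definition xconfOf m x : bits M * conf M d0.-1 m := (bitsOf x, confOf m x).

Lemma closed_bad n m L x (lst : 'I_M) : sep n -> (size x + m.+1)%N = n ->
  ordS lst = 0%N :> nat -> iter L (@ordS M) (ordS lst) = lst ->
  rpath n L.+1 (ordS lst) x x -> bad_conf lst (xconfOf m.+1 x).
Proof.
move=> sp xm l0 it P; apply/or3P.
case: (boolP [exists i, bitsOf x i]) => [H|/existsPn nb]; first by constructor 1.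
case: (boolP [exists j, ((confOf m.+1 x : {ffun _ -> _}) j).1 lst]) => [H|/existsPn nc]; first by constructor 2.
constructor 3; apply/asboolP.
have xn : (size x < n)%N by rewrite -xm addnS ltnS leq_addr.
have nbx (i : 'I_M) : ~~ bar x i by have := nb i; rewrite ffunE.
have [w [P' st]] := rpath_last P; rewrite it in st.
(* A jump in cell [lst] would need a bar of the parent edge or of a child there. *)
have ew : w = x.
  case: (dstep_sym st) => [[]//|[xw]]; case/tadjP: xw => -[j [e ->]].
    by move=> bw; have := nc j; rewrite !ffunE /= ?ffunE -e bw.
  by move=> bw; have := nbx lst; rewrite bw.
rewrite ew in P'; have [b E] := rpath_root sp xm xn nbx P' it.
exists b; apply: eq_pole E => // i /=; by rewrite ffunE.
Qed.

End Paths.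

(** * The permutation and its finite cycles *)

Section Sigma.
Context {R : realType} (d0 : nat) {dO : measure_display} {Omega : measurableType dO}.
Variables (N : tvert d0 -> Omega -> R -> nat) (om : Omega) (T : R).
Hypothesis T0 : 0 < T.
Hypothesis Nmono : forall e s t, 0 <= s -> s <= t -> (N e om s <= N e om t)%N.
Hypothesis Nrc : forall e t, 0 <= t -> exists2 delta : R, 0 < delta &
       forall s, t <= s -> s < t + delta -> N e om s = N e om t.
Implicit Types u v w x y e : tvert d0.
Variable K : nat -> nat.


Definition sepn n := sep N om T (K n).+1 n.

Definition nochain k n x := ~ chain N om T (K n).+1 (iota 0 (K n).+1) k x /\
  ~ chain N om T (K n).+1 (rev (iota 0 (K n).+1)) k x.

Hypothesis GS : forall n0, exists2 n, (n0 <= n)%N & sepn n.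
Hypothesis GC : forall x, exists k n, [/\ (size x + k <= n)%N, sepn n & nochain k n x].

Lemma all_iotaM k : all (fun i => (i < k)%N) (iota 0 k).
Proof. by apply/allP => i; rewrite mem_iota add0n. Qed.

Lemma traj_size n a x y : traj N om T n a x y -> (size x < n)%N.
Proof. by case. Qed.

(** Images exist by [GC]; they are unique because two trajectories can be compared at one separated
    level, where paths are deterministic. Reversed cells give the same for preimages. *)
Lemma sigma_exists : exists sigma : tvert d0 -> tvert d0, bijective sigma /\
  (forall x y, stir_rel N om T x y <-> sigma x = y).
Proof.
have fwd x : exists y, stir_rel N om T x y.
  have [k [n [xk sp [nc _]]]] := GC x.
  have [y P] := nochain_lpath nc xk; exists y; apply: (lpath_stir T0 Nmono Nrc _ sp _ P) => //.
  by case: k nc xk => [[]|k _]; [apply: chain0|rewrite addnS; apply: leq_ltn_trans (leq_addr _ _)].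
have bwd y : exists x, stir_rel N om T x y.
  have [k [n [xk sp [_ nc]]]] := GC y.
  have yn : (size y < n)%N.
    by case: k nc xk => [[]|k _]; [apply: chain0|rewrite addnS; apply: leq_ltn_trans (leq_addr _ _)].
  have [x P] := nochain_lpath nc xk; exists x.
  apply: (lpath_stir T0 Nmono Nrc _ sp (lpath_size yn P)) => //.
  by have := lpath_rev yn P; rewrite revK.
have fun1 x y y' : stir_rel N om T x y -> stir_rel N om T x y' -> y = y'.
  move=> /stir_traj [n1 H1] /stir_traj [n2 H2].
  have [n hn sp] := GS (maxn n1 n2); move: hn; rewrite geq_max => /andP[/H1 t1 /H2 t2].
  apply: (lpath_fun (M := (K n).+1) sp (all_iotaM _) (traj_size t1)).
    exact: traj_lpath0 sp t1.
  exact: traj_lpath0 sp t2.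
have inj x x' y : stir_rel N om T x y -> stir_rel N om T x' y -> x = x'.
  move=> /stir_traj [n1 H1] /stir_traj [n2 H2].
  have [n hn sp] := GS (maxn n1 n2); move: hn; rewrite geq_max => /andP[/H1 t1 /H2 t2].
  have P1 := traj_lpath0 T0 Nmono (ltn0Sn (K n)) sp t1.
  have P2 := traj_lpath0 T0 Nmono (ltn0Sn (K n)) sp t2.
  apply: (lpath_fun (M := (K n).+1) (s := rev (iota 0 (K n).+1)) sp _ (lpath_size (traj_size t1) P1)).
  - by rewrite all_rev all_iotaM.
  - exact: lpath_rev (traj_size t1) P1.
  - exact: lpath_rev (traj_size t2) P2.
pose sigma x := projT1 (cid (fwd x)); pose tau y := projT1 (cid (bwd y)).
have sP x : stir_rel N om T x (sigma x) by rewrite /sigma; case: cid.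
have tP y : stir_rel N om T (tau y) y by rewrite /tau; case: cid.
exists sigma; split.
  exists tau => x; [exact: inj (tP _) (sP _)|exact: fun1 (sP _) (tP _)].
by move=> x y; split=> [H|<- //]; apply: fun1 (sP _) H.
Qed.

(** The depth is [n - size x] for [size x < n], written as a successor to expose the children;
    [ord_max] is the cell cyclically before cell [0]. *)
Definition bad_stage n x := bad_conf ord_max (xconfOf N om T (K n).+1 (n - (size x).+1).+1 x).

Lemma finite_orbit_cycle (sigma : tvert d0 -> tvert d0) x : injective sigma ->
  finite_set [set y | exists n : nat, iter n sigma x = y \/ iter n sigma y = x]%classic ->
  exists k, iter k.+1 sigma x = x.
Proof.
move=> inj /finite_seqP [s es].
have ins k : iter k sigma x \in (s : seq (seq 'I_d0.-1)).
  suff : [set` s]%classic (iter k sigma x) by [].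
  by rewrite -es; exists k; left.
have iinj k : injective (iter k sigma) by elim: k => [|k IH] a b //= /inj /IH.
have : ~~ uniq ([seq iter k sigma x | k <- iota 0 (size s).+1] : seq (seq 'I_d0.-1)).
  apply/negP => un; have : (size [seq iter k sigma x | k <- iota 0 (size s).+1] <= size s)%N.
    by apply: (uniq_leq_size un) => v /mapP [k _ ->]; apply: ins.
  by rewrite size_map size_iota ltnn.
have [H|H] := pselect (exists i j, (i < j)%N /\ iter i sigma x = iter j sigma x).
  case: H => i [j [ij e]] _; exists (j - i).-1; rewrite prednK ?subn_gt0 //.
  by apply: (iinj i); rewrite -iterD subnKC // ltnW.
rewrite map_inj_in_uniq ?iota_uniq // => i j _ _ e; apply/eqP/negPn/negP => ij.
by apply: H; case/orP: (leq_total i j) => le; [exists i, j|exists j, i];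
  split=> //; rewrite ltn_neqAle le ?andbT // eq_sym.
Qed.

(** A finite cycle needs finitely many turns and vertices, so at every large separated level it
    appears as a closed discrete walk. *)
Lemma no_cycle_bad : ~ stirring_infinite_cycle N om T -> forall x,
  exists n0, forall n, (n0 <= n)%N -> sepn n -> bad_stage n x.
Proof.
move=> nic x; have [sigma [bij graph]] := sigma_exists.
have inj := bij_inj bij.
have [k cyc] : exists k, iter k.+1 sigma x = x.
  apply: (finite_orbit_cycle inj); apply: contrapT => inf; apply: nic.
  by exists sigma; split=> //; split=> //; exists x.
have [n0 H] : exists n0, forall n, (n0 <= n)%N -> sepn n -> (size x < n)%N /\
    rpath N om T n (k.+1 * (K n).+1) (ord0 : 'I_(K n).+1) x (iter k.+1 sigma x).
  elim: k.+1 => [|j [n0 IH]].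
    by exists (size x).+1 => n xn _; split.
  have /stir_traj [n1 H1] : stir_rel N om T (iter j sigma x) (iter j.+1 sigma x) by apply/graph.
  exists (maxn n0 n1) => n; rewrite geq_max => /andP[/IH {}IH /H1 tr] sp.
  have [xn P] := IH sp; split=> //; rewrite mulSn addnC; apply: rpath_cat P _.
  rewrite (_ : iter _ _ _ = ord0); last first.
    by apply: val_inj; rewrite val_iter_ordS /= add0n modnMl.
  apply: lpath_rpath => //; exact: traj_lpath0 sp tr.
exists n0 => n /H {}H sp; have [xn] := H sp; rewrite cyc => P.
apply: (@closed_bad _ _ _ _ _ _ _ _ n (n - (size x).+1) (k * (K n).+1 + K n)) => //.
- by rewrite -addSnnS subnKC.
- by rewrite /= modnn.
- rewrite -iterSr; apply: val_inj; rewrite val_iter_ordS /=.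
  by rewrite -addnS addnC -mulSnr modnMDl modn_small.
- move: P; rewrite mulSn addnC addnS; congr rpath; by apply: val_inj; rewrite /= modnn.
Qed.

End Sigma.

(** * The law of the bars *)

Local Open Scope classical_set_scope.
Local Open Scope ring_scope.

Section RealProb.
Context {R : realType} {dO : measure_display} {Omega : measurableType dO}.
Variable P : probability Omega R.

Definition pr (A : set Omega) : R := fine (P A).

Lemma prE A : measurable A -> P A = (pr A)%:E.
Proof. by move=> mA; rewrite /pr fineK // fin_num_measure. Qed.

Lemma pr_ge0 A : 0 <= pr A.
Proof. by rewrite /pr fine_ge0. Qed.

Lemma le_pr A B : measurable A -> measurable B -> A `<=` B -> pr A <= pr B.
Proof.
by move=> mA mB AB; rewrite -lee_fin -!prE //; apply: le_measure; rewrite ?inE.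
Qed.

Lemma pr_set0 : pr set0 = 0.
Proof. by rewrite /pr measure0. Qed.

Lemma prU_le A B : measurable A -> measurable B -> pr (A `|` B) <= pr A + pr B.
Proof.
move=> mA mB; rewrite -lee_fin EFinD -!prE //; last exact: measurableU.
exact: measureU2.
Qed.

Lemma prU A B : measurable A -> measurable B -> A `&` B = set0 -> pr (A `|` B) = pr A + pr B.
Proof.
move=> mA mB AB; apply: EFin_inj; rewrite EFinD -!prE //; last exact: measurableU.
exact: measureU.
Qed.

Lemma pr_setID A B : measurable A -> measurable B -> pr (A `&` B) + pr (A `&` ~` B) = pr A.
Proof.
move=> mA mB; rewrite -prU; last 3 first.
- exact: measurableI.
- by apply: measurableI => //; apply: measurableC.
- by rewrite setIACA setICr !setI0.
by rewrite -setIUr setUCr setIT.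
Qed.

Lemma pr_bigsetU_le (J : Type) (s : seq J) (F : J -> set Omega) :
  (forall j, measurable (F j)) ->
  pr (\big[setU/set0]_(j <- s) F j) <= \sum_(j <- s) pr (F j).
Proof.
move=> mF; elim: s => [|j s IH]; first by rewrite !big_nil pr_set0.
rewrite !big_cons; apply: le_trans (prU_le _ _) _ => //.
  exact: bigsetU_measurable.
by rewrite lerD2l.
Qed.

Lemma mem_bigsetU (J : eqType) (s : seq J) (F : J -> set Omega) j om :
  j \in s -> F j om -> (\big[setU/set0]_(j <- s) F j) om.
Proof.
elim: s => // a s IH; rewrite in_cons big_cons => /orP [/eqP <-|js] Fj; first by left.
by right; apply: IH.
Qed.

Lemma pr_finType (C : finType) (X : Omega -> C) (w : C -> R) (D : pred C) :
  (forall c, measurable [set om | X om = c]) -> (forall c, pr [set om | X om = c] = w c) ->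
  measurable [set om | D (X om)] /\ pr [set om | D (X om)] = Pr w D.
Proof.
move=> mX wX.
suff H (s : seq C) : uniq s -> measurable [set om | X om \in s] /\
    pr [set om | X om \in s] = \sum_(c <- s) w c.
  have [m1 m2] := H (enum D) (enum_uniq _).
  have -> : [set om | D (X om)] = [set om | X om \in enum D].
    by apply/seteqP; split=> om /=; rewrite mem_enum.
  split=> //; rewrite m2 /Pr /Ex big_enum /= big_mkcond; apply: eq_bigr => c _.
  by rewrite /in_mem /=; case: (D c); rewrite ?mulr1 ?mulr0.
elim: s => [_|c s IH /andP[cs us]].
  rewrite big_nil (_ : [set om | X om \in [::]] = set0); last by apply/seteqP; split.
  by rewrite pr_set0; split.
have [m1 m2] := IH us.
have -> : [set om | X om \in c :: s] = [set om | X om = c] `|` [set om | X om \in s].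
  apply/seteqP; split=> om /=; rewrite in_cons.
    by case/orP=> [/eqP|]; [left|right].
  by case=> [->|->]; rewrite ?eqxx ?orbT.
split; first exact: measurableU.
rewrite prU // ?wX ?m2 ?big_cons //.
by apply/seteqP; split=> om //= [-> cs']; rewrite cs' in cs.
Qed.

(** Nothing is assumed on the measurability of [E]: it lies in the lower limit of the [U n], whose
    probability is at most [eta] by continuity from below. *)
Lemma liminf_negligible (E : set Omega) :
  (forall eta : R, 0 < eta -> exists U : nat -> set Omega, [/\ forall n, measurable (U n),
     forall om, E om -> exists n0, forall n, (n0 <= n)%N -> U n om &
     exists n1, forall n, (n1 <= n)%N -> pr (U n) <= eta]) ->
  P.-negligible E.
Proof.
move=> H.
have HV eta : 0 < eta -> exists V, [/\ measurable V, E `<=` V & pr V <= eta].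
  move=> /H [U [mU EU [n1 hn1]]].
  pose F n0 := \bigcap_(n in [set n | (n0 <= n)%N]) U n.
  have mF n0 : measurable (F n0) by apply: bigcap_measurable => //; exists n0 => /=.
  have mV : measurable (\bigcup_n F n) by apply: bigcup_measurable.
  exists (\bigcup_n F n); split=> //.
    by move=> om /EU [n0 h]; exists n0 => // n /= /h.
  rewrite -lee_fin -prE //.
  have hF : {homo F : n m / (n <= m)%N >-> (n <= m)%O}.
    move=> n m nm; apply/subsetPset => om h k /= mk; apply: h => /=; exact: leq_trans mk.
  have cv := nondecreasing_cvg_mu (mu := P) mF mV hF.
  rewrite -(cvg_lim _ cv) //; apply: lime_le; first by apply/cvg_ex; eexists; exact: cv.
  apply: nearW => n /=; rewrite prE // lee_fin; apply: le_trans (hn1 (maxn n n1) (leq_maxr _ _)).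
  by apply: le_pr => // om h; apply: h => /=; apply: leq_maxl.
have e0 k : 0 < k.+1%:R^-1 :> R by rewrite invr_gt0 ltr0n.
pose V k := projT1 (cid (HV _ (e0 k))).
have VP k : [/\ measurable (V k), E `<=` V k & pr (V k) <= k.+1%:R^-1].
  by rewrite /V; case: cid.
exists (\bigcap_k V k); split.
- by apply: bigcapT_measurable => k; case: (VP k).
- rewrite prE; last by apply: bigcapT_measurable => k; case: (VP k).
  congr EFin; apply/eqP; rewrite eq_le pr_ge0 andbT leNgt; apply/negP => lt.
  set a := pr _ in lt; have := truncnS_gt a^-1; set k := Num.truncn _ => hk.
  have [mk _ hV] := VP k.
  have : a <= k.+1%:R^-1.
    apply: le_trans hV; apply: le_pr => //; last exact: bigcap_inf.
    by apply: bigcapT_measurable => j; case: (VP j).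
  by rewrite leNgt -[a]invrK ltf_pV2 ?posrE ?invr_gt0 // hk.
- by move=> om Eom k _; have [_ h _] := VP k; apply: h.
Qed.

End RealProb.

(** * Independence of the bits *)

Section Law.
Context {R : realType} (d0 : nat) {dO : measure_display} {Omega : measurableType dO}.
Variables (P : probability Omega R) (N : tvert d0 -> Omega -> R -> nat) (T : R).
Hypothesis H : poisson_clocks P N.
Hypothesis T0 : 0 < T.
Variable M : nat.
Hypothesis M0 : (0 < M)%N.
Let h := T / M%:R.
Let h0 : 0 < h. Proof. by rewrite divr_gt0 // ltr0n. Qed.
Let p := pbar h.
Local Notation tm := (tm T M).
Local Notation barE e i := [set om | bar N om T M e i].
Implicit Types (e : tvert d0).

Lemma Nmeas e t : measurable_fun setT (fun om => (N e om t)%:R : R).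
Proof. by case: H => _ [_ [_ [Hm _]]]. Qed.

Lemma Nmono_om om e s t : 0 <= s -> s <= t -> (N e om s <= N e om t)%N.
Proof. by case: H => _ [Hm _]; apply: Hm. Qed.

Lemma tmS i : tm i.+1 - tm i = h.
Proof. by rewrite /tm -natr1 mulrDl mul1r addrAC subrr add0r. Qed.

Lemma measurable_cmp e e' s t (k : nat) : measurable [set om | (N e om s + k < N e' om t)%N].
Proof.
have -> : [set om | (N e om s + k < N e' om t)%N] =
   [set om | (N e om s)%:R + k%:R < (N e' om t)%:R :> R].
  by apply/seteqP; split=> om /=; rewrite -natrD ltr_nat.
have mf : measurable_fun setT (fun om => (N e om s)%:R + k%:R < (N e' om t)%:R :> R).
  apply: measurable_realfun.measurable_fun_ltr; last exact: Nmeas.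
  by apply: measurable_realfun.measurable_funD => //; exact: Nmeas.
have := mf measurableT [set true] I; rewrite setTI.
by congr measurable; apply/seteqP; split=> om /=.
Qed.

Lemma measurable_bar e i : measurable (barE e i).
Proof.
by have := measurable_cmp e e (tm i) (tm i.+1) 0; congr measurable;
  apply/seteqP; split=> om /=; rewrite addn0.
Qed.

Definition ev (l : seq (tvert d0 * nat * bool)) : set Omega :=
  [set om | all (fun t => bar N om T M t.1.1 t.1.2 == t.2) l].

Lemma ev_cons t l : ev (t :: l) = [set om | bar N om T M t.1.1 t.1.2 = t.2] `&` ev l.
Proof.
apply/seteqP; split=> om; first by move=> /= /andP[/eqP e a]; split.
by move=> [/= e a]; apply/andP; split=> //; apply/eqP.
Qed.

Lemma measurable_bit e i b : measurable [set om | bar N om T M e i = b].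
Proof.
case: b; first exact: measurable_bar.
have := measurableC (measurable_bar e i); congr measurable.
by apply/seteqP; split=> om /= => [/negP/negbTE|->].
Qed.

Lemma measurable_ev l : measurable (ev l).
Proof.
elim: l => [|t l IH]; first by rewrite (_ : ev [::] = setT) //; apply/seteqP; split.
rewrite ev_cons; apply: measurableI => //; exact: measurable_bit.
Qed.

Lemma law_zero (Z : seq (tvert d0 * nat)) : uniq (Z : seq (seq _ * nat)) ->
  (forall z, z \in (Z : seq (seq _ * nat)) -> z.1 != [::]) ->
  pr P (ev [seq (z, false) | z <- Z]) = (1 - p) ^+ size Z.
Proof.
move=> uZ nZ; case: H => _ [_ [_ [_ Hf]]].
pose f (z : tvert d0 * nat) : tvert d0 * R * R * nat := (z.1, tm z.2, tm z.2.+1, 0%N).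
have := Hf (map f Z); rewrite size_map.
have nthf k : (k < size Z)%N ->
  nth ([::], 0, 0, 0%N) (map f Z) k = f (nth ([::], 0%N) Z k).
  by move=> kZ; rewrite (nth_map ([::] : tvert d0, 0%N)).
move=> HH; apply: EFin_inj; rewrite -prE; last exact: measurable_ev.
have -> : ((1 - p) ^+ size Z)%:E =
   (\prod_(q <- map f Z) (poisson_pmf (q.1.2 - q.1.1.2) q.2)%:E)%E.
  rewrite big_map /= prodEFin; congr EFin.
  rewrite (eq_bigr (fun=> 1 - p)); last first.
    move=> z _; rewrite /= tmS /poisson_pmf h0 expr0 fact0 divr1 mul1r /p /pbar; ring.
  by rewrite big_const_seq count_predT iter_mulr_1.
rewrite -HH.
- congr (P _); apply/seteqP; split=> om /=.
    move=> /allP ha k kZ; rewrite nthf //=.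
    have /ha : (nth ([::], 0%N) Z k, false) \in ([seq (z, false) | z <- Z] : seq (seq _ * nat * bool)).
      by apply: (map_f (fun z => (z, false))); apply: mem_nth.
    rewrite /= eqbF_neg /bar -leqNgt => hle; by apply/eqP; rewrite subn_eq0.
  move=> hk; apply/allP => t /mapP [z zZ ->] /=; rewrite eqbF_neg /bar -leqNgt.
  have iz : (index z (Z : seq (seq _ * nat)) < size Z)%N by rewrite index_mem.
  by have := hk _ iz; rewrite nthf // nth_index //= => /eqP; rewrite subn_eq0.
- move=> k kZ; rewrite nthf //=; split; first by apply: nZ; apply: mem_nth.
  by split; [apply: tm_ge0|apply: tm_ltS].
- move=> k l kZ lZ kl; rewrite !nthf //= => e12.
  have : (nth ([::], 0%N) Z k).2 != (nth ([::], 0%N) Z l).2.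
    apply/negP => /eqP e2; apply: kl; apply/eqP.
    rewrite -(nth_uniq ([::] : seq _, 0%N) kZ lZ uZ); apply/eqP.
    by move: e12 e2; case: (nth _ _ _) => ? ?; case: (nth _ _ _) => ? ? /= -> ->.
  rewrite neq_ltn => /orP [lt|lt]; [left|right]; exact: tm_le.
Qed.

(** A present bar is not a single value of the Poisson increment, so it is handled as the complement
    of an absent one; carrying the list [Z] of absent bars makes the induction work. *)
Lemma law_bits l : uniq ([seq t.1 | t <- l] : seq (seq _ * nat)) ->
  (forall t, t \in (l : seq (seq _ * nat * bool)) -> t.1.1 != [::]) ->
  pr P (ev l) = \prod_(t <- l) bw p t.2.
Proof.
suff gen Z : uniq (Z ++ [seq t.1 | t <- l] : seq (seq _ * nat)) ->
   (forall z, z \in (Z : seq (seq _ * nat)) -> z.1 != [::]) ->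
   (forall t, t \in (l : seq (seq _ * nat * bool)) -> t.1.1 != [::]) ->
   pr P (ev ([seq (z, false) | z <- Z] ++ l)) = (1 - p) ^+ size Z * \prod_(t <- l) bw p t.2.
  by move=> u1 n1; have := gen [::] u1 (fun _ h => ltac:(by [])) n1; rewrite /= mul1r.
elim: l Z => [|[z b] l IH] Z uZ nZ nl.
  rewrite cats0 big_nil mulr1; apply: law_zero => //.
  by move: uZ; rewrite cats0.
have nl' t : t \in (l : seq (seq _ * nat * bool)) -> t.1.1 != [::].
  by move=> tl; apply: nl; rewrite in_cons tl orbT.
have zn : z.1 != [::] by apply: (nl (z, b)); rewrite mem_head.
have F0 : pr P (ev ([seq (z, false) | z <- Z] ++ (z, false) :: l)) =
    (1 - p) ^+ size Z * ((1 - p) * \prod_(t <- l) bw p t.2).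
  have := IH (rcons Z z); rewrite map_rcons !cat_rcons size_rcons exprSr -mulrA; apply=> //.
  by move=> z'; rewrite mem_rcons in_cons => /orP [/eqP ->|/nZ].
case: b uZ nl => uZ nl; last by rewrite F0 big_cons.
rewrite big_cons /=.
set l0 := [seq (z, false) | z <- Z] in F0 *.
have FA : pr P (ev (l0 ++ l)) = (1 - p) ^+ size Z * \prod_(t <- l) bw p t.2.
  apply: IH => //; move: uZ; rewrite !cat_uniq /= => /and3P[-> nh /andP[_ ->]].
  rewrite andbT; apply: contra nh => /= ->; by rewrite orbT.
have evI b : ev (l0 ++ (z, b) :: l) = ev (l0 ++ l) `&` [set om | bar N om T M z.1 z.2 = b].
  apply/seteqP; split=> om; rewrite /ev /= !all_cat /=.
    by move=> /and3P[-> /eqP -> ->].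
  by move=> [/andP[-> ->] ->]; rewrite eqxx.
have := pr_setID P (measurable_ev (l0 ++ l)) (measurable_bar z.1 z.2).
rewrite FA -(evI true) .
have -> : ev (l0 ++ l) `&` ~` barE z.1 z.2 = ev (l0 ++ (z, false) :: l).
  rewrite evI; congr (_ `&` _); apply/seteqP; split=> om /= => [/negP/negbTE|->] //.
rewrite F0 => e; move: e; set X := (1 - p) ^+ _; set Y := \prod_(_ <- _) _ => e.
have -> : X * (p * Y) = X * Y - X * ((1 - p) * Y) by ring.
by rewrite -e addrK.
Qed.

End Law.

Lemma uniq_flatten_map (J A : eqType) (s : seq J) (f : J -> seq A) : uniq s ->
  (forall j, uniq (f j)) ->
  (forall j j' a, a \in f j -> a \in f j' -> j = j') -> uniq (flatten (map f s)).
Proof.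
move=> us uf df; elim: s us => //= j s IH /andP[js /IH {}IH].
rewrite cat_uniq uf IH andbT /=; apply/hasPn => a /flattenP [_ /mapP [j' j's ->] aj'].
by apply: contra js => aj; rewrite (df j j' a aj aj').
Qed.

Lemma suffix_eq (A : eqType) (v v' e : seq A) : suffix v e -> suffix v' e ->
  size v = size v' -> v = v'.
Proof. by move=> sv sv' ss; move: sv sv'; rewrite !suffixE ss => /eqP e1 /eqP e2; exact: etrans (esym e1) e2. Qed.

(** * Independent subtrees, collisions and chains *)

Section Family.
Context {R : realType} (d0 : nat) {dO : measure_display} {Omega : measurableType dO}.
Variables (P : probability Omega R) (N : tvert d0 -> Omega -> R -> nat) (T : R).
Hypothesis H : poisson_clocks P N.
Hypothesis T0 : 0 < T.
Variable M : nat.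
Hypothesis M0 : (0 < M)%N.
Let h := T / M%:R.
Let p := pbar h.
Let h0 : 0 < h. Proof. by rewrite divr_gt0 // ltr0n. Qed.
Local Notation tm := (tm T M).
Local Notation barE e i := [set om | bar N om T M e i].
Local Notation conf := (conf M d0.-1).
Implicit Types (e u : tvert d0).

Definition epairs u (b : bits M) : seq (tvert d0 * nat * bool) :=
  [seq (u, val i, b i) | i <- enum 'I_M].

Fixpoint cpairs m u : conf m -> seq (tvert d0 * nat * bool) :=
  match m with
  | 0 => fun=> [::]
  | m'.+1 => fun c : conf m'.+1 =>
      flatten [seq epairs (j :: u) (c j).1 ++ cpairs (j :: u) (c j).2 | j <- enum 'I_d0.-1]
  end.

Definition xpairs m u (v : bits M * conf m) := epairs u v.1 ++ cpairs u v.2.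

Lemma ev_epairs u b om : ev N T M (epairs u b) om <-> bitsOf N om T M u = b.
Proof.
rewrite /ev /= all_map; split.
  move=> /allP /= ha; apply/ffunP => i; rewrite ffunE.
  by have := ha i; rewrite mem_enum => /(_ isT) /eqP.
by move=> <-; apply/allP => i _ /=; rewrite ffunE.
Qed.

Lemma ev_cat l1 l2 om : ev N T M (l1 ++ l2) om <-> ev N T M l1 om /\ ev N T M l2 om.
Proof. by rewrite /ev /= all_cat; split=> [/andP|[-> ->]]. Qed.

Lemma ev_flatten (J : eqType) (s : seq J) (f : J -> seq (tvert d0 * nat * bool)) om :
  ev N T M (flatten (map f s)) om <-> forall j, j \in s -> ev N T M (f j) om.
Proof.
elim: s => [|j s IH] /=; first by split.
rewrite ev_cat IH; split=> [[h1 h2] j'|hj].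
  by rewrite in_cons => /orP [/eqP ->|/h2].
by split=> [|j' j's]; apply: hj; rewrite in_cons ?eqxx // j's orbT.
Qed.

Lemma ev_cpairs m u (c : conf m) om : ev N T M (cpairs u c) om <-> confOf N om T M m u = c.
Proof.
elim: m u c => [|m IH] u c /=; first by split=> // _; case: c.
rewrite ev_flatten; split=> [hj|<- j _].
  apply/ffunP => j; rewrite ffunE; have := hj j; rewrite mem_enum => /(_ isT).
  by rewrite ev_cat ev_epairs IH => -[-> ->]; case: (c j).
by rewrite ffunE ev_cat ev_epairs IH.
Qed.

Lemma ev_xpairs m u (v : bits M * conf m) om :
  ev N T M (xpairs u v) om <-> xconfOf N om T M m u = v.
Proof.
rewrite /xpairs ev_cat ev_epairs ev_cpairs /xconfOf; split=> [[-> ->]|<- //].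
by case: v.
Qed.

Lemma prod_epairs u b : \prod_(t <- epairs u b) bw p t.2 = bitsw p b.
Proof. by rewrite /epairs big_map /= big_enum. Qed.

Lemma prod_cpairs m u (c : conf m) : \prod_(t <- cpairs u c) bw p t.2 = wt p c.
Proof.
elim: m u c => [|m IH] u c /=; first by rewrite big_nil.
rewrite big_flatten /= big_map big_enum /=; apply: eq_bigr => j _.
by rewrite big_cat prod_epairs IH.
Qed.

Lemma prod_xpairs m u (v : bits M * conf m) :
  \prod_(t <- xpairs u v) bw p t.2 = xw p v.
Proof. by rewrite big_cat prod_epairs prod_cpairs. Qed.

Lemma epairs_edge u b t : t \in (epairs u b : seq (seq _ * nat * bool)) -> t.1.1 = u.
Proof. by case/mapP=> i _ ->. Qed.

Lemma cpairs_edge m u (c : conf m) t : t \in (cpairs u c : seq (seq _ * nat * bool)) ->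
  suffix u t.1.1 /\ (size u < size t.1.1)%N.
Proof.
elim: m u c => [|m IH] u c //= /flattenP [l /mapP [j _ ->]]; rewrite mem_cat => /orP [].
  move=> /epairs_edge ->; split=> //.
  by apply/suffixP; exists [:: j]; rewrite cat_cons.
move=> /IH [s1 s2]; split; first exact: suffixW s1.
exact: ltn_trans s2.
Qed.

Lemma xpairs_edge m u (v : bits M * conf m) t :
  t \in (xpairs u v : seq (seq _ * nat * bool)) -> suffix u t.1.1.
Proof.
rewrite mem_cat => /orP [/epairs_edge ->|/cpairs_edge []//]; exact: suffix_refl.
Qed.

Local Notation keys l := ([seq t.1 | t <- l] : seq (seq 'I_d0.-1 * nat)).

Lemma uniq_epairs u b : uniq (keys (epairs u b)).
Proof.
rewrite /epairs -map_comp map_inj_in_uniq ?enum_uniq // => i j _ _ [].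
exact: val_inj.
Qed.

Lemma uniq_xpairs_of m u (v : bits M * conf m) :
  uniq (keys (cpairs u v.2)) -> uniq (keys (xpairs u v)).
Proof.
move=> uc; rewrite /xpairs map_cat cat_uniq uniq_epairs uc andbT /=.
apply/hasPn => k /mapP [t /cpairs_edge [_ ts] ->]; apply/negP => /mapP [t' /epairs_edge e1 e2].
by move: ts; rewrite e2 e1 ltnn.
Qed.

Lemma uniq_cpairs m u (c : conf m) : uniq (keys (cpairs u c)).
Proof.
elim: m u c => [|m IH] u c //=.
rewrite map_flatten -map_comp; apply: uniq_flatten_map.
- exact: enum_uniq.
- by move=> j /=; apply: (uniq_xpairs_of (v := c j)); apply: IH.
- move=> j j' a /mapP [t /(xpairs_edge (v := c j)) e1 ->].
  move=> /mapP [t' /(xpairs_edge (v := c j')) e2 e3].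
  rewrite e3 in e1; by case: (suffix_eq e1 e2 erefl).
Qed.

Lemma uniq_xpairs m u (v : bits M * conf m) : uniq (keys (xpairs u v)).
Proof. exact/uniq_xpairs_of/uniq_cpairs. Qed.

(** An edge shared by two vertices would have both as suffixes of equal length, so distinct vertices
    use disjoint sets of bits. *)
Lemma law_family (I : finType) (v : I -> tvert d0) (L m : nat) :
  injective v -> (forall i, size (v i) = L.+1) ->
  forall c : {ffun I -> (bits M * conf m)%type},
  measurable [set om | [ffun i => xconfOf N om T M m (v i)] = c] /\
  pr P [set om | [ffun i => xconfOf N om T M m (v i)] = c] = prodw (xw p (d := _) (n := m)) c.
Proof.
move=> vi vs c; pose l := flatten [seq xpairs (v i) (c i) | i <- enum I].
have -> : [set om | [ffun i => xconfOf N om T M m (v i)] = c] = ev N T M l.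
  apply/seteqP; split=> om; rewrite /l.
    by move=> /= <-; apply/ev_flatten => i _; rewrite ffunE; apply/ev_xpairs.
  move/ev_flatten => hi; apply/ffunP => i; rewrite ffunE; apply/ev_xpairs; apply: hi.
  by rewrite mem_enum.
split; first exact: (measurable_ev T H).
rewrite (law_bits H T0 M0).
- by rewrite /l big_flatten /= big_map big_enum /=; apply: eq_bigr => i _; apply: prod_xpairs.
- rewrite /l map_flatten -map_comp; apply: uniq_flatten_map.
  + exact: enum_uniq.
  + by move=> i; apply: uniq_xpairs.
  + move=> i i' a /mapP [t /xpairs_edge e1 ->] /mapP [t' /xpairs_edge e2 e3].
    rewrite e3 in e1; apply: vi; apply: (suffix_eq e1 e2); by rewrite !vs.
- move=> t /flattenP [l' /mapP [i _ ->]] /xpairs_edge st; apply: contraTneq st => ->.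
  by rewrite suffixs0; apply/eqP => e; have := vs i; rewrite e.
Qed.

Fixpoint words k : seq (seq 'I_d0.-1) :=
  if k is k'.+1 then [seq j :: w | j <- enum 'I_d0.-1, w <- words k'] else [:: [::]].

Lemma mem_words w : w \in words (size w).
Proof.
elim: w => //= j w IH; apply/allpairsP; exists (j, w); split=> //=; by rewrite mem_enum.
Qed.

Definition edges n : seq (seq 'I_d0.-1) := flatten [seq words k.+1 | k <- iota 0 n].

Lemma words_size k w : w \in words k -> size w = k.
Proof.
elim: k w => [|k IH] w /=; first by rewrite inE => /eqP ->.
by case/allpairsP => -[j w'] /= [_ /IH <- ->].
Qed.

Lemma mem_edges n e : (0 < size e <= n)%N -> e \in edges n.
Proof.
move=> /andP[e0 en]; apply/flattenP; exists (words (size e)); last exact: mem_words.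
by apply/mapP; exists (size e).-1; rewrite ?mem_iota ?prednK.
Qed.

Lemma edges_neq0 n e : e \in edges n -> e != [::].
Proof.
by case/flattenP => l /mapP [k _ ->] /words_size; case: e.
Qed.

Lemma pr_bars (Z : seq (tvert d0 * nat)) : uniq (Z : seq (seq _ * nat)) ->
  (forall z, z \in (Z : seq (seq _ * nat)) -> z.1 != [::]) ->
  pr P (ev N T M [seq (z, true) | z <- Z]) = p ^+ size Z.
Proof.
move=> uZ nZ; rewrite (law_bits H T0 M0).
- by rewrite big_map /= big_const_seq count_predT iter_mulr_1.
- by rewrite -map_comp map_id.
- by move=> t /mapP [z zZ ->]; apply: nZ.
Qed.

Lemma pr_bar e i : e != [::] -> pr P (barE e i) = p.
Proof.
move=> e0; have := @pr_bars [:: (e, i)] isT.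
rewrite expr1 => <-; last by move=> z; rewrite inE => /eqP ->.
by congr pr; apply/seteqP; split=> om; rewrite /ev /= andbT eqb_id.
Qed.

Lemma pr_bar2 e e' i : e != [::] -> e' != [::] -> e != e' ->
  pr P (barE e i `&` barE e' i) = p ^+ 2.
Proof.
move=> e0 e0' ee'; have := @pr_bars [:: (e, i); (e', i)].
rewrite /= inE andbT xpair_eqE negb_and ee' /= => <- //; last first.
  by move=> z; rewrite !inE => /orP [] /eqP ->.
by congr pr; apply/seteqP; split=> om; rewrite /ev /= andbT !eqb_id => /andP.
Qed.

Lemma pr_double e i : e != [::] -> pr P [set om | (N e om (tm i) + 1 < N e om (tm i.+1))%N] <= h ^+ 2.
Proof.
move=> e0; set A2 := [set om | _].
have mA2 : measurable A2 by apply: (measurable_cmp H).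
have mb := measurable_bar T H M e i.
have tlt := ltW (tm_ltS T0 M0 i); have t0 := tm_ge0 T0 M0 i.
have e1 : pr P (barE e i `&` ~` A2) = h * expR (- h).
  case: (H) => _ [_ [_ [_ Hf]]].
  have := Hf [:: (e, tm i, tm i.+1, 1%N)].
  rewrite big_seq1 /= tmS /poisson_pmf h0 expr1 divr1 => Hf'.
  apply: EFin_inj; rewrite -prE; last by apply: measurableI => //; apply: measurableC.
  rewrite -Hf'.
  - congr (P _); apply/seteqP; split=> om /=.
      move=> [bb nA] [|//] _ /=; apply/eqP; rewrite eqn_leq; apply/andP; split.
        by rewrite leq_subLR leqNgt; apply/negP.
      by rewrite subn_gt0; exact: bb.
    move=> /(_ 0%N isT) /= e1; split; first by rewrite /bar -subn_gt0 e1.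
    by apply/negP; rewrite -leqNgt -leq_subLR e1.
  - by case=> //= _; split=> //; split=> //; apply: tm_ltS.
  - by case=> [|//] [].
have e2 := pr_setID P mb mA2.
have A2b : barE e i `&` A2 = A2.
  apply/seteqP; split=> om; first by case.
  move=> hA; split=> //=; rewrite /bar; apply: leq_ltn_trans hA; exact: leq_addr.
rewrite A2b e1 pr_bar // in e2.
have -> : pr P A2 = p - h * expR (- h) by rewrite -e2 addrK.
rewrite /p /pbar; have := expR_ge1Dx (- h); have := h0.
(* [1 - (1 + h) e^(-h) <= 1 - (1 + h) (1 - h) = h^2]. *)
move=> hp he; have : (1 + h) * (1 - h) <= (1 + h) * expR (- h) by apply: ler_wpM2l => //; lra.
rewrite expr2; lra.
Qed.

Definition usep n : set Omega :=
  (\big[setU/set0]_(ei <- [seq (e, i) | e <- edges n, i <- iota 0 M])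
     [set om | (N ei.1 om (tm ei.2) + 1 < N ei.1 om (tm ei.2.+1))%N]) `|`
  (\big[setU/set0]_(ei <- [seq (ee, i) | ee <- [seq (e, e') | e <- edges n, e' <- edges n], i <- iota 0 M])
     if ei.1.1 == ei.1.2 then set0 else barE ei.1.1 ei.2 `&` barE ei.1.2 ei.2).

Lemma measurable_usep n : measurable (usep n).
Proof.
apply: measurableU; apply: bigsetU_measurable => -[e i] _; first exact: (measurable_cmp H).
by case: ifP => // _; apply: measurableI; apply: (measurable_bar T H).
Qed.

Lemma usepP n om : ~ sep N om T M n -> usep n om.
Proof.
move=> ns; apply: contrapT => nu; apply: ns; split=> [e i en iM|e e' i en e'n iM b b'].
  rewrite leqNgt; apply/negP => lt; apply: nu; left.
  apply: (mem_bigsetU (j := (e : seq 'I_d0.-1, i))); last by rewrite /= addn1.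
  apply/allpairsP; exists (e, i); split=> //=; first exact: mem_edges.
  by rewrite mem_iota.
apply/eqP/negPn/negP => ee'; apply: nu; right.
apply: (mem_bigsetU (j := (e : seq 'I_d0.-1, e' : seq 'I_d0.-1, i))); last by rewrite /= (negbTE ee').
apply/allpairsP; exists ((e, e'), i); split=> //=; last by rewrite mem_iota.
by apply/allpairsP; exists (e, e'); split=> //=; apply: mem_edges.
Qed.

(** Each of the [M] cells contributes order [h^2], in all order [1 / M]; the constant grows with
    [n], so the mesh must depend on [n]. *)
Lemma pr_usep n : pr P (usep n) <= ((size (edges n)) + (size (edges n)) ^ 2)%:R * T ^+ 2 / M%:R.
Proof.
have hp : p <= h by apply: pbar_le.
have /andP[p0 _] := pbar01 (ltW h0).
have MR : 0 < M%:R :> R by rewrite ltr0n.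
have -> : ((size (edges n)) + (size (edges n)) ^ 2)%:R * T ^+ 2 / M%:R =
   (size (edges n) * M)%:R * h ^+ 2 + (size (edges n) * size (edges n) * M)%:R * h ^+ 2 :> R.
  by rewrite /h natrD natrX !natrM; field; rewrite gt_eqF.
apply: le_trans (prU_le _ _ _) _.
- by apply: bigsetU_measurable => -[e i] _; exact: (measurable_cmp H).
- apply: bigsetU_measurable => -[e i] _.
  by case: ifP => // _; apply: measurableI; apply: (measurable_bar T H).
have sumc (J : eqType) (s : seq J) (F : J -> R) : (forall j, j \in s -> F j <= h ^+ 2) ->
   \sum_(j <- s) F j <= (size s)%:R * h ^+ 2.
  move=> hF; rewrite big_seq; apply: (@le_trans _ _ (\sum_(j <- s | j \in s) h ^+ 2)).
    exact: ler_sum.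
  by rewrite -big_seq big_const_seq count_predT iter_addr_0 mulr_natl.
apply: lerD.
  apply: le_trans (pr_bigsetU_le _ _ _) _; first by move=> -[e i]; exact: (measurable_cmp H).
  apply: le_trans (sumc _ _ _ _) _; last by rewrite size_allpairs size_iota.
  move=> [e i] /allpairsP [[e1 i1] /= [he hi [-> ->]]] /=; apply: pr_double; exact: edges_neq0 he.
apply: le_trans (pr_bigsetU_le _ _ _) _.
  by move=> -[e i]; case: ifP => // _; apply: measurableI; apply: (measurable_bar T H).
apply: le_trans (sumc _ _ _ _) _; last by rewrite !size_allpairs size_iota.
move=> [e i] /allpairsP [[e1 i1] /= [/allpairsP [[a b] /= [ha hb ->]] hi [-> ->]]] /=.
case: eqVneq => [_|ab]; first by rewrite pr_set0 sqr_ge0.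
rewrite pr_bar2 //; [|exact: edges_neq0 ha|exact: edges_neq0 hb].
by apply: lerXn2r => //; rewrite nnegrE // ltW.
Qed.

(** The filter removes [behead u] at the root, where it is [u] itself. *)
Definition nbrs u : seq (tvert d0) :=
  [seq w <- behead u :: [seq j :: u | j <- enum 'I_d0.-1] | tadj u w].

Lemma mem_nbrs u w : tadj u w -> w \in (nbrs u : seq (seq _)).
Proof.
move=> uw; rewrite mem_filter uw /=; case/tadjP: uw => -[j [e _]].
  by rewrite in_cons e (map_f (fun j => j :: u)) ?orbT // mem_enum.
by rewrite in_cons e eqxx.
Qed.

Fixpoint uchain (s : seq nat) (k : nat) u : set Omega :=
  match k, s with
  | 0, _ => setT
  | _.+1, [::] => set0
  | k'.+1, i :: s' => uchain s' k u `|`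
      \big[setU/set0]_(w <- nbrs u) (barE (tedge_of u w) i `&` uchain s' k' w)
  end.

Lemma measurable_uchain s k u : measurable (uchain s k u).
Proof.
elim: s k u => [|i s IH] [|k] u //=; apply: measurableU; first exact: IH.
by apply: bigsetU_measurable => w _; apply: measurableI => //; apply: (measurable_bar T H).
Qed.

Lemma chain_uchain s k u om : chain N om T M s k u -> uchain s k u om.
Proof.
elim: s k u => [|i s IH] [|k] u //= [/IH|[w [uw b /IH c]]]; first by left.
right; apply: (mem_bigsetU (j := (w : seq 'I_d0.-1))); last by split.
exact: mem_nbrs.
Qed.

Let p01 : 0 <= p <= 1. Proof. by apply: pbar01; apply: ltW. Qed.

(** [Z] collects the bars already used; their cells lie outside [s], so all bits involved are
    distinct. Pascal's rule reflects the choice between skipping cell [i] and jumping in it. *)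
Lemma pr_uchain_gen s k u (Z : seq (tvert d0 * nat)) : uniq s -> uniq (Z : seq (seq _ * nat)) ->
  (forall z, z \in (Z : seq (seq _ * nat)) -> z.1 != [::] /\ z.2 \notin s) ->
  pr P (ev N T M [seq (z, true) | z <- Z] `&` uchain s k u) <=
  p ^+ size Z * ('C(size s, k)%:R * (d0.-1.+1%:R * p) ^+ k).
Proof.
have /andP[p0 p1] := p01.
have x0 : 0 <= d0.-1.+1%:R * p by apply: mulr_ge0.
elim: s k u Z => [|i s IH] k u Z us uZ nZ.
  case: k => [|k] /=; last by rewrite setI0 pr_set0 bin0n mul0r mulr0.
  by rewrite setIT bin0 expr0 !mulr1 pr_bars // => z /nZ [].
case: k => [|k].
  by rewrite /= setIT bin0 expr0 !mulr1 pr_bars // => z /nZ [].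
move: us => /= /andP[si us].
have nZ' z : z \in (Z : seq (seq _ * nat)) -> z.1 != [::] /\ z.2 \notin s.
  by move=> /nZ [-> ]; rewrite in_cons negb_or => /andP[_ ->].
rewrite setIUr; apply: le_trans (prU_le _ _ _) _.
- by apply: measurableI; [apply: (measurable_ev T H)|apply: measurable_uchain].
- apply: measurableI; first exact: (measurable_ev T H).
  apply: bigsetU_measurable => w _; apply: measurableI; first exact: (measurable_bar T H).
  exact: measurable_uchain.
rewrite binS natrD mulrDl mulrDr; apply: lerD; first exact: IH.
rewrite big_distrr /=.
apply: le_trans (pr_bigsetU_le _ _ _) _.
  move=> w; apply: measurableI; first exact: (measurable_ev T H).
  by apply: measurableI; [apply: (measurable_bar T H)|apply: measurable_uchain].
set b := p ^+ (size Z).+1 * ('C(size s, k)%:R * (d0.-1.+1%:R * p) ^+ k).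
have b0 : 0 <= b by rewrite mulr_ge0 ?exprn_ge0 // mulr_ge0 // exprn_ge0.
apply: (@le_trans _ _ (\sum_(w <- nbrs u) b)).
  rewrite /nbrs !big_filter big_seq_cond [leRHS]big_seq_cond; apply: ler_sum => w /andP[_ uw].
  have e0 : tedge_of u w != [::].
    by have /andP[] := tincident_edge uw.
  have hI : pr P (ev N T M [seq (z, true) | z <- (tedge_of u w, i) :: Z] `&` uchain s k w) <= b.
    apply: (IH k w ((tedge_of u w, i) :: Z) us).
      by rewrite /= uZ andbT; apply/negP => /nZ []; rewrite mem_head.
    by move=> z; rewrite in_cons => /orP [/eqP ->|/nZ'].
  apply: le_trans hI; apply: le_pr.
  - apply: measurableI; first exact: (measurable_ev T H).
    by apply: measurableI; [apply: (measurable_bar T H)|apply: measurable_uchain].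
  - by apply: measurableI; [apply: (measurable_ev T H)|apply: measurable_uchain].
  - by move=> om [h1 [h2 h3]]; split=> //; rewrite /ev /= eqb_id; apply/andP; split.
rewrite big_const_seq count_predT iter_addr_0 -[leLHS]mulr_natl.
apply: (@le_trans _ _ (d0.-1.+1%:R * b)).
  apply: ler_wpM2r => //; rewrite ler_nat /nbrs; apply: leq_trans (size_subseq (filter_subseq _ _)) _.
  by rewrite /= size_map size_enum_ord.
rewrite /b !exprS le_eqVlt; apply/orP; left; apply/eqP; ring.
Qed.

Lemma ffact_le_exp n k : (n ^_ k <= n ^ k)%N.
Proof.
elim: k n => // k IH n; by rewrite ffactnSr expnSr; apply: leq_mul; [apply: IH|apply: leq_subr].
Qed.

(** ['C(M, k) (T / M)^k <= T^k / k!]: a bound independent of the mesh. *)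
Lemma pr_uchain s k u : uniq s -> size s = M ->
  pr P (uchain s k u) <= exp_coeff (d0.-1.+1%:R * T) k.
Proof.
move=> us sM; have := @pr_uchain_gen s k u [::] us isT.
rewrite /= expr0 mul1r (_ : ev N T M [::] = setT) ?setTI; last by apply/seteqP; split.
move=> /(_ (fun _ h => ltac:(by []))) /le_trans; apply.
have /andP[p0 p1] := p01; have hp : p <= h by apply: pbar_le.
have MR : 0 < M%:R :> R by rewrite ltr0n.
have kf : 0 < k`!%:R :> R by rewrite ltr0n fact_gt0.
rewrite /exp_coeff /= ler_pdivlMr // mulrAC -natrM bin_ffact sM.
apply: (@le_trans _ _ ((M ^ k)%:R * (d0.-1.+1%:R * h) ^+ k)).
  apply: ler_pM => //; first by rewrite exprn_ge0 // mulr_ge0.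
    by rewrite ler_nat ffact_le_exp.
  by apply: lerXn2r; rewrite ?nnegrE ?mulr_ge0 ?ler_wpM2l // ltW.
rewrite natrX -exprMn /h le_eqVlt; apply/orP; left; apply/eqP; congr (_ ^+ _).
by field; rewrite gt_eqF.
Qed.

End Family.

(** * Almost sure existence of an infinite cycle *)

Lemma Pr_pair (R : realFieldType) (X Y : finType) (u : X -> R) (v : Y -> R)
    (f : pred X) (g : pred Y) :
  Pr (pairw u v) (fun z => f z.1 && g z.2) = Pr u f * Pr v g.
Proof.
rewrite /Pr Ex_pair -ExZr; apply: eq_Ex => x; rewrite -ExZ; apply: eq_Ex => y /=.
by rewrite -natrM mulnb.
Qed.

(** The parent edge is silent with probability [expR (- T)], independently of the subtree; excluding
    child bars in the single cell [lst] costs at most half of [s0]. *)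
Lemma Pr_bad_conf (R : realType) (d0 M m : nat) (T s0 : R) (lst : 'I_M) :
  0 < T -> d0.-1%:R * (T / M%:R) <= s0 / 2 ->
  let p := pbar (T / M%:R) in
  s0 <= Pr (@wt R M p d0.-1 m.+1) (fun y => ~~ exits y (nobits M) lst) ->
  Pr (@xw R M p d0.-1 m.+1) (bad_conf (d0 := d0) lst) <= 1 - expR (- T) * (s0 / 2).
Proof.
move=> T0 dh p hs; set h := T / M%:R in dh p hs *.
have M0 : (0 < M)%N by apply: leq_ltn_trans (ltn_ord lst).
have h0 : 0 < h by rewrite divr_gt0 // ltr0n.
have p01 : 0 <= p <= 1 by apply: pbar01; apply: ltW.
have hx : isdist (@xw R M p d0.-1 m.+1) by apply: isdist_xw.
have hw : isdist (@wt R M p d0.-1 m.+1) by apply: isdist_wt.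
have hxm : isdist (@xw R M p d0.-1 m) by apply: isdist_xw.
rewrite lerBrDr -lerBrDl -(PrC hx).
pose ch (c : conf M d0.-1 m.+1) := [exists j, (c j).1 lst].
pose good (c : conf M d0.-1 m.+1) := ~~ ch c && ~~ exits c (nobits M) lst.
have -> : Pr (@xw R M p d0.-1 m.+1) (predC (bad_conf (d0 := d0) lst)) =
   Pr (@bitsw R M p) (none (enum 'I_M)) * Pr (@wt R M p d0.-1 m.+1) good.
  rewrite -Pr_pair; apply: eq_Pr => z.
  have e : none (enum 'I_M) z.1 = ~~ [exists i, z.1 i].
    apply/allP/existsPn => [nb i|nb i _]; last exact: nb.
    by apply: nb; rewrite mem_enum.
  by rewrite e /good -!negb_or.
rewrite (@Pr_none R M p p01 (enum (ordinal M))) ?enum_uniq // size_enum_ord qX.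
have -> : M%:R * h = T by rewrite mulrC divfK // pnatr_eq0 -lt0n.
apply: ler_wpM2l; first exact: expR_ge0.
have h1 : Pr (@wt R M p d0.-1 m.+1) (fun y => ~~ exits y (nobits M) lst) <=
   Pr (@wt R M p d0.-1 m.+1) good + Pr (@wt R M p d0.-1 m.+1) ch.
  apply: (Pr_orb hw) => c nc; rewrite /good nc andbT; by case: (ch c).
have h2 : Pr (@wt R M p d0.-1 m.+1) ch <= d0.-1%:R * p.
  apply: le_trans (Pr_union (r := enum 'I_d0.-1) (Q := fun j (c : conf M d0.-1 m.+1) => (c j).1 lst) hw _) _.
    by move=> c /existsP [j cj]; exists j => //; rewrite mem_enum.
  rewrite big_enum /= (eq_bigr (fun=> p)); first by rewrite sumr_const card_ord mulr_natl.
  move=> j _.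
  have -> : Pr (@wt R M p d0.-1 m.+1) (fun c : conf M d0.-1 m.+1 => (c j).1 lst) =
    Pr (prodw (@xw R M p d0.-1 m)) (fun x : {ffun 'I_d0.-1 -> bits M * conf M d0.-1 m} =>
      [forall i, (i == j) ==> (x i).1 lst]).
    apply: eq_Pr => c; apply/idP/forallP => [cj i|/(_ j)]; last by rewrite eqxx.
    by apply/implyP => /eqP ->.
  rewrite (Pr_prod _ (fun i (x : bits M * conf M d0.-1 m) => (i == j) ==> x.1 lst)).
  rewrite (bigD1 j) //= eqxx big1 ?mulr1.
    rewrite (Pr_xw_fst p01 d0.-1 m (fun b : bits M => b lst)).
    rewrite -[RHS](@Pr_bit R M p p01 lst true); apply: eq_Pr => b; by rewrite eqb_id.
  move=> i /negbTE ->; rewrite /Pr /=; exact: (Ex_cst hxm).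
have : d0.-1%:R * p <= d0.-1%:R * h by apply: ler_wpM2l => //; apply: pbar_le.
lra.
Qed.

(** * Choice of the mesh and conclusion *)

Section Main.
Context {R : realType} (d0 : nat) {dO : measure_display} {Omega : measurableType dO}.
Variables (P : probability Omega R) (N : tvert d0 -> Omega -> R -> nat) (T : R).
Hypothesis H : poisson_clocks P N.
Hypothesis T0 : 0 < T.
Hypothesis d2 : (1 < d0.-1)%N.
Variable s0 : R.
Hypothesis s00 : 0 < s0.
Variable M00 : nat.
Hypothesis surv : forall M, (M00 <= M)%N -> forall n (c : 'I_M),
  s0 <= Pr (@wt R M (pbar (T / M%:R)) d0.-1 n) (fun y => ~~ exits y (nobits M) c).

Let cE n : R := ((size (edges d0 n)) + (size (edges d0 n)) ^ 2)%:R * T ^+ 2.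
(** Three demands on the mesh: [surv] applies, some child rings in a given cell with probability at
    most [s0 / 2], and collisions up to level [n] have probability at most [n.+1%:R^-1]. *)
Let K n := (M00 + Num.truncn (2 * (d0.-1%:R * T) / s0 + n.+1%:R * cE n))%N.

Let cE0 n : 0 <= cE n. Proof. by rewrite mulr_ge0 ?exprn_ge0 // ltW. Qed.
Let dT0 : 0 <= 2 * (d0.-1%:R * T) / s0.
Proof. by rewrite divr_ge0 ?mulr_ge0 // ltW. Qed.

Lemma K_gt n : 2 * (d0.-1%:R * T) / s0 + n.+1%:R * cE n < (K n).+1%:R.
Proof.
apply: lt_le_trans (truncnS_gt _) _; by rewrite ler_nat ltnS leq_addl.
Qed.

Lemma pr_usepK n : pr P (usep N T (K n).+1 n) <= n.+1%:R^-1.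
Proof.
apply: le_trans (pr_usep H T0 _ n) _ => //; rewrite ler_pdivrMr ?ltr0n //.
rewrite [leRHS]mulrC ler_pdivlMr ?ltr0n // [leLHS]mulrC.
apply: ltW; apply: le_lt_trans (K_gt n); by rewrite lerDr.
Qed.

Lemma inv_small (eta : R) : 0 < eta -> exists n1, forall n, (n1 <= n)%N -> n.+1%:R^-1 <= eta.
Proof.
move=> e0; exists (Num.truncn eta^-1) => n hn.
rewrite -[leRHS]invrK lef_pV2 ?posrE ?invr_gt0 ?ltr0n //.
by apply: ltW; apply: lt_le_trans (truncnS_gt _) _; rewrite ler_nat.
Qed.

Lemma negligible_sep : P.-negligible [set om | ~ forall n0, exists2 n, (n0 <= n)%N & sepn N om T K n].
Proof.
apply: liminf_negligible => eta e0; exists (fun n => usep N T (K n).+1 n); split.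
- move=> n; exact: (measurable_usep T H).
- move=> om /existsNP [n0 nex]; exists n0 => n hn; apply: usepP => sp.
  by apply: nex; exists n.
- have [n1 h] := inv_small e0; exists n1 => n /h; exact: le_trans (pr_usepK n).
Qed.

Definition gchain om (x : tvert d0) :=
  exists k n, [/\ (size x + k <= n)%N, sepn N om T K n & nochain N om T K k n x].

Lemma negligible_chain x : P.-negligible [set om | ~ gchain om x].
Proof.
apply: liminf_negligible => eta e0.
have [k hk] : exists k, exp_coeff (d0.-1.+1%:R * T) k <= eta / 3.
  have /cvgrPdist_le := cvg_series_cvg_0 (is_cvg_series_exp_coeff (d0.-1.+1%:R * T)).
  have e3 : 0 < eta / 3 by rewrite divr_gt0.
  move=> /(_ _ e3) [k _ hk]; exists k; have := hk k (leqnn k).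
  by rewrite /= sub0r normrN; apply: le_trans; apply: ler_norm.
pose U n := usep N T (K n).+1 n `|` (uchain N T (K n).+1 (iota 0 (K n).+1) k x `|`
    uchain N T (K n).+1 (rev (iota 0 (K n).+1)) k x).
have mU s n : measurable (uchain N T (K n).+1 s k x) by apply: (measurable_uchain T H).
exists U; split.
- by move=> n; apply: measurableU; [exact: (measurable_usep T H)|exact: measurableU].
- move=> om ng; exists (size x + k)%N => n hn; apply: contrapT => nU; apply: ng.
  exists k, n; split=> //.
    by apply: contrapT => /usepP us; apply: nU; left.
  by split=> /chain_uchain c; apply: nU; right; [left|right].
- have e3 : 0 < eta / 3 by rewrite divr_gt0.
  have [n1 h] := inv_small e3; exists n1 => n /h hn.
  apply: le_trans (prU_le _ _ _) _; [exact: (measurable_usep T H)|exact: measurableU|].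
  have c1 : pr P (uchain N T (K n).+1 (iota 0 (K n).+1) k x) <= eta / 3.
    by apply: le_trans hk; apply: (pr_uchain H T0 (M := (K n).+1)) => //; rewrite ?iota_uniq ?size_iota.
  have c2 : pr P (uchain N T (K n).+1 (rev (iota 0 (K n).+1)) k x) <= eta / 3.
    apply: le_trans hk; apply: (pr_uchain H T0 (M := (K n).+1)) => //.
      by rewrite rev_uniq iota_uniq.
    by rewrite size_rev size_iota.
  have c3 := le_trans (prU_le P (mU _ n) (mU _ n)) (lerD c1 c2).
  apply: le_trans (lerD (le_trans (pr_usepK n) hn) c3) _; lra.
Qed.

Lemma negligible_chains : P.-negligible [set om | ~ forall x, gchain om x].
Proof.
pose F k := if unpickle k is Some x then [set om | ~ gchain om (x : seq 'I_d0.-1)] else set0.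
apply: (@negligibleS _ _ _ _ (\bigcup_k F k)).
  move=> om /existsNP [x nx]; exists (pickle (x : seq 'I_d0.-1)) => //.
  by rewrite /F pickleK.
apply: negligible_bigcup => k; rewrite /F; case: unpickle => [x|]; first exact: negligible_chain.
exact: negligible_set0.
Qed.

Lemma negligible_nocycle : P.-negligible [set om |
  [/\ forall n0, exists2 n, (n0 <= n)%N & sepn N om T K n, forall x, gchain om x &
   ~ stirring_infinite_cycle N om T]].
Proof.
apply: liminf_negligible => eta e0.
pose r := 1 - expR (- T) * (s0 / 2).
have s02 : 0 < s0 / 2 by rewrite divr_gt0.
have r1 : r < 1 by rewrite /r ltrBlDr ltrDl mulr_gt0 // expR_gt0.
have dK n : d0.-1%:R * (T / (K n).+1%:R) <= s0 / 2.
  rewrite mulrA ler_pdivrMr ?ltr0n //; have := K_gt n.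
  have : 0 <= n.+1%:R * cE n by apply: mulr_ge0.
  move=> a b; have : 2 * (d0.-1%:R * T) / s0 < (K n).+1%:R by lra.
  rewrite ltr_pdivrMr // => c; lra.
have bad_r n m : Pr (@xw R (K n).+1 (pbar (T / (K n).+1%:R)) d0.-1 m.+1)
    (bad_conf (d0 := d0) ord_max) <= r.
  apply: Pr_bad_conf => //; apply: surv; by rewrite /K leqW // leq_addr.
have hx n m : isdist (@xw R (K n).+1 (pbar (T / (K n).+1%:R)) d0.-1 m).
  by apply: isdist_xw; apply: pbar01; rewrite divr_ge0 // ltW.
have r0 : 0 <= r by apply: le_trans (bad_r 0%N 0%N); apply: (Pr_ge0 (hx _ _)).
(* Level [L.+1] has [d0.-1 ^ L.+1], hence at least [L.+1], vertices, which are bad independently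
   with probability at most [r] each. *)
have [L hL] : exists L, r ^+ L.+1 <= eta / 2.
  have : `|r| < 1 by rewrite ger0_norm.
  move=> /cvg_expr /cvgrPdist_le; have e2 : 0 < eta / 2 by rewrite divr_gt0.
  move=> /(_ _ e2) [L _ h]; exists L; have := h L.+1 (leqnSn L).
  by rewrite /= sub0r normrN; apply: le_trans; apply: ler_norm.
pose I := L.+1.-tuple 'I_d0.-1.
pose v (i : I) : tvert d0 := tval i.
pose X n om := [ffun i : I => xconfOf N om T (K n).+1 (n - L.+2).+1 (v i)].
pose D n (c : {ffun I -> bits (K n).+1 * conf (K n).+1 d0.-1 (n - L.+2).+1}) :=
  [forall i, bad_conf ord_max (c i)].
have law n := law_family H T0 (M := (K n).+1) isT (v := v) (L := L) (m := (n - L.+2).+1)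
  (@val_inj _ _ _) (fun i => size_tuple i).
have lawD n := pr_finType (P := P) (X := X n) (w := prodw (xw (pbar (T / (K n).+1%:R)) (d := d0.-1) (n := (n - L.+2).+1)))
  (D n) (fun c => (law n c).1) (fun c => (law n c).2).
exists (fun n => usep N T (K n).+1 n `|` [set om | D n (X n om)]); split.
- by move=> n; apply: measurableU; [exact: (measurable_usep T H)|exact: (lawD n).1].
- move=> om [gs gc nic].
  have bad x : exists n0, forall n, (n0 <= n)%N -> sepn N om T K n -> bad_stage N om T K n x.
    apply: no_cycle_bad => //; first by move=> e s t; apply: (Nmono_om H).
    by case: H => _ [_ [Hr _]] e t; apply: Hr.
  pose n0 i := projT1 (cid (bad (v i))).
  exists (\max_i n0 i)%N => n hn.
  have [sp|nsp] := pselect (sepn N om T K n); last by left; apply: usepP.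
  right; apply/forallP => i; rewrite ffunE.
  have bs : bad_stage N om T K n (v i).
    apply: (projT2 (cid (bad (v i)))) sp; apply: leq_trans hn; exact: (leq_bigmax i).
  by move: bs; rewrite /bad_stage (_ : size (v i) = L.+1) //; apply: size_tuple.
- have e2 : 0 < eta / 2 by rewrite divr_gt0.
  have [n1 h] := inv_small e2; exists n1 => n /h hn.
  apply: le_trans (prU_le _ _ _) _; [exact: (measurable_usep T H)|exact: (lawD n).1|].
  have h1 := pr_usepK n.
  have h2 : pr P [set om | D n (X n om)] <= eta / 2.
    rewrite (lawD n).2 /D (Pr_prod _ (fun i => bad_conf (d0 := d0) ord_max)).
    rewrite prodr_const; apply: le_trans hL; set c := #|_|.
    have hc : (L.+1 <= c)%N.
      by rewrite /c card_tuple card_ord; apply: ltnW; apply: ltn_expl.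
    apply: (@le_trans _ _ (r ^+ c)); last by apply: ler_wiXn2l => //; exact: ltW.
    by apply: lerXn2r; rewrite ?nnegrE //; apply: (Pr_ge0 (hx _ _)).
  apply: le_trans (lerD (le_trans h1 hn) h2) _; lra.
Qed.

Lemma infinite_cycle_ae : {ae P, forall om, stirring_infinite_cycle N om T}.
Proof.
apply: (negligibleS _ (negligibleU negligible_sep (negligibleU negligible_chains negligible_nocycle))).
move=> om /= nic.
have [gs|gs] := pselect (forall n0, exists2 n, (n0 <= n)%N & sepn N om T K n); last by left.
have [gc|gc] := pselect (forall x, gchain om x); last by right; left.
by right; right.
Qed.

End Main.

Lemma in_scrT_of_regime (R : realType) (d0 : nat) (T : R) : (100 < d0)%N ->
  0 < T /\ (((100 <= d0.-1)%N /\ 20 <= d0.-1%:R * T) \/ [/\ d0.-1%:R * T <= 20, T <= 1 &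
  1 < d0.-1%:R * T * (1 - T) * (1 - d0.-1%:R * T ^+ 2 / 6)]) ->
  in_scrT d0 T.
Proof.
move=> hd [T0 hr]; have d2 : (1 < d0.-1)%N.
  by case: (d0) hd => // d; rewrite ltnS; apply: leq_trans.
split=> // dO Omega P N HN.
have [s0 s00 [M00 surv]] := discrete_survival T0 hr.
exact: (infinite_cycle_ae HN T0 d2 s00 surv).
Qed.

Theorem theorem4 (R : realType) :
  (forall d0 : nat, (2 <= d0)%N -> (1287 <= d0)%N ->
     forall T : R, d0%:R^-1 + 3 * d0%:R^-2 <= T -> in_scrT d0 T) /\
  (forall eps : R, 0 < eps -> exists d0' : nat,
     forall d0 : nat, (2 <= d0)%N -> (d0' <= d0)%N ->
     forall T : R, d0%:R^-1 + (13%:R / 6%:R + eps) * d0%:R^-2 <= T ->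
       in_scrT d0 T).
Proof.
split=> [d0 _ hd T hT|eps e0].
  by apply: in_scrT_of_regime; [apply: leq_trans hd|apply: regime3].
have [d0' h] := regime_eps e0; exists d0' => d0 _ /h [hd hT] T /hT.
exact: in_scrT_of_regime.
Qed.
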